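(* For all $n\ge1$ and $\lambda=(\lambda_1,\dots,\lambda_n)\in\mathbb R^n$, the following hold. 1) For each $\sigma\subset\{1,\dots,n\}$ there exists a polynomial $R_{n,\sigma}$ of $n$ variables (chosen independently of $\lambda$ and $\epsilon$) such that for all $x$ with $\sigma(x)=\sigma$ we have the following estimate: for some $c^*>0$, $$\big|\Psi^{(n)}_{i\lambda,\epsilon}(x)\big|\le R_{n,\sigma(x)}(x)\prod_{i\in\sigma(x)}\exp\{-c^*e^{-(x_i-x_{i+1})/2}\},\qquad x_{n+1}=0.$$ 2) For $x$ varying in a compact domain, $\Psi^{(n)}_{i\lambda,\epsilon}(x)$ converges, as $\epsilon$ goes to zero, uniformly to $\Psi^{\mathfrak{so}_{2n+1}}_{i\lambda}(x)$.
   Context: **The polynomials $\mathcal P^{(n)}_z$.** $(x;q)_m=\prod_{k=0}^{m-1}(1-xq^k)$, $\binom{m}{k}_q=\frac{(q;q)_m}{(q;q)_k(q;q)_{m-k}}$, $|z|=\sum_i z_i$. $\Lambda_n=\{z\in\mathbb Z^n:z_1\ge\dots\ge z_n\ge0\}$. Write $\nu\preceq\mu$ if $\mu_1\ge\nu_1\ge\mu_2\ge\nu_2\ge\cdots$. For $q\in(0,1)$, $a\in(\mathbb C\setminus\{0\})^n$: $\mathcal P^{(1)}_{z}(a_1;q)=\sum_{m=0}^{z}\binom zm_q a_1^{2m-z}$ and, for $n\ge2$, $$\mathcal P^{(n)}_\lambda(a_1,\dots,a_n;q)=\sum_{\nu\in\Lambda_{n-1}}Q^{(n-1,n)}_{a_n,q}(\nu,\lambda)\,\mathcal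 P^{(n-1)}_\nu(a_1,\dots,a_{n-1};q),$$ $$Q^{(n-1,n)}_{a_n,q}(\nu,\lambda)=\sum_{\mu\in\Lambda_n:\ \nu\preceq\mu\preceq\lambda}a_n^{2|\mu|-|\nu|-|\lambda|}\prod_{i=1}^{n-1}\binom{\lambda_i-\lambda_{i+1}}{\lambda_i-\mu_i}_q\binom{\mu_i-\mu_{i+1}}{\mu_i-\nu_i}_q\binom{\lambda_n}{\lambda_n-\mu_n}_q.$$ **Scaling.** $\epsilon>0$ is a scaling parameter (tending to $0$). Set $q=e^{-\epsilon}$, $a_l=e^{\mathrm i\epsilon\lambda_l}$ ($1\le l\le n$), $m(\epsilon)=-[\epsilon^{-1}\log\epsilon]$ ($[\cdot]$ integer part), $\mathcal A(\epsilon)=-\frac{\pi^2}{6\epsilon}-\frac12\log\frac{\epsilon}{2\pi}$, and, for $x\in\mathbb R^n$, $z_i=\epsilon^{-1}x_i+(2n-2(i-1))m(\epsilon)$ for $1\le i\le n$. Then $$\Psi^{(n)}_{i\lambda,\epsilon}(x)=\epsilon^{n^2}e^{n^2\mathcal A(\epsilon)}\mathcal P^{(n)}_z(a;q),$$ for those $x$ for which $z\in\Lambda_n$ (in particular $x\in\epsilon\mathbb Z^n$). For $x\in\mathbb R^n$, $\sigma(x)=\{1\le i\le n:x_i\le x_{i+1}\}$ with $x_{n+1}=0$. The $i$ in the subscript $i\lambda$ and in $a_l$ is the imaginary unit. **The $\mathfrak{so}_{2n+1}$-Whittaker function.** For $\lambda\in\mathbb C^n$, $x\in\mathbb R^n$,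 $$\Psi^{\mathfrak{so}_{2n+1}}_\lambda(x)=\int\prod_{k=1}^{2n-1}\prod_{i=1}^{[\frac{k+1}2]}dx^k_i\;e^{\mathcal F_\lambda(\mathbf x)},$$ where the integration is over all real arrays $\mathbf x=(x^1,\dots,x^{2n})$, $x^k\in\mathbb R^{[\frac{k+1}2]}$, with $x^{2n}=x$ fixed, and (with $|x^0|=0$) $$\mathcal F_\lambda(\mathbf x)=\sum_{k=1}^n\lambda_k(2|x^{2k-1}|-|x^{2k}|-|x^{2k-2}|)-\sum_{k=1}^n\Big(\sum_{i=1}^{k-1}(e^{x^{2k-1}_i-x^{2k}_i}+e^{x^{2k}_{i+1}-x^{2k-1}_i})+(e^{-x^{2k-1}_k}+e^{x^{2k-1}_k-x^{2k}_k})+\sum_{i=1}^{k-1}(e^{x^{2k-1}_{i+1}-x^{2k-2}_i}+e^{x^{2k-2}_i-x^{2k-1}_i})\Big).$$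
   Formalization: The estimate in 1) is stated for all sufficiently small ε (0<ε<ε₀, with ε₀ depending only on n and σ); for arbitrary ε>0 it fails, e.g. n=1, x=0, ε→∞, where Ψ=√(2πε)e^{-π²/(6ε)} is unbounded. *)

(* Defs.v *)
From HB Require Import structures.
From mathcomp Require Import all_boot all_order all_algebra.
From mathcomp Require Import all_classical all_reals all_analysis.
From mathcomp Require Import complex.

Set Implicit Arguments.
Unset Strict Implicit.
Unset Printing Implicit Defensive.

Import Order.TTheory GRing.Theory Num.Theory numFieldNormedType.Exports.

Local Open Scope classical_set_scope.
Local Open Scope ring_scope.
Local Open Scope complex_scope.

(* Coordinates are numbered from 1, and v_i = 0 for i outside {1, ..., n};
   in particular v_(n+1) = 0. *)
Definition crd {V : nmodType} {n : nat} (v : 'rV[V]_n) (i : nat) : V :=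
  if i is j.+1 then (if insub j is Some k then v ord0 k else 0) else 0.

Definition vsum {V : nmodType} {n : nat} (v : 'rV[V]_n) : V :=
  \sum_(i < n) v ord0 i.

Definition Lambda (n : nat) : set 'rV[int]_n :=
  [set z | (forall i, (1 <= i < n)%N -> crd z i.+1 <= crd z i) /\
           (forall i, (1 <= i <= n)%N -> 0 <= crd z i)].

(* mu_1 >= nu_1 >= mu_2 >= nu_2 >= ..., both sequences being extended by 0. *)
Definition interlace {p n : nat} (nu : 'rV[int]_p) (mu : 'rV[int]_n) : Prop :=
  forall i, (1 <= i)%N -> crd nu i <= crd mu i /\ crd mu i.+1 <= crd nu i.

Section qPolynomials.
Variable R : realType.

Definition qpoch (x q : R) (m : nat) : R := \prod_(k < m) (1 - x * q ^+ k).

Definition qbinom (q : R) (m k : nat) : R :=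
  qpoch q q m / (qpoch q q k * qpoch q q (m - k)).

(* Q^(p,p+1)_(a,q)(nu, lam).  In Qker and Ppoly the differences inside the
   q-binomials are nonnegative on the range of summation, so that the absolute
   value |.|%N : int -> nat is the identity there. *)
Definition Qker (p : nat) (a : R[i]) (q : R)
    (nu : 'rV[int]_p) (lam : 'rV[int]_p.+1) : R[i] :=
  \sum_(mu \in [set mu : 'rV[int]_p.+1 |
                 Lambda mu /\ interlace nu mu /\ interlace mu lam])
    a ^ (2 * vsum mu - vsum nu - vsum lam) *
    ((\prod_(1 <= i < p.+1)
        (qbinom q `|crd lam i - crd lam i.+1|%N `|crd lam i - crd mu i|%N *
         qbinom q `|crd mu i - crd mu i.+1|%N `|crd mu i - crd nu i|%N)) *
     qbinom q `|crd lam p.+1|%N `|crd lam p.+1 - crd mu p.+1|%N)%:C.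

(* The case n = 0 is a dummy value. *)
Fixpoint Ppoly (q : R) (n : nat) : 'rV[R[i]]_n -> 'rV[int]_n -> R[i] :=
  if n is p.+1 then fun a z =>
    if p == 0%N then
      \sum_(0 <= m < `|crd z 1|%N.+1)
        (qbinom q `|crd z 1|%N m)%:C * crd a 1 ^ (2 * m%:Z - crd z 1)
    else
      \sum_(nu \in @Lambda p)
        Qker (crd a p.+1) q nu z *
        Ppoly q (\row_(i < p) crd a i.+1) nu
  else fun _ _ => 1.

End qPolynomials.

Section Scaling.
Variable R : realType.

Definition cexp (z : R[i]) : R[i] :=
  (expR (complex.Re z))%:C * (cos (complex.Im z) +i* sin (complex.Im z)).

Definition mscale (eps : R) : int := - Num.floor (eps^-1 * ln eps).

Definition Ascale (eps : R) : R :=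
  - (pi ^+ 2 / (6 * eps)) - 2^-1 * ln (eps / (2 * pi)).

Definition zscale (n : nat) (eps : R) (x : 'rV[R]_n) : 'rV[R]_n :=
  \row_(i < n) (eps^-1 * crd x i.+1 +
                (2 * n%:Z - 2 * (i : nat)%:Z)%:~R * (mscale eps)%:~R).

Definition scaled_dom (n : nat) (eps : R) : set 'rV[R]_n :=
  [set x | exists2 z : 'rV[int]_n,
             Lambda z & zscale eps x = \row_(i < n) (crd z i.+1)%:~R].

(* Psi^(n)_(i lambda, eps)(x); meaningful for x in scaled_dom n eps, where
   floor merely reads the coordinates of zscale eps x as integers. *)
Definition Psi_eps (n : nat) (lam : 'rV[R]_n) (eps : R) (x : 'rV[R]_n) : R[i] :=
  (eps ^+ (n ^ 2) * expR ((n ^ 2)%:R * Ascale eps))%:C *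
  Ppoly (expR (- eps))
        (\row_(l < n) cexp (0 +i* (eps * crd lam l.+1)))
        (\row_(i < n) Num.floor (crd (zscale eps x) i.+1)).

Definition sigma (n : nat) (x : 'rV[R]_n) : {set 'I_n} :=
  [set i : 'I_n | crd x i.+1 <= crd x i.+2]%SET.

End Scaling.

(* The m-fold product of a sigma-finite measure mu, on m.-tuple T. *)
Section MeasurePower.
Context d (T : measurableType d) (R : realType).
Local Open Scope ereal_scope.

Definition tcons (m : nat) (p : T * m.-tuple T) : m.+1.-tuple T :=
  [tuple of p.1 :: p.2].

Definition tuncons (m : nat) (t : m.+1.-tuple T) : T * m.-tuple T :=
  (thead t, [tuple of behead t]).

Lemma measurable_tcons m : measurable_fun [set: T * m.-tuple T] (@tcons m).
Proof. exact: measurable_cons. Qed.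

Lemma measurable_tuncons m : measurable_fun [set: m.+1.-tuple T] (@tuncons m).
Proof.
apply: measurable_fun_pair; [exact: measurable_tnth | exact: measurable_behead].
Qed.

Lemma tconsK m : cancel (@tcons m) (@tuncons m).
Proof. by move=> [a t]; congr pair; apply: val_inj. Qed.

Section Step.
Variables (mu : {sigma_finite_measure set T -> \bar R}).
Variables (m : nat) (nu : {sigma_finite_measure set (m.-tuple T) -> \bar R}).

Definition measure_cons : set (m.+1.-tuple T) -> \bar R :=
  pushforward (mu \x nu) (@tcons m).

Let measure_cons0 : measure_cons set0 = 0.
Proof. by rewrite /measure_cons /pushforward preimage_set0 measure0. Qed.

Let preimage_tcons A : measurable A -> measurable (@tcons m @^-1` A).
Proof. by move=> mA; rewrite -[X in measurable X]setTI; exact: measurable_tcons. Qed.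

Let measure_cons_ge0 A : 0 <= measure_cons A.
Proof. by rewrite /measure_cons /pushforward; exact: measure_ge0. Qed.

Let measure_cons_sigma_additive : semi_sigma_additive measure_cons.
Proof.
move=> F mF tF mUF; rewrite /measure_cons /pushforward preimage_bigcup.
apply: measure_semi_sigma_additive.
- by move=> k; exact: preimage_tcons.
- apply/trivIsetP => /= i j _ _ ij; rewrite -preimage_setI.
  by move/trivIsetP : tF => /(_ _ _ _ _ ij) ->//; rewrite preimage_set0.
- by rewrite -preimage_bigcup; exact: preimage_tcons.
Qed.

HB.instance Definition _ := isMeasure.Build _ _ _
  measure_cons measure_cons0 measure_cons_ge0 measure_cons_sigma_additive.

Lemma measure_cons_sigma_finite : sigma_finite setT measure_cons.
Proof.
have /sigma_finiteP[F [FT ndF mF]] := sigma_finiteT mu.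
have /sigma_finiteP[G [GT ndG mG]] := sigma_finiteT nu.
exists (fun k => @tuncons m @^-1` (F k `*` G k)) => [|k].
  rewrite -preimage_bigcup (_ : \bigcup_k _ = setT) ?preimage_setT//.
  apply/seteqP; split => // -[x y] _.
  have [i _ Fix] : (\bigcup_i F i) x by rewrite -FT.
  have [j _ Gjy] : (\bigcup_i G i) y by rewrite -GT.
  exists (maxn i j) => //; split => /=.
  - by move: Fix; exact/subsetPset/ndF/leq_maxl.
  - by move: Gjy; exact/subsetPset/ndG/leq_maxr.
have [? ?] := mF k; have [? ?] := mG k; split.
  rewrite -[X in measurable X]setTI; apply: measurable_tuncons => //.
  exact: measurableX.
rewrite /measure_cons /pushforward -comp_preimage.
rewrite (_ : _ \o _ = id); last by apply/funext => p /=; rewrite tconsK.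
by rewrite preimage_id product_measure1E// lte_mul_pinfty// ge0_fin_numE.
Qed.

HB.instance Definition _ :=
  Measure_isSigmaFinite.Build _ _ _ measure_cons measure_cons_sigma_finite.

End Step.

Fixpoint measure_pow (mu : {sigma_finite_measure set T -> \bar R}) (m : nat) :
    {sigma_finite_measure set (m.-tuple T) -> \bar R} :=
  match m return {sigma_finite_measure set (m.-tuple T) -> \bar R} with
  | 0 => dirac ([tuple] : 0.-tuple T)
  | p.+1 => measure_cons mu (measure_pow mu p)
  end.

End MeasurePower.

Section Whittaker.
Variable R : realType.

Local Notation RT := (measurableTypeR R).

Definition cintegral d (T : measurableType d) (mu : {measure set T -> \bar R})
    (f : T -> R[i]) : R[i] :=
  (\int[mu]_t complex.Re (f t)) +i* (\int[mu]_t complex.Im (f t)).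

(* Number of real variables x^j_i, 1 <= j < k, 1 <= i <= [(j+1)/2]; note that
   uphalf j = [(j+1)/2]. *)
Definition woffset (k : nat) : nat := (\sum_(1 <= j < k) uphalf j)%N.

(* x^k_i (1 <= i <= [(k+1)/2]) for the array whose last row x^(2n) is x and whose
   rows x^1, ..., x^(2n-1) are listed one after the other in t. *)
Definition warray (n : nat) (x : 'rV[R]_n) (t : (woffset n.*2).-tuple RT)
    (k i : nat) : R :=
  if k == n.*2 then crd x i else nth (0 : R) t (woffset k + i.-1).

(* F_lam at the array X k i = x^k_i. *)
Definition wpotential (n : nat) (lam : 'rV[R[i]]_n) (X : nat -> nat -> R) : R[i] :=
  let S k := \sum_(1 <= i < (uphalf k).+1) X k i in
  \sum_(1 <= k < n.+1)
     crd lam k * (2 * S (2 * k - 1)%N - S (2 * k)%N - S (2 * k - 2)%N)%:C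
  - (\sum_(1 <= k < n.+1)
      (\sum_(1 <= i < k)
          (expR (X (2 * k - 1)%N i - X (2 * k)%N i) +
           expR (X (2 * k)%N i.+1 - X (2 * k - 1)%N i))
       + (expR (- X (2 * k - 1)%N k) + expR (X (2 * k - 1)%N k - X (2 * k)%N k))
       + \sum_(1 <= i < k)
          (expR (X (2 * k - 1)%N i.+1 - X (2 * k - 2)%N i) +
           expR (X (2 * k - 2)%N i - X (2 * k - 1)%N i))))%:C.

Definition Psi_so (n : nat) (lam : 'rV[R[i]]_n) (x : 'rV[R]_n) : R[i] :=
  cintegral (measure_pow (@lebesgue_measure R) (woffset n.*2))
    (fun t => cexp (wpotential lam (warray x t))).

End Whittaker.

(* Main.v *)
Require Import Defs.
From mathcomp Require Import all_boot all_order all_algebra.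
From mathcomp Require Import all_classical all_reals all_analysis.
From mathcomp Require Import measurable_realfun complex ring lra zify.
From mathcomp Require mpoly.

Set Implicit Arguments.
Unset Strict Implicit.
Unset Printing Implicit Defensive.

Import Order.TTheory GRing.Theory Num.Theory numFieldNormedType.Exports.
Import (canonicals) mpoly.

Local Open Scope classical_set_scope.
Local Open Scope ring_scope.
Local Open Scope complex_scope.

(** Iterating the branching rule writes the polynomial as a finite sum over
    triangular arrays of integers whose last row is z, the rows
    k = 1, ..., 2n - 1 having [(k+1)/2] entries, hence n ^ 2 entries altogether
    ([Ppoly_sum]). A summand is a phase times a product of n ^ 2 q-binomials:
    the entry y of row j, lying between the entries a and b of row j + 1,
    contributes the q-binomial with parts a - y and y - b. The prefactor
    eps ^ (n ^ 2) * exp (n ^ 2 * A) is distributed evenly. Each factor eps is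
    a mesh size: with the entry (k, i) written as t / eps + (k - 2i + 2) m, where
    t runs over eps Z, the function Psi_eps is exactly the integral over
    R ^ (n ^ 2) of a step function ([Psi_eps_integral]). Each factor exp A
    normalises one q-binomial. The shifts are such that the parts of every
    q-binomial are m + u / eps and m + v / eps with u and v differences of
    adjacent real entries, so that all limits and bounds follow from those of
    one function of (u, v), called [pairwt] below.

    That function is analysed through the identity
      (q;q)_oo * qbinom (a + b) a = T a * T b / T (a + b),
    where T a is the infinite product of the 1 - q ^ k over k > a. When
    a = m + u / eps one has T a -> exp (- exp (- u)), while T (a + b) -> 1.
    There remains the constant exp A / (q;q)_oo, which tends to 1: this is the
    modular behaviour of the eta function, obtained here in an elementary way.
    Gauss's identity equates (q^2;q^2)_oo ^ 2 / (q;q)_oo with the sum of the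
    q ^ (j (j + 1) / 2), and this sum differs from a Gaussian integral by at
    most 1 ([theta_quot_asymp]). For the error c (eps) of the logarithm this
    says that 2 c (2 eps) - c (eps) tends to 0; since moreover eps * c (eps)
    tends to 0, by the value pi ^ 2 / 6 of the sum of the inverse squares, c
    itself tends to 0 ([cvg0_of_doubling]). In the limit the product of the
    exp (- exp (- u)) exp (- exp (- v)) is the exponential of the real part of
    the Whittaker potential ([Psi_soE]).

    For small eps the same formulas give
      pairwt u v <= 2 exp (- (exp (- u) + exp (- v)) / 4).
    Half of this decay is spent on the top row, where u + v = x_i - x_(i+1): it
    yields the factors exp (- c exp (- (x_i - x_(i+1)) / 2)). The other half
    confines every entry y of a row, up to a penalty, to the interval between
    its two neighbours a >= b in the row above; quantitatively a power of
    1 + y ^ 2 is bounded by the same power of (1 + a ^ 2) (1 + b ^ 2)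
    ([peetre]). Applied row by row, this bounds the integrand by a polynomial in
    x times the product of the 1 / (1 + t ^ 2) over all integration variables
    ([stepfun_bound]). Integrating gives the first claim. For the second one the
    step functions converge pointwise, uniformly for bounded x ([stepfun_near]),
    and dominated convergence applies along any sequence of values of eps and x
    ([step_integral_near]). *)

(** * Bounds for q-Pochhammer products *)

Section QAsymptotics.
Variable R : realType.
Implicit Types (q x : R) (a b m N : nat).

Lemma qpochS x q m : qpoch x q m.+1 = qpoch x q m * (1 - x * q ^+ m).
Proof. by rewrite /qpoch big_ord_recr. Qed.

Lemma qpoch0 x q : qpoch x q 0 = 1.
Proof. by rewrite /qpoch big_ord0. Qed.

Lemma qpochD x q a m : qpoch x q (a + m) = qpoch x q a * qpoch (x * q ^+ a) q m.
Proof.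
elim: m => [|m IH]; first by rewrite addn0 qpoch0 mulr1.
by rewrite addnS !qpochS IH -mulrA -mulrA -exprD.
Qed.

Lemma geometric_sum q m : 0 < q < 1 -> \sum_(k < m) q ^+ k = (1 - q ^+ m) / (1 - q).
Proof.
move=> /andP[q0 q1]; have q1' : 1 - q != 0 by rewrite subr_eq0 gt_eqF.
apply: (mulIf q1'); rewrite divfK //.
by rewrite -opprB mulrN mulrC -subrX1 opprB.
Qed.

(** The lower counterpart of 1 - x <= exp (- x), applied to 1 / (1 - x). *)
Lemma expR_le_1B x : x < 1 -> expR (- (x / (1 - x))) <= 1 - x.
Proof.
move=> x1; have h : 0 < 1 - x by rewrite subr_gt0.
rewrite expRN -[leRHS]invrK lef_pV2 ?posrE ?expR_gt0 ?invr_gt0//.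
apply: le_trans (expR_ge1Dx _); rewrite le_eqVlt; apply/orP; left; apply/eqP.
by field; rewrite gt_eqF.
Qed.

Lemma oneB_le_expR x : 1 - x <= expR (- x).
Proof. exact: expR_ge1Dx. Qed.

Lemma qpoch_gt0 x q m : 0 < q < 1 -> 0 <= x < 1 -> 0 < qpoch x q m.
Proof.
move=> /andP[q0 q1] /andP[x0 x1]; apply: prodr_gt0 => k _; rewrite subr_gt0.
apply: le_lt_trans x1; apply: ler_piMr => //.
by rewrite exprn_ile1 // ltW.
Qed.

(** Multiply 1 - y <= exp (- y) over the factors and sum the geometric series. *)
Lemma qpoch_le_expR x q m : 0 < q < 1 -> 0 <= x < 1 ->
  qpoch x q m <= expR (- (x * (1 - q ^+ m) / (1 - q))).
Proof.
move=> q01 /andP[x0 x1]; rewrite -mulrA -geometric_sum// mulr_sumr -sumrN expR_sum.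
case/andP: q01 => q0 q1.
apply: ler_prod => k _; rewrite oneB_le_expR andbT subr_ge0.
by rewrite (le_trans _ (ltW x1))// ler_piMr// exprn_ile1 // ltW.
Qed.

(** All factors satisfy 1 - y >= exp (- y / (1 - x)), because y <= x; the
    geometric series is then bounded by its full sum. *)
Lemma qpoch_ge_expR x q m : 0 < q < 1 -> 0 <= x < 1 ->
  expR (- (x / ((1 - q) * (1 - x)))) <= qpoch x q m.
Proof.
move=> q01 /andP[x0 x1]; have [q0 q1] := andP q01.
have q1' : 0 < 1 - q by rewrite subr_gt0.
have x1' : 0 < 1 - x by rewrite subr_gt0.
apply: (@le_trans _ _ (expR (\sum_(k < m) - (x * q ^+ k / (1 - x))))).
  rewrite ler_expR sumrN lerN2 -mulr_suml -mulr_sumr geometric_sum//.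
  rewrite -[leLHS]mulrA ler_wpM2l// -mulrA -invfM ler_piMl//.
    by rewrite invr_ge0 ltW// mulr_gt0.
  by rewrite gerBl exprn_ge0// ltW.
rewrite expR_sum; apply: ler_prod => k _; rewrite expR_ge0/=.
have xq : x * q ^+ k <= x by rewrite ler_piMr// exprn_ile1// ltW.
apply: le_trans (expR_le_1B (le_lt_trans xq x1)).
rewrite ler_expR lerN2 ler_wpM2l// ?mulr_ge0 ?exprn_ge0 ?(ltW q0)//.
by rewrite lef_pV2 ?posrE ?subr_gt0// ?lerB// (le_lt_trans xq).
Qed.

Definition qinf q : R := limn (qpoch q q).
(** The product (q^(a+1);q)_oo, as a quotient so that one limit serves for all a. *)
Definition qtail q a : R := qinf q / qpoch q q a.

Lemma qpoch_qq_gt0 q m : 0 < q < 1 -> 0 < qpoch q q m.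
Proof. by move=> q01; apply: qpoch_gt0 => //; case/andP: q01 => /ltW -> ->. Qed.

Lemma qpoch_nonincreasing q : 0 < q < 1 -> nonincreasing_seq (qpoch q q).
Proof.
move=> q01; apply/nonincreasing_seqP => m; rewrite qpochS ler_piMr//.
  exact/ltW/qpoch_qq_gt0.
by rewrite gerBl mulr_ge0// ?exprn_ge0//; case/andP: q01 => /ltW.
Qed.

Lemma cvg_qinf q : 0 < q < 1 -> qpoch q q @ \oo --> qinf q.
Proof.
move=> q01; apply: nonincreasing_is_cvgn; first exact: qpoch_nonincreasing.
by exists 0 => _ [m _ <-]; exact/ltW/qpoch_qq_gt0.
Qed.

Lemma qpow_lt1 q a : 0 < q < 1 -> 0 <= q ^+ a.+1 < 1.
Proof.
by move=> /andP[q0 q1]; rewrite exprn_ge0 ?exprn_ilt1// ltW.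
Qed.

Lemma qtail_ge q a : 0 < q < 1 ->
  expR (- (q ^+ a.+1 / ((1 - q) * (1 - q ^+ a.+1)))) <= qtail q a.
Proof.
move=> q01; rewrite /qtail ler_pdivlMr ?qpoch_qq_gt0//.
apply: limr_ge; first exact: cvgP (cvg_qinf q01).
near=> m.
have -> : m = (a + (m - a))%N by rewrite subnKC//; near: m; exists a.
rewrite qpochD -exprS mulrC ler_wpM2l ?(ltW (qpoch_qq_gt0 _ _))//.
by apply: qpoch_ge_expR => //; exact: qpow_lt1.
Unshelve. all: end_near. Qed.

Lemma cvg_qpow q : 0 < q < 1 -> q ^+ m @[m --> \oo] --> 0.
Proof.
move=> /andP[q0 q1]; apply: cvg_expr.
by rewrite ger0_norm// ltW.
Qed.

Lemma qtail_le q a : 0 < q < 1 -> qtail q a <= expR (- (q ^+ a.+1 / (1 - q))).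
Proof.
move=> q01; rewrite /qtail ler_pdivrMr ?qpoch_qq_gt0//.
have h m : qpoch q q (m + a) <=
   expR (- (q ^+ a.+1 * (1 - q ^+ m) / (1 - q))) * qpoch q q a.
  rewrite addnC qpochD -exprS mulrC ler_wpM2r ?(ltW (qpoch_qq_gt0 _ _))//.
  by apply: qpoch_le_expR => //; exact: qpow_lt1.
have c1 : qpoch q q (m + a) @[m --> \oo] --> qinf q.
  by rewrite (cvg_shiftn a (qpoch q q)); exact: cvg_qinf.
apply: ler_cvg_to c1 _ _; last exact: nearW h.
apply: cvgMr_tmp; apply: continuous_cvg; first exact: continuous_expR.
apply: cvgN; rewrite -[X in X / _]mulr1 -[X in _ * X / _]subr0.
exact: cvgMr_tmp (cvgMl_tmp (cvgB (cvg_cst _) (cvg_qpow q01))).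
Qed.

Lemma qinf_gt0 q : 0 < q < 1 -> 0 < qinf q.
Proof.
move=> q01; have := qtail_ge 0 q01.
by rewrite /qtail qpoch0 divr1; apply: lt_le_trans; exact: expR_gt0.
Qed.

Lemma qinf_le q a : 0 < q < 1 -> qinf q <= qpoch q q a.
Proof.
move=> q01; apply: (nonincreasing_cvgn_ge (qpoch_nonincreasing q01)).
by apply: cvgP; exact: cvg_qinf.
Qed.

Lemma qtail_gt0 q a : 0 < q < 1 -> 0 < qtail q a.
Proof. by move=> q01; rewrite divr_gt0// ?qpoch_qq_gt0 ?qinf_gt0. Qed.

Lemma qtail_le1 q a : 0 < q < 1 -> qtail q a <= 1.
Proof. by move=> q01; rewrite ler_pdivrMr ?mul1r ?qinf_le ?qpoch_qq_gt0. Qed.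

Lemma qtail_nondecreasing q a b : 0 < q < 1 -> (a <= b)%N -> qtail q a <= qtail q b.
Proof.
move=> q01 ab; rewrite ler_wpM2l ?(ltW (qinf_gt0 _))//.
by rewrite lef_pV2 ?posrE ?qpoch_qq_gt0//; exact: qpoch_nonincreasing.
Qed.

Lemma qinf_qbinom q a b : 0 < q < 1 ->
  qinf q * qbinom q (a + b) a = qtail q a * qtail q b / qtail q (a + b).
Proof.
move=> q01; rewrite /qbinom /qtail addKn; field.
by rewrite !gt_eqF// ?qinf_gt0 ?qpoch_qq_gt0.
Qed.

(** The factor at max a b is at most the one at a + b in the denominator. *)
Lemma qinf_qbinom_le q a b : 0 < q < 1 ->
  qinf q * qbinom q (a + b) a <= qtail q (minn a b).
Proof.
move=> q01; rewrite qinf_qbinom// ler_pdivrMr ?qtail_gt0//.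
wlog ab : a b / (a <= b)%N.
  move=> H; have /orP[ab|ba] := leq_total a b; first exact: H.
  by rewrite mulrC minnC addnC H.
rewrite (minn_idPl ab) ler_wpM2l ?(ltW (qtail_gt0 _ _))//.
by apply: qtail_nondecreasing => //; exact: leq_addl.
Qed.

(** * Gauss's identity for the theta series of triangular numbers *)

Definition tri (j : nat) : nat := 'C(j.+1, 2).

(** The q-Pascal rule that appends a last factor 1 + x q ^ m to a product, since
    q ^ (m - k) q ^ k = q ^ m. *)
Lemma qbinom_S q m k : 0 < q < 1 -> (k < m)%N ->
  qbinom q m.+1 k.+1 = qbinom q m k.+1 + q ^+ (m - k) * qbinom q m k.
Proof.
move=> q01 km; have [d ->] : exists d, m = (k + d).+1.
  by exists (m - k).-1; lia.
rewrite /qbinom.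
have -> : ((k + d).+2 - k.+1 = d.+1)%N by lia.
have -> : ((k + d).+1 - k.+1 = d)%N by lia.
have -> : ((k + d).+1 - k = d.+1)%N by lia.
rewrite !qpochS -!exprS.
have nz a : qpoch q q a != 0 by rewrite gt_eqF ?qpoch_qq_gt0.
have nz' a : 1 - q ^+ a.+1 != 0.
  by rewrite subr_eq0 gt_eqF//; case/andP: (qpow_lt1 a q01).
have -> : q ^+ (k + d).+2 = q ^+ d.+1 * q ^+ k.+1 by rewrite -exprD; congr (_ ^+ _); lia.
by field; rewrite !nz !nz'.
Qed.

Lemma qbinomn0 q m : 0 < q < 1 -> qbinom q m 0 = 1.
Proof. by move=> q01; rewrite /qbinom qpoch0 mul1r subn0 divff// gt_eqF ?qpoch_qq_gt0. Qed.

Lemma qbinomnn q m : 0 < q < 1 -> qbinom q m m = 1.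
Proof. by move=> q01; rewrite /qbinom subnn qpoch0 mulr1 divff// gt_eqF ?qpoch_qq_gt0. Qed.

Lemma q_binomial_theorem q x m : 0 < q < 1 ->
  \prod_(k < m) (1 + x * q ^+ k) = \sum_(k < m.+1) q ^+ 'C(k, 2) * qbinom q m k * x ^+ k.
Proof.
move=> q01; elim: m => [|m IH].
  by rewrite big_ord0 big_ord_recl big_ord0 qbinomn0// !mulr1 addr0.
rewrite big_ord_recr/= {}IH.
rewrite mulrDr mulr1 [X in X + _ = _]big_ord_recl/= [X in _ + X = _]mulrC.
rewrite [X in _ + _ * X = _]big_ord_recr/= [RHS]big_ord_recl/= [X in _ = _ + X]big_ord_recr/=.
rewrite !qbinomn0// -!addrA; congr (_ + _).
rewrite mulrDr addrA mulr_sumr -big_split/=; congr (_ + _).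
  apply: eq_bigr => k _; rewrite /bump/= add1n.
  rewrite qbinom_S//.
  have -> : q ^+ m = q ^+ (m - k) * q ^+ k by rewrite -exprD subnK// ltnW.
  rewrite binS bin1 exprD exprS; ring.
by rewrite !qbinomnn// /bump/= add1n binS bin1 exprD exprS; ring.
Qed.

Lemma bin2D a b : ('C(a + b, 2) = 'C(a, 2) + 'C(b, 2) + a * b)%N.
Proof.
elim: b => [|b IH]; first by rewrite addn0 muln0 bin0n !addn0.
by rewrite addnS !binS !bin1 IH; lia.
Qed.

Lemma bin2_sqr m : ('C(m, 2) + m + 'C(m, 2) = m * m)%N.
Proof. by elim: m => // m IH; rewrite binS bin1; lia. Qed.

(** The q-binomial theorem with 2N factors at x = q ^ (1 - N): the lower half
    of the factors, taken in reverse order, is the product of the 1 + q ^ k up to a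
    power of q, and the exponents of the sum become triangular numbers when its index is
    counted from the middle. *)
Lemma finite_gauss q N : 0 < q < 1 ->
  (\prod_(k < N) (1 + q ^+ k.+1)) * (\prod_(k < N) (1 + q ^+ k)) =
  \sum_(i < N) q ^+ tri i * qbinom q (N + N) (N - i.+1) +
  \sum_(j < N.+1) q ^+ tri j * qbinom q (N + N) (N + j).
Proof.
move=> q01; have q0 : q != 0 by rewrite gt_eqF//; case/andP: q01.
have qn0 m : q ^+ m != 0 by rewrite expf_neq0.
(* q ^ (1 - N), the value that centres the sum *)
pose x := q / q ^+ N.
have := q_binomial_theorem x (N + N) q01.
have -> : \prod_(k < N + N) (1 + x * q ^+ k) =
   (\prod_(k < N) (1 + q ^+ k.+1)) * (\prod_(k < N) (1 + q ^+ k)) / q ^+ 'C(N, 2).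
  rewrite big_split_ord/= mulrC -mulrA; congr (_ * _).
    by apply: eq_bigr => k _; rewrite exprD exprS /x; congr (_ + _); field.
  have -> : q ^+ 'C(N, 2) = \prod_(k < N) q ^+ k.
    by rewrite -bin2_sum big_mkord -prodrXr.
  rewrite -prodf_div (reindex_inj rev_ord_inj)/=; apply: eq_bigr => k _.
  have -> : q ^+ (N - k.+1) = q ^+ N / q ^+ k.+1.
    by rewrite -[in q ^+ N](subnK (ltn_ord k)) exprD mulfK.
  rewrite /x exprS; field.
  by rewrite q0 !qn0.
move/(congr1 ( *%R^~ (q ^+ 'C(N, 2)))); rewrite divfK// => ->.
rewrite -addnS big_split_ord/= mulrDl !mulr_suml; congr (_ + _).
  rewrite [LHS](reindex_inj rev_ord_inj)/=; apply: eq_bigr => i _.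
  rewrite /x expr_div_n -exprM /tri.
  case: i => i /= iN; have [m Nm] : exists m, (N = m + i.+1)%N by exists (N - i.+1)%N; lia.
  rewrite {}Nm addnK bin2D {iN}.
  apply: (mulIf (qn0 ((m + i.+1) * m)%N)).
  transitivity (q ^+ ('C(m, 2) + m + ('C(m, 2) + 'C(i.+1, 2) + m * i.+1)) * qbinom q (m + i.+1 + (m + i.+1)) m).
    by rewrite !exprD; field; exact: qn0.
  transitivity (q ^+ ('C(i.+1, 2) + (m + i.+1) * m) * qbinom q (m + i.+1 + (m + i.+1)) m).
    by congr (_ ^+ _ * _); have := bin2_sqr m; lia.
  by rewrite exprD; ring.
apply: eq_bigr => j _; rewrite /x expr_div_n -exprM /tri !bin2D.
apply: (mulIf (qn0 (N * (N + j))%N)).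
transitivity (q ^+ ('C(N, 2) + 'C(j, 2) + N * j + (N + j) + 'C(N, 2)) * qbinom q (N + N) (N + j)).
  by rewrite !exprD; field; exact: qn0.
transitivity (q ^+ ('C(j.+1, 2) + (N * (N + j))) * qbinom q (N + N) (N + j)).
  congr (_ ^+ _ * _); rewrite binS bin1. have := bin2_sqr N.
  lia.
by rewrite exprD; ring.
Qed.

(** By Gauss's identity this is the sum of the q ^ tri j over j >= 0; the two
    one-sided comparisons [theta_quot_le] and [theta_quot_ge] are used in its place. *)
Definition theta_quot q := qinf (q ^+ 2) ^+ 2 / qinf q.

Lemma sqr_lt1 q : 0 < q < 1 -> 0 < q ^+ 2 < 1.
Proof. by move=> /andP[q0 q1]; rewrite exprn_gt0// exprn_ilt1// ltW. Qed.

(** Euler: 1 + y = (1 - y ^ 2) / (1 - y). *)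
Lemma prod_1Dq q N : 0 < q < 1 ->
  \prod_(k < N) (1 + q ^+ k.+1) = qpoch (q ^+ 2) (q ^+ 2) N / qpoch q q N.
Proof.
move=> q01; apply: canRL (mulfK _) _; first by rewrite gt_eqF ?qpoch_qq_gt0.
rewrite /qpoch -big_split/=; apply: eq_bigr => k _.
by rewrite -!exprS -exprM mulnC exprM; ring.
Qed.

(** The second product differs from the first one only by its end factors, whose
    quotient 2 / (1 + q ^ N) tends to 2. *)
Lemma cvg_gauss q : 0 < q < 1 ->
  (qinf q * ((\prod_(k < N) (1 + q ^+ k.+1)) * (\prod_(k < N) (1 + q ^+ k))))
   @[N --> \oo] --> 2 * theta_quot q.
Proof.
move=> q01; have q201 := sqr_lt1 q01.
have G : (\prod_(k < N) (1 + q ^+ k.+1)) @[N --> \oo] --> qinf (q ^+ 2) / qinf q.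
  under eq_fun do rewrite prod_1Dq//.
  apply: cvgM; first exact: cvg_qinf.
  by apply: cvgV; [rewrite gt_eqF ?qinf_gt0|exact: cvg_qinf].
have E N : qinf q * ((\prod_(k < N) (1 + q ^+ k.+1)) * (\prod_(k < N) (1 + q ^+ k))) =
   (qinf q * (2 * (\prod_(k < N) (1 + q ^+ k.+1)) ^+ 2)) / (1 + q ^+ N).
  apply: canRL (mulfK _) _.
    by rewrite gt_eqF// ltr_pwDl// exprn_ge0//; case/andP: q01 => /ltW.
  rewrite -!mulrA; congr (_ * _).
  have -> : \prod_(k < N) (1 + q ^+ k) * (1 + q ^+ N) = 2 * \prod_(k < N) (1 + q ^+ k.+1).
    transitivity (\prod_(k < N.+1) (1 + q ^+ k)); first by rewrite big_ord_recr.
    by rewrite big_ord_recl/= expr0.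
  by rewrite mulrCA expr2.
under eq_fun do rewrite E.
have -> : 2 * theta_quot q = (qinf q * (2 * (qinf (q ^+ 2) / qinf q) ^+ 2)) / (1 + 0).
  by rewrite /theta_quot; field; rewrite gt_eqF ?qinf_gt0.
apply: cvgM; first apply: cvgMl_tmp; first apply: cvgMl_tmp.
  by rewrite expr2; apply: cvgM.
apply: cvgV; first by rewrite addr0 oner_eq0.
by apply: cvgD; [exact: cvg_cst|exact: cvg_qpow].
Qed.

Lemma qinf_qbinom_le1 q a b : 0 < q < 1 -> qinf q * qbinom q (a + b) a <= 1.
Proof. by move=> q01; apply: le_trans (qinf_qbinom_le _ _ _) (qtail_le1 _ _). Qed.

(** Both sums of the finite identity, multiplied by (q;q)_oo, are termwise below
    the theta series. *)
Lemma theta_quot_le q B : 0 < q < 1 ->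
  (forall J, \sum_(j < J) q ^+ tri j <= B) -> theta_quot q <= B.
Proof.
move=> q01 HB; have q0 : 0 <= q by case/andP: q01 => /ltW.
rewrite -(ler_pM2l (_ : 0 < 2)) ?ltr0n//.
rewrite [leRHS]mulrDl mul1r; apply: (ler_cvg_to (cvg_gauss q01)) (@cvg_cst _ _ _ _ _) _.
apply: nearW => N; rewrite finite_gauss// mulrDr; apply: lerD; rewrite mulr_sumr.
  apply: le_trans (HB N); apply: ler_sum => i _.
  rewrite mulrCA ler_piMr ?exprn_ge0//.
  have -> : (N + N = (N - i.+1) + (N + i.+1))%N by have := ltn_ord i; lia.
  exact: qinf_qbinom_le1.
apply: le_trans (HB N.+1); apply: ler_sum => i _.
rewrite mulrCA ler_piMr ?exprn_ge0//.
have -> : (N + N = (N + i) + (N - i))%N by have := ltn_ord i; lia.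
exact: qinf_qbinom_le1.
Qed.

(** The denominator is at most 1 and both numerators are at least the one at c. *)
Lemma qinf_qbinom_ge q a b c : 0 < q < 1 -> (c <= a)%N -> (c <= b)%N ->
  qtail q c ^+ 2 <= qinf q * qbinom q (a + b) a.
Proof.
move=> q01 ca cb; rewrite qinf_qbinom// ler_pdivlMr ?qtail_gt0//.
apply: (@le_trans _ _ (qtail q c ^+ 2)).
  by rewrite ler_piMr ?qtail_le1 ?exprn_ge0 ?(ltW (qtail_gt0 _ _)).
by rewrite expr2 ler_pM// ?qtail_nondecreasing ?(ltW (qtail_gt0 _ _)).
Qed.

Lemma cvg_qtail q : 0 < q < 1 -> qtail q m @[m --> \oo] --> (1 : R).
Proof.
move=> q01; rewrite -(@divff _ (qinf q)) ?gt_eqF ?qinf_gt0//.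
apply: cvgMl_tmp; apply: cvgV; first by rewrite gt_eqF ?qinf_gt0.
exact: cvg_qinf.
Qed.

(** Of each of the two sums of the finite identity only the first J terms are kept;
    their q-binomials, multiplied by (q;q)_oo, tend to 1 as N grows. *)
Lemma theta_quot_ge q J : 0 < q < 1 -> \sum_(j < J) q ^+ tri j <= theta_quot q.
Proof.
move=> q01; have q0 : 0 <= q by case/andP: q01 => /ltW.
rewrite -(ler_pM2l (_ : 0 < 2)) ?ltr0n//; set S := \sum_(j < J) _.
have c1 : 2 * (qtail q (N - J) ^+ 2 * S) @[N --> \oo] --> 2 * (1 ^+ 2 * S).
  apply: cvgMl_tmp; apply: cvgMr_tmp; rewrite expr2.
  have c : qtail q (N - J) @[N --> \oo] --> (1 : R).
    rewrite -(cvg_shiftn J (fun N => qtail q (N - J))).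
    by under eq_fun do rewrite addnK; exact: cvg_qtail.
  exact: cvgM.
rewrite -[S]mul1r -[X in X * S](expr1n _ 2).
apply: ler_cvg_to c1 (cvg_gauss q01) _; near=> N.
have JN : (J <= N)%N by near: N; exists J.
rewrite finite_gauss// mulrDr [leLHS]mulrDl mul1r !mulr_sumr; apply: lerD.
  rewrite [leRHS](bigID (fun i : 'I_N => (i < J)%N))/= -[leLHS]addr0; apply: lerD.
  - rewrite (big_ord_narrow JN); apply: ler_sum => i _.
    rewrite mulrC [leRHS]mulrCA ler_wpM2l ?exprn_ge0//.
    have -> : (N + N = (N - i.+1) + (N + i.+1))%N by have := ltn_ord i; lia.
    by apply: qinf_qbinom_ge => //; have := ltn_ord i; lia.
  - apply: sumr_ge0 => i _; rewrite mulrCA mulr_ge0 ?exprn_ge0//.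
    by rewrite mulr_ge0 ?(ltW (qinf_gt0 _))// divr_ge0 ?mulr_ge0 ?(ltW (qpoch_qq_gt0 _ _)).
rewrite [leRHS](bigID (fun i : 'I_N.+1 => (i < J)%N))/= -[leLHS]addr0; apply: lerD.
- have JN1 : (J <= N.+1)%N by lia.
  rewrite (big_ord_narrow JN1); apply: ler_sum => i _.
  rewrite mulrC [leRHS]mulrCA ler_wpM2l ?exprn_ge0//.
  have -> : (N + N = (N + i) + (N - i))%N by have := ltn_ord i; lia.
  by apply: qinf_qbinom_ge => //; have := ltn_ord i; lia.
- apply: sumr_ge0 => i _; rewrite mulrCA mulr_ge0 ?exprn_ge0//.
  by rewrite mulr_ge0 ?(ltW (qinf_gt0 _))// divr_ge0 ?mulr_ge0 ?(ltW (qpoch_qq_gt0 _ _)).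
Unshelve. all: end_near. Qed.

(** * The theta series and the Gaussian integral *)

Import gauss_integral_proof.
Local Notation mu := (@lebesgue_measure R).
Local Notation G := (@integral0_gauss R).

Lemma integrable_gauss_itv (i : interval R) :
  mu.-integrable [set` i] (EFin \o @gauss_fun R).
Proof.
by apply: integrableS integrableT_gauss => //; exact: measurable_itv.
Qed.

Lemma gauss_fun_nonincreasing (x y : R) : 0 <= x -> x <= y -> gauss_fun y <= gauss_fun x.
Proof.
move=> x0 xy; rewrite ler_expR lerN2 ler_pXn2r// nnegrE//.
exact: le_trans xy.
Qed.

(** The Gaussian is decreasing on the half line. *)
Lemma integral_gauss_step (x y : R) : 0 <= x -> x <= y ->
  gauss_fun y * (y - x) <= G y - G x <= gauss_fun x * (y - x).
Proof.
move=> x0 xy; rewrite /integral0_gauss Rintegral_itvB//; last first.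
  exact: integrable_gauss_itv.
have E : y - x = fine (mu `]x, y]%classic).
  rewrite lebesgue_measure_itv/= lte_fin; case: ltP => [//|yx].
  by apply/eqP; rewrite subr_eq0 eq_le xy yx.
have icst r : mu.-integrable `]x, y]%classic (EFin \o cst r).
  have : mu.-integrable `[x, y]%classic (EFin \o cst r).
    apply: continuous_compact_integrable; first exact: segment_compact.
    by apply: continuous_subspaceT => z; exact: cvg_cst.
  by apply: integrableS => //; apply: subset_itvr; rewrite bnd_simp.
rewrite E -!Rintegral_cst//; apply/andP; split; apply: le_Rintegral => //.
- exact: icst.
- exact: integrable_gauss_itv.
- move=> z /=; rewrite in_itv/= => /andP[xz zy]; apply: gauss_fun_nonincreasing => //.
  by rewrite (le_trans x0)// ltW.
- exact: integrable_gauss_itv.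
- exact: icst.
- by move=> z /=; rewrite in_itv/= => /andP[/ltW xz zy]; apply: gauss_fun_nonincreasing.
Qed.

Lemma integral0_gauss_nondecreasing (x y : R) : 0 <= x -> x <= y -> G x <= G y.
Proof.
move=> x0 xy; have /andP[h _] := integral_gauss_step x0 xy.
by rewrite -subr_ge0 (le_trans _ h)// mulr_ge0 ?gauss_fun_ge0// subr_ge0.
Qed.

Lemma integral0_gauss0 : G 0 = 0.
Proof. by rewrite /integral0_gauss set_itv1 Rintegral_set1. Qed.

Lemma integral0_gauss_le (x : R) : 0 <= x -> G x <= Num.sqrt pi / 2.
Proof.
move=> x0; rewrite -(@ler_pXn2r _ 2)// ?nnegrE ?integral0_gauss_ge0 ?divr_ge0 ?sqrtr_ge0//.
rewrite expr_div_n sqr_sqrtr ?pi_ge0// (_ : 2 ^+ 2 = 4); last by rewrite expr2 -natrM.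
apply: (ler_cvg_to (@cvg_cst _ _ _ _ _) cvg_integral0_gauss_sqr).
near=> y; rewrite ler_pXn2r ?nnegrE ?integral0_gauss_ge0//.
by apply: integral0_gauss_nondecreasing => //; near: y; exact: nbhs_pinfty_ge.
Unshelve. all: end_near. Qed.

Lemma integral0_gauss_ub (B : R) : 0 <= B ->
  (forall x, 0 <= x -> G x <= B) -> Num.sqrt pi / 2 <= B.
Proof.
move=> B0 HB; rewrite -(@ler_pXn2r _ 2)// ?nnegrE ?divr_ge0 ?sqrtr_ge0//.
rewrite expr_div_n sqr_sqrtr ?pi_ge0// (_ : 2 ^+ 2 = 4); last by rewrite expr2 -natrM.
apply: (ler_cvg_to cvg_integral0_gauss_sqr (@cvg_cst _ _ _ _ _)).
near=> y; rewrite ler_pXn2r ?nnegrE ?integral0_gauss_ge0//.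
by apply: HB; near: y; exact: nbhs_pinfty_ge.
Unshelve. all: end_near. Qed.

Lemma triE j : (2 * tri j = j * j.+1)%N.
Proof. by rewrite /tri binS bin1; have := bin2_sqr j; lia. Qed.

(** The terms q ^ tri j lie between exp (- y ^ 2) at the points y = h j and
    y = h (j + 1), so the series multiplied by h is squeezed between the Gaussian
    integral minus h and the same integral plus h. *)
Lemma theta_quot_asymp (eps : R) : 0 < eps ->
  `|theta_quot (expR (- eps)) - Num.sqrt (pi / (2 * eps))| <= 1.
Proof.
move=> e0; set q := expR (- eps).
have q01 : 0 < q < 1 by rewrite expR_gt0 -expR0 ltr_expR oppr_lt0.
(* chosen so that q ^ tri j = exp (- h ^ 2 * (j * (j + 1))) *)
pose h := Num.sqrt (eps / 2).
have h0 : 0 < h by rewrite sqrtr_gt0 divr_gt0.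
have h2 : h ^+ 2 = eps / 2 by rewrite sqr_sqrtr// divr_ge0// ltW.
have -> : Num.sqrt (pi / (2 * eps)) = Num.sqrt pi / 2 / h.
  have -> : pi / (2 * eps) = (Num.sqrt pi / 2 / h) ^+ 2.
    rewrite expr_div_n h2 expr_div_n sqr_sqrtr ?pi_ge0//; by field; rewrite gt_eqF.
  by rewrite sqrtr_sqr ger0_norm// divr_ge0 ?divr_ge0 ?sqrtr_ge0// ltW.
have qt j : q ^+ tri j = expR (- (h ^+ 2 * (j%:R * j.+1%:R))).
  rewrite /q -expRM_natl h2; congr expR.
  have := triE j; move/(congr1 (fun k => k%:R : R)); rewrite !natrM => <-; by field.
have lo j : gauss_fun (h * j.+1%:R) <= q ^+ tri j.
  rewrite qt ler_expR lerN2 exprMn ler_wpM2l ?sqr_ge0// expr2 ler_wpM2r//.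
  by rewrite ler_nat.
have up j : q ^+ tri j <= gauss_fun (h * j%:R).
  rewrite qt ler_expR lerN2 exprMn ler_wpM2l ?sqr_ge0// expr2 ler_wpM2l//.
  by rewrite ler_nat.
have st j : h * gauss_fun (h * j.+1%:R) <= G (h * j.+1%:R) - G (h * j%:R) <= h * gauss_fun (h * j%:R).
  have a1 : 0 <= h * j%:R by rewrite mulr_ge0// ltW.
  have a2 : h * j%:R <= h * j.+1%:R by rewrite ler_pM2l// ler_nat.
  have /andP[] := integral_gauss_step a1 a2.
  have -> : h * j.+1%:R - h * j%:R = h by rewrite -natr1; ring.
  by rewrite ![_ * h]mulrC => -> ->.
have upJ J : h * \sum_(j < J) q ^+ tri j.+1 <= G (h * J%:R).
  elim: J => [|J IH]; first by rewrite big_ord0 !mulr0 integral0_gauss0.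
  rewrite big_ord_recr/= mulrDr; have /andP[s1 _] := st J.
  have := up J.+1 => s2; rewrite -(ler_pM2l h0) in s2.
  by apply: (le_trans (lerD IH (le_trans s2 s1))); rewrite addrC subrK.
have loJ J : G (h * J.+1%:R) - h <= h * \sum_(j < J) q ^+ tri j.
  elim: J => [|J IH].
    rewrite big_ord0 !mulr0; have /andP[_] := st 0%N.
    have b1 := gauss_fun_le1 (h * 0%:R); rewrite -(ler_pM2l h0) in b1.
    rewrite [h * 0%:R]mulr0 integral0_gauss0 subr0 => b2.
    by rewrite mulr0 mulr1 in b1; rewrite subr_le0 (le_trans b2).
  rewrite big_ord_recr [leRHS]mulrDr; have /andP[_ s1] := st J.+1.
  have s2 := lo J; rewrite -(ler_pM2l h0) in s2.
  by apply: le_trans _ (lerD IH (le_trans s1 s2)); rewrite [leRHS]addrC addrA subrK.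
have tq := theta_quot_ge _ q01.
have tq0 : 0 <= theta_quot q by have := tq 0%N; rewrite big_ord0.
rewrite ler_distl; apply/andP; split.
  rewrite lerBlDr ler_pdivrMr//; apply: integral0_gauss_ub.
    by rewrite mulr_ge0 ?addr_ge0// ltW.
  move=> x x0; pose J := Num.trunc (x / h).
  have xJ : x <= h * J.+1%:R.
    by rewrite mulrC -ler_pdivrMr// ltW// truncnS_gt.
  apply: le_trans (integral0_gauss_nondecreasing x0 xJ) _.
  have s1 := tq J; rewrite -(ler_pM2l h0) in s1.
  rewrite [leRHS]mulrDl mul1r -lerBlDr [leRHS]mulrC; exact: le_trans (loJ J) s1.
apply: theta_quot_le => // -[|J].
  by rewrite big_ord0 addr_ge0// divr_ge0 ?divr_ge0 ?sqrtr_ge0// ltW.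
rewrite big_ord_recl /= expr0 addrC lerD2r ler_pdivlMr// mulrC.
apply: le_trans (upJ J) _; apply: integral0_gauss_le.
by rewrite mulr_ge0// ltW.
Qed.

(** * The sum of the inverse squares *)

Lemma le_from_derive (f df : R -> R) (a b : R) : a <= b ->
  (forall x, a <= x <= b -> is_derive x 1 f (df x)) ->
  (forall x, a <= x <= b -> 0 <= df x) -> f a <= f b.
Proof.
move=> ab Df df0.
have [|x xab|c /itvP cab E] := @MVT_segment R f df a b ab.
- by move=> x /itvP xab; apply: Df; rewrite !xab.
- apply: derivable_within_continuous => y yab; apply: @ex_derive.
  by apply: Df; rewrite !(itvP yab).
- by rewrite -subr_ge0 E mulr_ge0 ?subr_ge0// df0// !cab.
Qed.

Lemma sin_lex (x : R) : 0 <= x -> sin x <= x.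
Proof.
move=> x0; rewrite -subr_ge0.
have := @le_from_derive (fun y => y - sin y) (fun y => 1 - cos y) 0 x x0.
rewrite /= sin0 !subr0; apply => y _.
by rewrite subr_ge0 cos_le1.
Qed.

Lemma xcos_le_sin (x : R) : 0 <= x <= pi / 2 -> x * cos x <= sin x.
Proof.
move=> /andP[x0 xpi]; rewrite -subr_ge0.
have := @le_from_derive (fun y => sin y - y * cos y) (fun y => y * sin y) 0 x x0.
rewrite /= sin0 mul0r subr0; apply => y /andP[y0 yx].
  apply: is_derive_eq; rewrite /GRing.scale/=; ring.
rewrite mulr_ge0//; apply: sin_ge0_pi; rewrite y0 (le_trans yx)//.
by rewrite (le_trans xpi)// ler_pdivrMr// mulr_natr mulr2n lerDl pi_ge0.
Qed.

(** From x cos x <= sin x <= x. *)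
Lemma sin2_bounds (x : R) : 0 < x < pi / 2 ->
  (x ^+ 2)^-1 <= (sin x ^+ 2)^-1 <= 1 + (x ^+ 2)^-1.
Proof.
move=> x0p; have /andP[x0 xp] := x0p.
have s0 : 0 < sin x by exact: sin_gt0_pihalf.
have c0 : 0 < cos x by apply: cos_gt0_pihalf; rewrite xp andbT (lt_trans _ x0)// oppr_lt0 divr_gt0 ?pi_gt0.
apply/andP; split.
  rewrite lef_pV2 ?posrE ?exprn_gt0// ler_pXn2r ?nnegrE ?(ltW s0) ?(ltW x0)//.
  exact/sin_lex/ltW.
have : (x * cos x) ^+ 2 <= sin x ^+ 2.
  rewrite ler_pXn2r ?nnegrE ?(ltW s0) ?mulr_ge0 ?(ltW x0) ?(ltW c0)//.
  by apply: xcos_le_sin; rewrite !ltW.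
rewrite exprMn cos2sin2 => h.
have s20 : 0 < sin x ^+ 2 by rewrite exprn_gt0.
have x20 : 0 < x ^+ 2 by rewrite exprn_gt0.
have -> : 1 + (x ^+ 2)^-1 = (x ^+ 2 + 1) / x ^+ 2 by rewrite mulrDl divff ?gt_eqF ?mul1r.
rewrite -[leLHS]mul1r ler_pdivrMr// mulrAC ler_pdivlMr//; lra.
Qed.

(** The angles (2k+1) pi / (4N): halving them and adding their complements produces
    the same family for 2N. *)
Let ang N k : R := (k.*2.+1)%:R * pi / (4 * N%:R).

(** 1 = cos ^ 2 + sin ^ 2 divided by sin x ^ 2 = 4 sin (x/2) ^ 2 cos (x/2) ^ 2. *)
Lemma inv_sin2_dup (x : R) : 0 < x < pi ->
  (sin x ^+ 2)^-1 = 4^-1 * ((sin (x / 2) ^+ 2)^-1 + (sin (pi / 2 - x / 2) ^+ 2)^-1).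
Proof.
move=> /andP[x0 xp].
have y0 : 0 < x / 2 by rewrite divr_gt0.
have yp : x / 2 < pi / 2 by rewrite ltr_pM2r ?invr_gt0.
have s0 : 0 < sin (x / 2) by apply: sin_gt0_pihalf; rewrite y0.
have c0 : 0 < cos (x / 2) by apply: cos_gt0_pihalf; rewrite yp (lt_trans _ y0)// oppr_lt0 divr_gt0 ?pi_gt0.
have -> : sin (pi / 2 - x / 2) = cos (x / 2) by rewrite addrC sinDpihalf cosN.
have -> : sin x = cos (x / 2) * sin (x / 2) *+ 2.
  by rewrite -sin_mulr2n -[x / 2 *+ 2]mulr_natr divfK.
have E : cos (x / 2) ^+ 2 + sin (x / 2) ^+ 2 = 1 by rewrite cos2sin2 subrK.
move: s0 c0 E; set c := cos _; set s := sin _ => s0 c0 E.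
rewrite -[_ *+ 2]mulr_natr; transitivity ((c ^+ 2 + s ^+ 2) / (c * s * 2%:R) ^+ 2); first by rewrite E mul1r.
by field; rewrite !gt_eqF.
Qed.

(** By the duplication formula the sum is multiplied by 4 when the number of
    angles is doubled. *)
Lemma sum_inv_sin2 n : \sum_(k < 2 ^ n) (sin (ang (2 ^ n) k) ^+ 2)^-1 = 2 * (4 ^+ n).
Proof.
elim: n => [|n IH].
  rewrite expn0 big_ord_recl big_ord0 addr0 /ang mul1r !mulr1.
  have : cos (pi / 4 *+ 2) = 0 :> R by rewrite -[_ *+ 2]mulr_natr -mulrA (_ : 4^-1 * 2 = 2^-1) ?cos_pihalf//; field.
  rewrite cos_mulr2n sin2cos2 => /eqP; rewrite subr_eq0 -[_ *+ 2]mulr_natr => /eqP E.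
  have -> : 1 - cos (pi / 4) ^+ 2 = 2^-1 :> R by lra.
  by rewrite invrK.
have N0 : (2 ^ n)%:R != 0 :> R by rewrite pnatr_eq0 expn_eq0.
rewrite exprS mulrCA -IH expnS mul2n -addnn big_split_ord/=.
rewrite [X in _ + X](reindex_inj rev_ord_inj)/= -big_split/= mulr_sumr.
apply: eq_bigr => k _; rewrite [in RHS]inv_sin2_dup.
  have := ltn_ord k; move: (nat_of_ord k) N0 => {}k; move: (2 ^ n)%N => N N0 kN.
  have N1 : N%:R + N%:R != 0 :> R by rewrite -mulr2n mulrn_eq0.
  rewrite mulrA divff// mul1r; congr ((sin _ ^+ 2)^-1 + (sin _ ^+ 2)^-1).
    by rewrite /ang natrD; field; rewrite N0.
  rewrite /ang natrD.
  have -> : ((N + (N - k.+1)).*2.+1)%:R = 4 * N%:R - (k.*2.+1)%:R :> R.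
    apply/eqP; rewrite -subr_eq opprK -natrD -natrM; apply/eqP; congr _%:R; lia.
  by field; rewrite N0.
have N1 : 0 < 4 * (2 ^ n)%:R :> R by rewrite mulr_gt0// ltr0n expn_gt0.
apply/andP; split; first by rewrite divr_gt0// mulr_gt0 ?pi_gt0.
rewrite ltr_pdivrMr// mulrC ltr_pM2l ?pi_gt0// -natrM ltr_nat.
by have := ltn_ord k; lia.
Qed.

Definition odd_invsq_sum N : R := \sum_(k < N) ((k.*2.+1)%:R ^+ 2)^-1.

Lemma sum_inv_ang2 N : (0 < N)%N ->
  \sum_(k < N) (ang N k ^+ 2)^-1 = 16 * N%:R ^+ 2 / pi ^+ 2 * odd_invsq_sum N.
Proof.
rewrite -(ltr0n R) => N0; have p0 : 0 < pi :> R := pi_gt0 R.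
rewrite mulr_sumr; apply: eq_bigr => k _; rewrite /ang.
have : (k.*2.+1)%:R != 0 :> R by rewrite pnatr_eq0.
move: (k.*2.+1%:R : R) => m m0; move: (pi : R) p0 => p p0; field.
by rewrite m0 (gt_eqF p0) (gt_eqF N0).
Qed.

(** Comparing 1 / sin ^ 2 with 1 / angle ^ 2 costs at most 1 for each of the N angles,
    which is negligible against the total 2 N ^ 2. *)
Lemma odd_basel n :
  odd_invsq_sum (2 ^ n) <= pi ^+ 2 / 8
    <= odd_invsq_sum (2 ^ n) + pi ^+ 2 / (16 * 2 ^+ n).
Proof.
set O := odd_invsq_sum _; set N := (2 ^ n)%N.
have NR : N%:R = 2 ^+ n :> R by rewrite /N natrX.
have N0 : 0 < N%:R :> R by rewrite NR exprn_gt0.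
have p0 : 0 < pi :> R := pi_gt0 R.
have E : \sum_(k < N) (ang N k ^+ 2)^-1 = 16 * N%:R ^+ 2 / pi ^+ 2 * O.
  by apply: sum_inv_ang2; rewrite expn_gt0.
have S := sum_inv_sin2 n; rewrite -/N in S.
have S4 : 4 ^+ n = N%:R ^+ 2 :> R.
  by rewrite NR -exprM mulnC exprM; congr (_ ^+ n); rewrite expr2 -natrM.
rewrite S4 in S.
have B (k : 'I_N) : 0 < ang N k < pi / 2.
  rewrite divr_gt0 ?mulr_gt0//= /ang ltr_pdivrMr ?mulr_gt0//.
  have -> : pi / 2 * (4 * N%:R) = (2 * N%:R) * pi :> R by field.
  by rewrite ltr_pM2r// -natrM ltr_nat; have := ltn_ord k; lia.
have lo : \sum_(k < N) (ang N k ^+ 2)^-1 <= 2 * N%:R ^+ 2.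
  by rewrite -S; apply: ler_sum => k _; have /andP[] := sin2_bounds (B k).
have up : 2 * N%:R ^+ 2 <= N%:R + \sum_(k < N) (ang N k ^+ 2)^-1.
  rewrite -S; have -> : N%:R = \sum_(k < N) 1 :> R by rewrite sumr_const card_ord.
  by rewrite -big_split; apply: ler_sum => k _; have /andP[] := sin2_bounds (B k).
rewrite E in lo up; rewrite -NR.
rewrite -/O in lo up *; clear E S S4 B; move: (pi : R) p0 (N%:R : R) N0 lo up => p p0 M M0 lo up.
clearbody O; clear NR.
have c0 : 0 < p ^+ 2 / (16 * M ^+ 2) :> R by rewrite divr_gt0 ?mulr_gt0 ?exprn_gt0.
have E1 : p ^+ 2 / (16 * M ^+ 2) * (16 * M ^+ 2 / p ^+ 2 * O) = O.
  by field; rewrite (gt_eqF p0) (gt_eqF M0).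
have E2 : p ^+ 2 / (16 * M ^+ 2) * (2 * M ^+ 2) = p ^+ 2 / 8.
  by field; rewrite (gt_eqF M0).
have E3 : p ^+ 2 / (16 * M ^+ 2) * M = p ^+ 2 / (16 * M).
  by field; rewrite (gt_eqF M0).
apply/andP; split; first by have := ler_wpM2l (ltW c0) lo; rewrite E1 E2.
by have := ler_wpM2l (ltW c0) up; rewrite mulrDr E1 E2 E3 addrC.
Qed.

Definition invsq_sum N : R := \sum_(k < N) ((k.+1)%:R ^+ 2)^-1.

(** Split the indices by parity. *)
Lemma invsq_sum_double N :
  invsq_sum (N + N) = odd_invsq_sum N + invsq_sum N / 4.
Proof.
elim: N => [|N IH].
  by rewrite /invsq_sum /odd_invsq_sum !big_ord0 mul0r addr0.
rewrite addSn addnS /invsq_sum 2!big_ord_recr/= -/(invsq_sum _) IH.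
rewrite /odd_invsq_sum [\sum_(k < N.+1) _]big_ord_recr.
rewrite -/(odd_invsq_sum N) /invsq_sum [\sum_(k < N.+1) _]big_ord_recr.
rewrite -/(invsq_sum N) mulrDl -!addrA; congr (_ + _).
rewrite addnn addrCA; congr (_ + (_ + _)).
have -> : N.*2.+2%:R = N.+1%:R * 2 :> R by rewrite -natrM; congr _%:R; lia.
by rewrite exprMn invfM; congr (_ * _); rewrite expr2 -natrM.
Qed.

Lemma invsq_sum_nondecreasing M N : (M <= N)%N -> invsq_sum M <= invsq_sum N.
Proof.
move=> /subnKC <-; rewrite /invsq_sum big_split_ord/= lerDl.
by apply: sumr_ge0 => k _; rewrite invr_ge0 exprn_ge0.
Qed.

Lemma odd_invsq_sum_nondecreasing M N : (M <= N)%N -> odd_invsq_sum M <= odd_invsq_sum N.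
Proof.
move=> /subnKC <-; rewrite /odd_invsq_sum big_split_ord/= lerDl.
by apply: sumr_ge0 => k _; rewrite invr_ge0 exprn_ge0.
Qed.

Lemma invsq_sum_le N : invsq_sum N <= pi ^+ 2 / 6.
Proof.
have := invsq_sum_double N.
have := @invsq_sum_nondecreasing N (N + N) (leq_addr _ _).
have := @odd_invsq_sum_nondecreasing N (2 ^ N) (ltnW (@ltn_expl 2 N isT)).
have /andP[+ _] := odd_basel N.
move: (invsq_sum N) (invsq_sum _) (odd_invsq_sum _) (odd_invsq_sum _) => a b c d.
move: (pi ^+ 2 : R) => p; lra.
Qed.

(** Passing from 2 ^ n to 2 ^ (n+1) terms divides the defect by 4 and adds the one of
    the odd sum, so the bound pi ^ 2 / 2 ^ n reproduces itself. *)
Lemma basel n : pi ^+ 2 / 6 - invsq_sum (2 ^ n) <= pi ^+ 2 / 2 ^+ n.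
Proof.
elim: n => [|n IH].
  rewrite expr0 /invsq_sum expn0 big_ord_recl big_ord0 addr0 expr1n invr1.
  have : 0 <= pi ^+ 2 :> R by rewrite exprn_ge0// pi_ge0.
  move: (pi ^+ 2 : R) => p; lra.
have := invsq_sum_double (2 ^ n); rewrite addnn -mul2n -expnS => ->.
have /andP[_] := odd_basel n.
have -> : pi ^+ 2 / (16 * 2 ^+ n) = (pi ^+ 2 / 2 ^+ n) / 16 :> R by rewrite [16 * _]mulrC invfM mulrA.
have -> : pi ^+ 2 / 2 ^+ n.+1 = (pi ^+ 2 / 2 ^+ n) / 2 :> R by rewrite [2 ^+ n.+1]exprSr invfM mulrA mulrAC.
have : 0 <= pi ^+ 2 / 2 ^+ n :> R by rewrite divr_ge0// exprn_ge0// pi_ge0.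
move: IH; move: (_ / 2 ^+ n : R) (invsq_sum _) (odd_invsq_sum _) => a b c.
move: (pi ^+ 2 : R) => p; lra.
Qed.

(** * Leading behaviour of the logarithm of (q;q)_oo *)

(** The Taylor polynomial of - ln (1 - x). *)
Let logpart J (x : R) : R := \sum_(j < J) x ^+ j.+1 / j.+1%:R.

Lemma is_derive_logpart J (x : R) : x < 1 ->
  is_derive x 1 (fun y => - ln (1 - y) - logpart J y) (x ^+ J / (1 - x)).
Proof.
move=> x1; have h : 0 < 1 - x by rewrite subr_gt0.
have D1 : is_derive x 1 (fun y : R => - ln (1 - y)) ((1 - x)^-1).
  have hl : is_derive (1 - x) 1 (@ln R) (1 - x)^-1 by exact: is_derive1_ln.
  have hi : is_derive x 1 (fun y : R => 1 - y) (- 1).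
    by apply: is_derive_eq; rewrite add0r mul1r.
  have hc := @is_derive1_comp R _ (fun y : R => 1 - y) _ _ _ hl hi.
  by apply: is_derive_eq; rewrite mulrN1 opprK.
have D2 : is_derive x 1 (logpart J) (\sum_(j < J) x ^+ j).
  rewrite /logpart; elim: J => [|J IH].
    rewrite (_ : (fun _ => _) = cst 0); last by apply/funext => y; rewrite big_ord0.
    by rewrite big_ord0; exact: is_derive_cst.
  rewrite (_ : (fun _ => _) = (fun y => \sum_(j < J) y ^+ j.+1 / j.+1%:R) \+ (fun y => y ^+ J.+1 / J.+1%:R)); last first.
    by apply/funext => y; rewrite big_ord_recr.
  rewrite big_ord_recr; apply: is_deriveD.
  have -> : (fun y : R => y ^+ J.+1 / J.+1%:R) = J.+1%:R^-1 \*: (id ^+ J.+1).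
    by apply/funext => y; rewrite /= exprfctE mulrC.
  have c0 : J.+1%:R != 0 :> R by rewrite pnatr_eq0.
  apply: is_derive_eq; rewrite -[LHS]/(J.+1%:R^-1 * ((J.+1%:R * x ^+ J) * 1)).
  by rewrite mulr1 mulrA mulVf ?mul1r.
apply: is_derive_eq.
have := subrX1 x J; move: (\sum_(j < J) _) => S E.
have -> : x ^+ J = 1 + (x - 1) * S by rewrite -E; ring.
by field; rewrite gt_eqF.
Qed.

Lemma logpart_le J (x : R) : 0 <= x < 1 -> logpart J x <= - ln (1 - x).
Proof.
move=> /andP[x0 x1]; rewrite -subr_ge0.
have := @le_from_derive _ _ 0 x x0
  (fun y (h : 0 <= y <= x) => is_derive_logpart J (le_lt_trans (proj2 (andP h)) x1)).
rewrite subr0 ln1 oppr0 add0r /logpart [in - _]big1 ?oppr0; last first.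
  by move=> i _; rewrite exprS !mul0r.
apply => y /andP[y0 yx]; rewrite divr_ge0 ?exprn_ge0// subr_ge0.
exact/ltW/(le_lt_trans yx).
Qed.

(** The derivative x ^ J / (1 - x) of the remainder is increasing. *)
Lemma logpart_ge J (x : R) : 0 <= x < 1 ->
  - ln (1 - x) <= logpart J x + x ^+ J.+1 / (1 - x).
Proof.
move=> /andP[x0 x1]; rewrite -lerBlDl exprSr mulrAC -subr_ge0.
pose c := x ^+ J / (1 - x).
have D (y : R) : 0 <= y <= x ->
    is_derive y 1 (fun z => c * z - (- ln (1 - z) - logpart J z)) (c - y ^+ J / (1 - y)).
  move=> /andP[y0 yx]; have hl := is_derive_logpart J (le_lt_trans yx x1).
  by apply: is_derive_eq; rewrite /GRing.scale/= mulr1.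
have := @le_from_derive _ _ 0 x x0 D.
rewrite mulr0 subr0 ln1 oppr0 !add0r /logpart [in - _]big1 ?oppr0; last first.
  by move=> i _; rewrite exprS !mul0r.
apply => y /andP[y0 yx]; rewrite subr_ge0 /c ler_pM ?exprn_ge0 ?invr_ge0 ?subr_ge0//.
- exact/ltW/(le_lt_trans yx).
- by rewrite lerXn2r ?nnegrE.
- by rewrite lef_pV2 ?posrE ?subr_gt0 ?(le_lt_trans yx)// lerB.
Qed.

Lemma expRN_lt1 (eps : R) : 0 < eps -> 0 < expR (- eps) < 1.
Proof. by move=> e0; rewrite expR_gt0 -expR0 ltr_expR oppr_lt0. Qed.

Lemma geometric_sum_S (r : R) N : 0 < r < 1 ->
  \sum_(k < N) r ^+ k.+1 = r / (1 - r) * (1 - r ^+ N).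
Proof.
move=> r01; under eq_bigr do rewrite exprS.
by rewrite -mulr_sumr geometric_sum// mulrAC mulrA.
Qed.

Lemma lnqpoch (q : R) N : 0 < q < 1 ->
  - ln (qpoch q q N) = \sum_(k < N) - ln (1 - q ^+ k.+1).
Proof.
move=> q01; elim: N => [|N IH]; first by rewrite big_ord0 qpoch0 ln1 oppr0.
rewrite big_ord_recr -IH qpochS -exprS lnM ?opprD// posrE ?qpoch_qq_gt0//.
by rewrite subr_gt0; case/andP: (qpow_lt1 N q01).
Qed.

(** Summing the logarithmic series over the factors first turns each power into a
    geometric series. *)
Lemma sum_logpart (q : R) N J : 0 < q < 1 ->
  \sum_(k < N) logpart J (q ^+ k.+1) =
  \sum_(j < J) (j.+1%:R)^-1 * (q ^+ j.+1 / (1 - q ^+ j.+1) * (1 - (q ^+ j.+1) ^+ N)).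
Proof.
move=> /andP[q0 q1]; rewrite /logpart exchange_big; apply: eq_bigr => j _.
rewrite -geometric_sum_S ?exprn_gt0 ?exprn_ilt1 ?(ltW q0)//.
rewrite mulr_sumr; apply: eq_bigr => k _.
by rewrite mulrC -!exprM mulnC.
Qed.

(** The ratio is 1 / (exp s - 1). *)
Lemma geom_ratio_bounds (s : R) : 0 < s ->
  s^-1 - 1 <= expR (- s) / (1 - expR (- s)) <= s^-1.
Proof.
move=> s0; have /andP[r0 r1] := expRN_lt1 s0.
have d0 : 0 < 1 - expR (- s) by rewrite subr_gt0.
apply/andP; split.
  have -> : expR (- s) / (1 - expR (- s)) = (1 - expR (- s))^-1 - 1.
    by apply: (mulIf (lt0r_neq0 d0)); rewrite divfK ?gt_eqF// mulrBl mulVf ?gt_eqF//; ring.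
  rewrite lerD2r lef_pV2 ?posrE//.
  have := expR_ge1Dx (- s); lra.
rewrite ler_pdivrMr// -ler_pdivrMl ?invr_gt0// invrK.
have h := expR_ge1Dx s.
have E : expR s * expR (- s) = 1 by rewrite -expRD subrr expR0.
have : (1 + s) * expR (- s) <= 1 by rewrite -[leRHS]E ler_wpM2r ?expR_ge0.
lra.
Qed.

(** Each j contributes at most 1 / (j ^ 2 eps) to - ln (q;q)_oo. The Taylor remainder
    is removed first, for a finite product, by letting J grow. *)
Lemma ln_qinf_ge (eps : R) : 0 < eps ->
  - (pi ^+ 2 / 6) <= eps * ln (qinf (expR (- eps))).
Proof.
move=> e0; set q := expR (- eps); have q01 : 0 < q < 1 := expRN_lt1 e0.
have /andP[q0 q1] := q01.
have q1' : 0 < 1 - q by rewrite subr_gt0.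
have H N : - ln (qpoch q q N) <= pi ^+ 2 / 6 / eps.
  have HJ J : - ln (qpoch q q N) <= pi ^+ 2 / 6 / eps + N%:R * (q ^+ J.+1 / (1 - q)).
    rewrite lnqpoch//.
    apply: (@le_trans _ _ (\sum_(k < N) (logpart J (q ^+ k.+1) + q ^+ J.+1 / (1 - q)))).
      apply: ler_sum => k _; apply: le_trans (logpart_ge J (qpow_lt1 k q01)) _.
      rewrite lerD2l ler_pM ?invr_ge0 ?exprn_ge0 ?(ltW q0)//.
      - by rewrite subr_ge0 exprn_ile1// ltW.
      - rewrite -exprM mulSn addnC exprD ler_piMl ?exprn_ge0 ?(ltW q0)//.
        by rewrite exprn_ile1// ltW.
      - rewrite lef_pV2 ?posrE ?subr_gt0 ?exprn_ilt1 ?(ltW q0)//.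
        by rewrite lerB// exprS ler_piMr ?exprn_ile1 ?ltW.
    rewrite big_split/= sumr_const card_ord -[X in _ + X]mulr_natl lerD2r.
    rewrite sum_logpart//.
    apply: (@le_trans _ _ (invsq_sum J / eps)); last first.
      by rewrite ler_pM2r ?invr_gt0// invsq_sum_le.
    rewrite mulr_suml; apply: ler_sum => j _.
    have qj : q ^+ j.+1 = expR (- (j.+1%:R * eps)).
      by rewrite -expRM_natl mulrN.
    have s0 : 0 < j.+1%:R * eps by rewrite mulr_gt0.
    have /andP[_ b] := geom_ratio_bounds s0; rewrite -qj in b.
    have -> : (j.+1%:R ^+ 2)^-1 / eps = j.+1%:R^-1 * (j.+1%:R * eps)^-1.
      by rewrite expr2 !invfM -mulrA.
    rewrite ler_wpM2l ?invr_ge0// (le_trans _ b)// ler_piMr//.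
      by rewrite divr_ge0 ?exprn_ge0 ?(ltW q0)// subr_ge0 exprn_ile1// ltW.
    by rewrite gerBl exprn_ge0// exprn_ge0// ltW.
  have c : pi ^+ 2 / 6 / eps + N%:R * (q ^+ J.+1 / (1 - q)) @[J --> \oo]
      --> pi ^+ 2 / 6 / eps + N%:R * (0 / (1 - q)).
    apply: cvgD; first exact: cvg_cst.
    apply: cvgMl_tmp; apply: cvgMr_tmp.
    rewrite (_ : (fun J => q ^+ J.+1) = (fun J => q ^+ (J + 1))); last by apply/funext => J; rewrite addn1.
    by rewrite (cvg_shiftn 1 (fun J => q ^+ J)); exact: cvg_qpow.
  rewrite mul0r mulr0 addr0 in c.
  by apply: ler_cvg_to (@cvg_cst _ _ _ _ _) c _; exact: nearW HJ.
rewrite -lerN2 opprK -mulrN -ler_pdivlMl// mulrC.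
have : expR (- (pi ^+ 2 / 6 / eps)) <= qinf q.
  apply: limr_ge; first exact: cvgP (cvg_qinf q01).
  apply: nearW => N; rewrite -[leRHS]lnK ?posrE ?qpoch_qq_gt0//.
  by rewrite ler_expR lerNl.
by rewrite -ler_ln ?posrE ?expR_gt0 ?qinf_gt0// expRK lerNl.
Qed.

(** Truncating the logarithmic series at J terms, each of which is within eps of
    1 / j ^ 2 after multiplication by eps. *)
Lemma ln_qinf_le (eps : R) J : 0 < eps ->
  eps * ln (qinf (expR (- eps))) <= - invsq_sum J + J%:R * eps.
Proof.
move=> e0; set q := expR (- eps); have q01 : 0 < q < 1 := expRN_lt1 e0.
have /andP[q0 q1] := q01.
have q1' : 0 < 1 - q by rewrite subr_gt0.
have H N : ln (qinf q) <= - (\sum_(j < J) (j.+1%:R)^-1 * (q ^+ j.+1 / (1 - q ^+ j.+1) * (1 - (q ^+ j.+1) ^+ N))).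
  rewrite lerNr -sum_logpart//.
  apply: (@le_trans _ _ (- ln (qpoch q q N))).
    by rewrite lnqpoch//; apply: ler_sum => k _; exact: logpart_le (qpow_lt1 k q01).
  by rewrite lerN2 ler_ln ?posrE ?qinf_gt0 ?qpoch_qq_gt0// qinf_le.
have c : - (\sum_(j < J) (j.+1%:R)^-1 * (q ^+ j.+1 / (1 - q ^+ j.+1) * (1 - (q ^+ j.+1) ^+ N))) @[N --> \oo]
  --> - (\sum_(j < J) (j.+1%:R)^-1 * (q ^+ j.+1 / (1 - q ^+ j.+1) * (1 - 0))).
  apply: cvgN; apply: cvg_big => [|j _]; first exact: add_continuous.
  apply: cvgMl_tmp; apply: cvgMl_tmp; apply: cvgB; first exact: cvg_cst.
  by apply: cvg_qpow; rewrite exprn_gt0// exprn_ilt1// ltW.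
have : ln (qinf q) <= - (\sum_(j < J) (j.+1%:R)^-1 * (q ^+ j.+1 / (1 - q ^+ j.+1) * (1 - 0))).
  by apply: ler_cvg_to (@cvg_cst _ _ _ _ _) c _; exact: nearW H.
rewrite -(ler_pM2l e0) => /le_trans; apply.
rewrite -lerN2 opprD opprK mulrN opprK mulr_sumr.
have -> : J%:R * eps = \sum_(j < J) eps by rewrite sumr_const card_ord mulr_natl.
rewrite /invsq_sum -sumrB; apply: ler_sum => j _.
have qj : q ^+ j.+1 = expR (- (j.+1%:R * eps)).
  by rewrite -expRM_natl mulrN.
have s0 : 0 < j.+1%:R * eps by rewrite mulr_gt0.
have /andP[b _] := geom_ratio_bounds s0; rewrite -qj in b.
rewrite subr0 mulr1 mulrCA.
apply: (@le_trans _ _ (j.+1%:R^-1 * (eps * ((j.+1%:R * eps)^-1 - 1)))); last first.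
  by rewrite ler_wpM2l ?invr_ge0// ler_pM2l.
have E : eps * (j.+1%:R * eps)^-1 = j.+1%:R^-1 by rewrite invfM mulrCA divff ?mulr1// gt_eqF.
rewrite mulrBr E mulr1 mulrBr expr2 invfM lerD2l lerN2 ler_piMl ?(ltW e0)//.
by rewrite invf_le1 ?ler1n.
Qed.

Lemma near_right0P (P : R -> Prop) :
  (\forall e \near 0^'+, P e) <-> (exists2 e0, 0 < e0 & forall e, 0 < e < e0 -> P e).
Proof.
split.
  rewrite /at_right near_withinE => /nbhs_ballP[e0 /= e00 H].
  exists e0 => // e /andP[e1 e2]; apply: H => //.
  by rewrite /ball/= sub0r normrN gtr0_norm.
move=> [e0 e00 H]; near=> e; apply: H; apply/andP; split; near: e.
  exact: nbhs_right_gt.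
exact: nbhs_right_lt.
Unshelve. all: end_near. Qed.

Lemma cvg_right0P (f : R -> R) (l : R) : f x @[x --> 0^'+] --> l <->
  (forall d, 0 < d -> exists2 e0, 0 < e0 & forall e, 0 < e < e0 -> `|f e - l| <= d).
Proof.
split.
  move=> /cvgrPdist_le H d d0; apply/near_right0P.
  by near=> e; rewrite distrC; near: e; exact: H.
move=> H; apply/cvgrPdist_le => d d0.
by have /near_right0P := H _ d0; apply: filterS => e; rewrite distrC.
Unshelve. all: end_near. Qed.

Lemma ln_qinf_weak : eps * ln (qinf (expR (- eps))) @[eps --> 0^'+] --> - (pi ^+ 2 / 6).
Proof.
apply/cvg_right0P => d d0.
have p2 : 0 <= pi ^+ 2 :> R by rewrite exprn_ge0// pi_ge0.
(* enough terms for a truncation error d / 2, as n < 2 ^ n *)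
pose n := Num.trunc (2 * pi ^+ 2 / d).
have nd : pi ^+ 2 / 2 ^+ n <= d / 2.
  have h : 2 * pi ^+ 2 / d < 2 ^+ n.
    apply: lt_le_trans (truncnS_gt _) _; rewrite -natrX ler_nat.
    exact: ltn_expl.
  rewrite ler_pdivrMr ?exprn_gt0//; rewrite ltr_pdivrMr// in h; lra.
have J0 : 0 < (2 ^ n)%:R :> R by rewrite ltr0n expn_gt0.
exists (d / (2 * (2 ^ n)%:R)); first by rewrite divr_gt0 ?mulr_gt0.
move=> e /andP[e0]; rewrite ltr_pdivlMr ?mulr_gt0// => e1.
have h1 := ln_qinf_ge e0; have h2 := ln_qinf_le (2 ^ n) e0; have h3 := basel n.
have h4 : (2 ^ n)%:R * e <= d / 2 by move: e1; rewrite mulrCA mulrC; lra.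
rewrite opprK; move: h1 h2 h3 h4 nd; set L := e * _; move: (_ / 2 ^+ n) => b.
move: (_ * e) (invsq_sum _) => a c.
move: (pi ^+ 2 : R) => p h1 h2 h3 h4 h5.
by rewrite ler_norml; apply/andP; split; lra.
Qed.

(** * The constant term of the logarithm of (q;q)_oo *)

(** The error of the predicted asymptotics of ln (q;q)_oo. *)
Definition eta_err (eps : R) := ln (qinf (expR (- eps))) - Ascale eps.

(** With y = sqrt (c / eps), ln y <= y turns the claim into eps * y -> 0. *)
Lemma epsln_small (c : R) : 0 < c -> eps * ln (eps / c) @[eps --> 0^'+] --> (0 : R).
Proof.
move=> c0; apply/cvg_right0P => d d0.
exists (Num.min c (d ^+ 2 / (4 * c))).
  by rewrite lt_min c0 divr_gt0 ?mulr_gt0 ?exprn_gt0.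
move=> e /andP[e0]; rewrite lt_min => /andP[ec]; rewrite ltr_pdivlMr ?mulr_gt0// => ed.
have ec0 : 0 < e / c by rewrite divr_gt0.
have y0 : 0 < c / e by rewrite divr_gt0.
have s0 : 0 < Num.sqrt (c / e) by rewrite sqrtr_gt0.
have E : ln (e / c) = - (2 * ln (Num.sqrt (c / e))).
  rewrite -[e / c]invrK lnV ?posrE ?invr_gt0// invf_div -[in LHS](sqr_sqrtr (ltW y0)).
  by rewrite expr2 lnM ?posrE//; ring.
have up : ln (Num.sqrt (c / e)) <= Num.sqrt (c / e).
  have := @le_ln1Dx R (Num.sqrt (c / e) - 1); rewrite addrCA subrr addr0.
  by rewrite ltrBrDr addNr => /(_ s0) /le_trans; apply; rewrite gerBl.
have lo : 0 <= ln (Num.sqrt (c / e)).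
  by rewrite ln_ge0// -sqrtr1 ler_wsqrtr// ler_pdivlMr// mul1r ltW.
rewrite subr0 E mulrN normrN ger0_norm ?mulr_ge0// ?(ltW e0)//.
apply: (@le_trans _ _ (e * (2 * Num.sqrt (c / e)))).
  by rewrite ler_pM2l// ler_pM2l.
rewrite -(@ler_pXn2r _ 2)// ?nnegrE ?mulr_ge0 ?sqrtr_ge0 ?(ltW e0) ?(ltW d0)//.
rewrite !exprMn sqr_sqrtr ?(ltW y0)//.
have -> : e ^+ 2 * (2 ^+ 2 * (c / e)) = e * (4 * c) by field; rewrite gt_eqF.
exact: ltW.
Qed.

Lemma eta_err_weak : eps * eta_err eps @[eps --> 0^'+] --> (0 : R).
Proof.
have c0 : 0 < 2 * pi :> R by rewrite mulr_gt0 ?pi_gt0.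
have : (eps * ln (qinf (expR (- eps))) + 2^-1 * (eps * ln (eps / (2 * pi))) + pi ^+ 2 / 6)
    @[eps --> 0^'+] --> - (pi ^+ 2 / 6) + 2^-1 * 0 + pi ^+ 2 / 6.
  apply: cvgD; last exact: cvg_cst.
  by apply: cvgD; [exact: ln_qinf_weak|apply: cvgMl_tmp; exact: epsln_small].
rewrite mulr0 addr0 addNr; apply: cvg_trans; apply: near_eq_cvg.
near=> e; have e0 : 0 < e by near: e; exact: nbhs_right_gt.
rewrite /eta_err /Ascale /=; move: (ln _) (ln _) => a b.
by move: (pi : R) => p; field; rewrite gt_eqF.
Unshelve. all: end_near. Qed.

(** In 2 A (2 eps) - A (eps) the terms in 1 / eps cancel; the logarithms combine to
    that of the Gaussian integral. *)
Lemma eta_err_double (eps : R) : 0 < eps ->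
  2 * eta_err (2 * eps) - eta_err eps =
  ln (theta_quot (expR (- eps)) / Num.sqrt (pi / (2 * eps))).
Proof.
move=> e0; have p0 : 0 < pi :> R := pi_gt0 R.
have q0 (e : R) : 0 < e -> 0 < qinf (expR (- e)) by move=> h; apply/qinf_gt0/expRN_lt1.
have E2 : expR (- eps) ^+ 2 = expR (- (2 * eps)) by rewrite -expRM_natl mulrN.
have y0 : 0 < pi / (2 * eps) by rewrite divr_gt0 ?mulr_gt0.
have s0 : 0 < Num.sqrt (pi / (2 * eps)) by rewrite sqrtr_gt0.
have ls : 2 * ln (Num.sqrt (pi / (2 * eps))) = - (ln (eps / (2 * pi)) + 2 * ln 2).
  have -> : 2 * ln (Num.sqrt (pi / (2 * eps))) = ln (pi / (2 * eps)).
    by rewrite -[in RHS](sqr_sqrtr (ltW y0)) expr2 lnM ?posrE//; ring.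
  have -> : pi / (2 * eps) = ((eps / (2 * pi)) * (2 * 2))^-1.
    by move: (pi : R) p0 => p p0; field; rewrite (gt_eqF p0) (gt_eqF e0).
  have e20 : 0 < eps / (2 * pi) by rewrite divr_gt0 ?mulr_gt0.
  move: (_ / _) e20 => a a0; have p2 : 0 < 2 :> R by [].
  by rewrite lnV ?lnM ?posrE ?mulr_gt0//; ring.
have h2 : 0 < 2 * eps by rewrite mulr_gt0.
have t0 : 0 < theta_quot (expR (- eps)).
  by rewrite /theta_quot divr_gt0 ?exprn_gt0 ?q0// E2 q0.
rewrite ln_div ?posrE// /theta_quot ln_div ?posrE ?exprn_gt0 ?q0 ?E2 ?q0//.
rewrite lnXn ?q0// /eta_err /Ascale.
have -> : ln (2 * eps / (2 * pi)) = ln 2 + ln (eps / (2 * pi)).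
  by rewrite -mulrA lnM ?posrE ?divr_gt0 ?mulr_gt0.
have gen (a b c L1 L2 p e : R) : 0 < e -> 2 * a = - (c + 2 * b) ->
    2 * (L1 - (- (p ^+ 2 / (6 * (2 * e))) - 2^-1 * (b + c))) -
      (L2 - (- (p ^+ 2 / (6 * e)) - 2^-1 * c)) = L1 *+ 2 - L2 - a.
  move=> h H; have -> : a = - (c + 2 * b) / 2 by rewrite -H; field.
  by field; rewrite gt_eqF.
exact: gen.
Qed.

Lemma ln_near1 (u : R) : `|u| <= 2^-1 -> `|ln (1 + u)| <= 2 * `|u|.
Proof.
rewrite ler_norml => /andP[u1 u2].
have h1 : 0 < 1 + u by lra.
have up : ln (1 + u) <= u by apply: le_ln1Dx; lra.
have lo : - (2 * `|u|) <= ln (1 + u).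
  have : ln ((1 + u)^-1) <= - u / (1 + u).
    have E : (1 + u)^-1 = 1 + - u / (1 + u) by field; rewrite gt_eqF.
    rewrite [X in ln X]E.
    apply: le_ln1Dx; rewrite ltr_pdivlMr//; lra.
  rewrite lnV ?posrE// lerNl => /(le_trans _); apply; rewrite lerN2.
  rewrite ler_pdivrMr//; have := ler_norm (- u); rewrite normrN => h.
  have h0 := normr_ge0 u; nra.
rewrite ler_norml lo/= (le_trans up)//.
by have := ler_norm u; have := normr_ge0 u; lra.
Qed.

Lemma eta_err_double_small :
  2 * eta_err (2 * eps) - eta_err eps @[eps --> 0^'+] --> (0 : R).
Proof.
apply/cvg_right0P => d d0; have p0 : 0 < pi :> R := pi_gt0 R.
(* sqrt (pi / (2 e)) > M makes the relative error of the theta quotient at most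
   1 / M, hence at most 1/2 and at most d / 2 *)
pose M : R := Num.max 2 (2 / d).
have M0 : 0 < M by rewrite lt_max ltr0n.
exists (pi / (2 * M ^+ 2)); first by rewrite divr_gt0 ?mulr_gt0 ?exprn_gt0.
move=> e /andP[e0 eM]; rewrite eta_err_double// subr0.
have h := theta_quot_asymp e0; move: h; set t := theta_quot _; set s := Num.sqrt _ => h.
have sM : M < s.
  rewrite -(@ltr_pXn2r _ 2)// ?nnegrE ?sqrtr_ge0 ?(ltW M0)//.
  rewrite sqr_sqrtr ?divr_ge0 ?mulr_ge0 ?(ltW p0) ?(ltW e0)//.
  move: eM; rewrite !ltr_pdivlMr ?mulr_gt0 ?exprn_gt0// => eM.
  by rewrite (_ : M ^+ 2 * (2 * e) = e * (2 * M ^+ 2))//; ring.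
have s0 : 0 < s := lt_trans M0 sM.
have us : `|t / s - 1| <= s^-1.
  have -> : t / s - 1 = (t - s) / s by rewrite mulrBl divff ?gt_eqF.
  by rewrite normrM [`|s^-1|]gtr0_norm ?invr_gt0// ler_piMl ?invr_ge0 ?(ltW s0).
have sM1 : s^-1 <= M^-1 by rewrite lef_pV2 ?posrE// ltW.
have M2 : M^-1 <= 2^-1 by rewrite lef_pV2 ?posrE// le_max lexx.
have Md : M^-1 <= d / 2.
  by rewrite -[d / 2]invf_div lef_pV2 ?posrE ?divr_gt0// le_max lexx orbT.
have -> : t / s = 1 + (t / s - 1) by rewrite addrCA subrr addr0.
apply: le_trans (ln_near1 _) _; first exact: le_trans us (le_trans sM1 M2).
by have := le_trans us (le_trans sM1 Md); lra.
Qed.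

(** Iterating c (2 e) = (c (e) + o(1)) / 2 towards 0 gives
    c (e) = 2 ^ (- k) c (2 ^ (- k) e) + o(1), uniformly in k. The first term is
    (2 ^ (- k) e) c (2 ^ (- k) e) divided by e, which vanishes as k grows. *)
Lemma cvg0_of_doubling (c : R -> R) :
  2 * c (2 * e) - c e @[e --> 0^'+] --> (0 : R) ->
  e * c e @[e --> 0^'+] --> (0 : R) -> c e @[e --> 0^'+] --> (0 : R).
Proof.
move=> /cvg_right0P H1 /cvg_right0P H2; apply/cvg_right0P => d d0.
have [e0 e00 He] := H1 (d / 2) (divr_gt0 d0 (ltr0n _ 2)).
exists e0 => // e /andP[ep ee].
have it k : `|c e| <= (2^-1) ^+ k * `|c ((2^-1) ^+ k * e)| + d / 2 * (1 - (2^-1) ^+ k).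
  elim: k => [|k IH]; first by rewrite !expr0 !mul1r subrr mulr0 addr0.
  apply: le_trans IH _.
  have hk : 0 < (2^-1 : R) ^+ k by rewrite exprn_gt0.
  have : `|2 * c ((2^-1) ^+ k * e) - c ((2^-1) ^+ k.+1 * e)| <= d / 2.
    have := He ((2^-1) ^+ k.+1 * e); rewrite subr0.
    have -> : 2 * (2^-1 ^+ k.+1 * e) = 2^-1 ^+ k * e by rewrite exprS; field.
    apply; rewrite mulr_gt0 ?exprn_gt0//=; apply: le_lt_trans ee.
    by rewrite ler_piMl ?(ltW ep)// exprn_ile1// invf_le1// ler1n.
  have := ler_normB (2 * c ((2^-1) ^+ k * e) - c ((2^-1) ^+ k.+1 * e)) (- c ((2^-1) ^+ k.+1 * e)).
  rewrite opprK subrK normrN normrM ger0_norm// => h1 h2.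
  rewrite exprS; move: hk h1 h2; rewrite exprS.
  move: (_ ^+ k) `|_ - _| `|c _| `|c _| => x a b b' hk h1 h2.
  nra.
have it2 : `|c e| <= d / 2 + d / 2.
  have [e1 e10 He1] := H2 (e * (d / 2)) (mulr_gt0 ep (divr_gt0 d0 (ltr0n _ 2))).
  (* e1 is chosen for the accuracy e * d / 2, so that dividing by e leaves d / 2 *)
  have [k hk] : exists k : nat, (2^-1) ^+ k * e < e1.
    exists (Num.trunc (e / e1)); rewrite exprVn mulrC ltr_pdivrMr ?exprn_gt0//.
    rewrite mulrC -ltr_pdivrMr//; apply: lt_le_trans (truncnS_gt _) _.
    by rewrite -natrX ler_nat ltn_expl.
  have k0 : 0 < (2^-1 : R) ^+ k by rewrite exprn_gt0.
  apply: le_trans (it k) _.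
  have := He1 (2^-1 ^+ k * e); rewrite hk mulr_gt0// subr0 => /(_ isT).
  rewrite !normrM (gtr0_norm k0) (gtr0_norm ep) mulrAC [_ * e]mulrC ler_pM2l// => h.
  apply: lerD => //; rewrite ler_piMr ?divr_ge0 ?(ltW d0)// gerBl; exact: ltW.
by rewrite subr0; move: it2; lra.
Qed.

Lemma eta_err_cvg0 : eta_err eps @[eps --> 0^'+] --> (0 : R).
Proof. by apply: cvg0_of_doubling; [exact: eta_err_double_small|exact: eta_err_weak]. Qed.

(** The factor by which exp A fails to be 1 / (q;q)_oo. *)
Definition eta_quot (eps : R) := expR (Ascale eps) / qinf (expR (- eps)).

Lemma eta_quot_cvg1 : eta_quot eps @[eps --> 0^'+] --> (1 : R).
Proof.
have : expR (- eta_err eps) @[eps --> 0^'+] --> expR (- 0 : R).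
  apply: continuous_cvg; first exact: continuous_expR.
  by apply: cvgN; exact: eta_err_cvg0.
rewrite oppr0 expR0; apply: cvg_trans; apply: near_eq_cvg; near=> e.
have e0 : 0 < e by near: e; exact: nbhs_right_gt.
by rewrite /eta_err opprB expRB lnK// posrE qinf_gt0// expRN_lt1.
Unshelve. all: end_near. Qed.

Lemma eta_quot_gt0 (eps : R) : 0 < eps -> 0 < eta_quot eps.
Proof. by move=> e0; rewrite divr_gt0 ?expR_gt0 ?qinf_gt0 ?expRN_lt1. Qed.

End QAsymptotics.

(** * The weight of an entry and its limit *)

Section PairWeight.
Variable R : realType.
Implicit Types (eps u v B : R) (a b : nat).

(** The factor relating q ^ (a+1) / (1 - q) to exp (- u) when a = m + u / eps; it
    tends to 1 because eps * m differs from - ln eps by at most eps. *)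
Definition kappa eps : R :=
  expR (- (eps * ((Defs.mscale eps)%:~R + 1))) / (1 - expR (- eps)).

Lemma mscale_bounds eps : 0 < eps ->
  - ln eps <= eps * (Defs.mscale eps)%:~R <= - ln eps + eps.
Proof.
move=> e0; rewrite /Defs.mscale mulrNz mulrN.
set t := eps^-1 * ln eps.
have -> : ln eps = eps * t by rewrite /t mulVKf ?gt_eqF.
have := floor_itv t; rewrite intrD1 => /andP[h1 h2].
rewrite lerN2 ler_pM2l// h1/=.
have : eps * t <= eps * ((Num.floor t)%:~R + 1) by rewrite ler_pM2l// ltW.
by rewrite mulrDr mulr1; lra.
Qed.

Lemma oneB_expRN_bounds eps : 0 < eps -> eps * expR (- eps) <= 1 - expR (- eps) <= eps.
Proof.
move=> e0; apply/andP; split; last by have := expR_ge1Dx (- eps); lra.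
have E : expR eps * expR (- eps) = 1 by rewrite -expRD subrr expR0.
have : (1 + eps) * expR (- eps) <= 1 by rewrite -[leRHS]E ler_wpM2r ?expR_ge0 ?expR_ge1Dx.
lra.
Qed.

Lemma kappa_bounds eps : 0 < eps -> expR (- (2 * eps)) <= kappa eps <= 1.
Proof.
move=> e0; have /andP[d1 d2] := oneB_expRN_bounds e0.
have d0 : 0 < 1 - expR (- eps) by rewrite (lt_le_trans _ d1)// mulr_gt0 ?expR_gt0.
have /andP[m1 m2] := mscale_bounds e0.
rewrite /kappa ler_pdivlMr// ler_pdivrMr// mul1r; apply/andP; split.
  apply: (@le_trans _ _ (expR (- (2 * eps)) * eps)).
    by rewrite ler_pM2l ?expR_gt0.
  rewrite -[X in _ * X](lnK (x := eps)) ?posrE// -expRD ler_expR; lra.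
apply: le_trans d1; have -> : eps * expR (- eps) = expR (ln eps - eps).
  by rewrite expRD lnK ?posrE.
rewrite ler_expR; lra.
Qed.

Lemma kappa_gt0 eps : 0 < eps -> 0 < kappa eps.
Proof. by move=> e0; have /andP[h _] := kappa_bounds e0; apply: lt_le_trans h; exact: expR_gt0. Qed.

(** The exponent that governs the tail products is thus exp (- u) up to [kappa]. *)
Lemma qpow_kappa eps a : 0 < eps ->
  expR (- eps) ^+ a.+1 / (1 - expR (- eps)) =
  kappa eps * expR (- (eps * (a%:R - (Defs.mscale eps)%:~R))).
Proof.
move=> e0; rewrite /kappa mulrAC -expRD -expRM_natl; congr (expR _ / _).
by rewrite -natr1; ring.
Qed.

(** The normalised weight of an entry with distances a and b to its neighbours in the
    row above. It vanishes when a distance is negative, so that arrays that do not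
    interlace drop out of all sums. *)
Definition pairwt eps (a b : int) : R :=
  if (0 <= a) && (0 <= b) then
    expR (Ascale eps) * qbinom (expR (- eps)) `|(a + b)%R|%N `|a|%N
  else 0.

(** The rescaled distance u for which a = m + u / eps. *)
Definition gap eps (a : int) : R := eps * (a%:~R - (Defs.mscale eps)%:~R).

Lemma pairwt_nat eps a b : 0 < eps ->
  pairwt eps a%:Z b%:Z =
  eta_quot eps * (qinf (expR (- eps)) * qbinom (expR (- eps)) (a + b) a).
Proof.
move=> e0; rewrite /pairwt /= /eta_quot mulrA divfK//.
by rewrite gt_eqF// qinf_gt0// expRN_lt1.
Qed.

Lemma pairwt_ge0 eps (a b : int) : 0 < eps -> 0 <= pairwt eps a b.
Proof.
move=> e0; have q01 := expRN_lt1 e0; rewrite /pairwt; case: ifP => // _.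
rewrite mulr_ge0 ?expR_ge0//.
by rewrite divr_ge0 ?mulr_ge0 ?(ltW (qpoch_qq_gt0 _ _)).
Qed.

(** The smaller of a and b gives the larger of exp (- u) and exp (- v), hence at
    least their mean. With [kappa] >= 1/2 this explains 1/4; the factor 2 bounds
    [eta_quot]. *)
Lemma pairwt_le : exists2 e0 : R, 0 < e0 & forall eps (a b : int), 0 < eps < e0 ->
  pairwt eps a b <= 2 * expR (- (4^-1 * (expR (- gap eps a) + expR (- gap eps b)))).
Proof.
have /cvg_right0P/(_ 1 ltr01)[e1 e10 H1] := @eta_quot_cvg1 R.
exists (Num.min e1 4^-1); first by rewrite lt_min e10 invr_gt0 ltr0n.
move=> eps a b /andP[e0]; rewrite lt_min => /andP[ee1 ee2].
have q01 := expRN_lt1 e0.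
have := H1 eps; rewrite e0 ee1 => /(_ isT); rewrite ler_distl => /andP[_ Eq].
case: a => [a|a]; last by rewrite /pairwt/= mulr_ge0// expR_ge0.
case: b => [b|b]; last by rewrite /pairwt andbF mulr_ge0// expR_ge0.
rewrite pairwt_nat// ler_pM ?(ltW (eta_quot_gt0 _))//.
  by rewrite mulr_ge0 ?(ltW (qinf_gt0 _))// divr_ge0 ?mulr_ge0 ?(ltW (qpoch_qq_gt0 _ _)).
have kap : 2^-1 <= kappa eps.
  have /andP[k _] := kappa_bounds e0; apply: le_trans k.
  by have := expR_ge1Dx (- (2 * eps)); lra.
wlog ab : a b / (a <= b)%N.
  move=> H; have /orP[ab|ba] := leq_total a b; first exact: H.
  by rewrite [in X in X <= _]mulrC addnC [expR (- gap _ _) + _]addrC; have := H b a ba; rewrite mulrC /qbinom addKn addnK [X in _ / X]mulrC.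
apply: le_trans (qinf_qbinom_le _ _ q01) _; rewrite (minn_idPl ab).
apply: le_trans (qtail_le _ q01) _; rewrite ler_expR lerN2 qpow_kappa//.
have uv : expR (- gap eps b) <= expR (- gap eps a).
  by rewrite ler_expR lerN2 ler_pM2l// lerB// ler_int.
rewrite -/(gap eps a).
have := expR_gt0 (- gap eps a); nra.
Qed.

(** The limit of the tail product at distance m + u / eps. *)
Definition psi u : R := expR (- expR (- u)).

Lemma expRN_lipschitz (x y : R) : 0 <= x -> expR (- x) - expR (- y) <= `|y - x|.
Proof.
move=> x0; have [yx|xy] := leP y x.
  by apply: le_trans (normr_ge0 _); rewrite subr_le0 ler_expR lerN2.
rewrite gtr0_norm ?subr_gt0//.
have -> : expR (- y) = expR (- x) * expR (- (y - x)) by rewrite -expRD; congr expR; ring.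
have h1 : expR (- x) <= 1 by rewrite -expR0 ler_expR oppr_le0.
have h2 := expR_ge1Dx (- (y - x)); have h3 := expR_gt0 (- x).
have h4 : expR (- (y - x)) <= 1 by rewrite -expR0 ler_expR oppr_le0 subr_ge0 ltW.
nra.
Qed.

Lemma expRN_gap_le eps B a : 0 < eps -> `|gap eps a| <= B -> expR (- gap eps a) <= expR B.
Proof.
by move=> e0; rewrite ler_norml => /andP[h _]; rewrite ler_expR lerNl.
Qed.

Lemma qpow_gap_le eps B a : 0 < eps -> `|gap eps a%:Z| <= B ->
  expR (- eps) ^+ a.+1 <= eps * expR B.
Proof.
move=> e0 aB; have q01 := expRN_lt1 e0; have q1 : 0 < 1 - expR (- eps) by rewrite subr_gt0; case/andP: q01.
have := qpow_kappa a e0; move=> /(canRL (divfK (lt0r_neq0 q1))) ->.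
rewrite mulrC ler_pM ?(ltW q1)//.
- by rewrite mulr_ge0 ?expR_ge0// ltW// kappa_gt0.
- by case/andP: (oneB_expRN_bounds e0).
rewrite -[leRHS]mul1r ler_pM ?expR_ge0 ?(ltW (kappa_gt0 _))//.
  by case/andP: (kappa_bounds e0).
exact: expRN_gap_le.
Qed.

(** Both bounds of the tail product are exp (- X (1 + O (eps exp B))) with
    X = exp (- u) <= exp B, and exp is 1-Lipschitz on the negative half line. *)
Lemma qtail_near_psi eps B a : 0 < eps -> 0 <= B -> eps * expR B <= 2^-1 ->
  `|gap eps a%:Z| <= B ->
  `|qtail (expR (- eps)) a - psi (gap eps a%:Z)| <= 4 * (eps * expR (2 * B)).
Proof.
move=> e0 B0 eB aB; have q01 := expRN_lt1 e0.
have q1 : 0 < 1 - expR (- eps) by rewrite subr_gt0; case/andP: q01.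
have := qtail_le a q01; have := qtail_ge a q01.
have sB := qpow_gap_le e0 aB; have XB := expRN_gap_le e0 aB.
have := qpow_kappa a e0; rewrite -/(gap eps a%:Z) /psi => E.
have s1 : 0 < 1 - expR (- eps) ^+ a.+1 by lra.
rewrite invfM [in expR _]mulrA E; set X := expR (- gap _ _) in E XB *.
have X0 : 0 < X := expR_gt0 _.
have k0 := kappa_gt0 e0; have /andP[k1 k2] := kappa_bounds e0.
have k3 : 1 - 2 * eps <= kappa eps by apply: le_trans k1; have := expR_ge1Dx (- (2 * eps)).
have s0 : 0 <= expR (- eps) ^+ a.+1 by rewrite exprn_ge0 ?expR_ge0.
move: s1 sB s0 k0 k1 k2 k3; set s := _ ^+ a.+1; set k := kappa eps => s1 sB s0 k0 k1 k2 k3 lo up.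
have e2B : expR (2 * B) = expR B * expR B by rewrite -expRD; congr expR; ring.
have B1 : 1 <= expR B by rewrite -expR0 ler_expR.
rewrite e2B; move: (expR B) B1 XB sB eB => b b1 Xb sb eb.
have dk : `|k - (1 - s)| <= 2 * (eps * b).
  by rewrite ler_norml; apply/andP; split; nra.
have i2 : (1 - s)^-1 <= 2.
  by rewrite -[leRHS]invrK lef_pV2 ?posrE ?invr_gt0//; lra.
have main : `|k * X / (1 - s) - X| <= 4 * (eps * (b * b)).
  have -> : k * X / (1 - s) - X = X * ((k - (1 - s)) / (1 - s)) by field; rewrite gt_eqF.
  rewrite normrM (gtr0_norm X0) normrM [`|(1 - s)^-1|]gtr0_norm ?invr_gt0//.
  have -> : 4 * (eps * (b * b)) = b * (2 * (eps * b) * 2) by ring.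
  by rewrite ler_pM ?(ltW X0) ?mulr_ge0 ?invr_ge0 ?(ltW s1)// ler_pM ?invr_ge0 ?(ltW s1).
rewrite ler_distl; apply/andP; split.
  have h : expR (- X) - expR (- (k * X / (1 - s))) <= `|k * X / (1 - s) - X|.
    by apply: expRN_lipschitz; exact: ltW.
  by rewrite lerBlDr; have := le_trans h main; lra.
have h : expR (- (k * X)) - expR (- X) <= `|X - k * X|.
  by apply: expRN_lipschitz; rewrite mulr_ge0 ?(ltW X0) ?(ltW k0).
have : `|X - k * X| <= 4 * (eps * (b * b)).
  by rewrite ger0_norm; nra.
by have := le_trans up; lra.
Qed.

(** At a + b the exponent is a product of two quantities, one bounded and the other
    of order eps. *)
Lemma qtail_near1 eps B a b : 0 < eps <= 2^-1 -> 0 <= B -> eps * expR B <= 2^-1 ->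
  `|gap eps a%:Z| <= B -> `|gap eps b%:Z| <= B ->
  1 - 4 * (eps * expR (2 * B)) <= qtail (expR (- eps)) (a + b).
Proof.
move=> /andP[e0 e2] B0 eB aB bB; have q01 := expRN_lt1 e0; have /andP[q0 q1] := q01.
have d0 : 0 < 1 - expR (- eps) by rewrite subr_gt0.
apply: le_trans (qtail_ge _ q01); apply: le_trans (expR_ge1Dx _).
rewrite lerD2l lerN2 invfM [leLHS]mulrA.
have q2 : 2^-1 <= expR (- eps) by have := expR_ge1Dx (- eps); lra.
have sa := qpow_gap_le e0 aB; have sb := qpow_gap_le e0 bB.
have XA := expRN_gap_le e0 aB.
have Ea := qpow_kappa a e0; rewrite -/(gap eps a%:Z) in Ea.
have /andP[_ k2] := kappa_bounds e0; have k0 := kappa_gt0 e0.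
have e2B : expR (2 * B) = expR B * expR B by rewrite -expRD; congr expR; ring.
rewrite e2B -addSn exprD [_ * _ / (1 - expR (- eps))]mulrAC Ea.
have qb : expR (- eps) ^+ b <= 2 * (eps * expR B).
  rewrite exprS in sb; rewrite -(ler_pM2l q0); apply: le_trans sb _.
  have : 0 <= eps * expR B by rewrite mulr_ge0 ?expR_ge0 ?(ltW e0).
  move: (_ * expR B) (expR _) q2 => x q q2 x0; nra.
have qb0 : 0 <= expR (- eps) ^+ b by rewrite exprn_ge0// ltW.
have qb1 : expR (- eps) ^+ b <= 1 by rewrite exprn_ile1 ?ltW.
have qa0 : 0 <= expR (- eps) ^+ a.+1 by rewrite exprn_ge0// ltW.
have i1 : 0 < 1 - expR (- eps) ^+ a.+1 * expR (- eps) ^+ b by nra.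
have i2 : (1 - expR (- eps) ^+ a.+1 * expR (- eps) ^+ b)^-1 <= 2.
  by rewrite -[leRHS]invrK lef_pV2 ?posrE ?invr_gt0//; nra.
have -> : 4 * (eps * (expR B * expR B)) = (1 * expR B) * (2 * (eps * expR B)) * 2 by ring.
rewrite ler_pM ?invr_ge0 ?(ltW i1) ?mulr_ge0 ?expR_ge0 ?invr_ge0 ?(ltW k0) ?(ltW d0)//.
apply: ler_pM => //; first by rewrite mulr_ge0 ?expR_ge0 ?(ltW k0).
by apply: ler_pM; rewrite ?expR_ge0 ?(ltW k0).
Qed.

Lemma psi_itv u : 0 <= psi u <= 1.
Proof. by rewrite expR_ge0 -expR0 ler_expR oppr_le0 expR_ge0. Qed.

Lemma mul_near (ta tb pa pb h : R) : 0 <= tb <= 1 -> 0 <= pa <= 1 ->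
  `|ta - pa| <= h -> `|tb - pb| <= h -> `|ta * tb - pa * pb| <= 2 * h.
Proof.
move=> /andP[tb0 tb1] /andP[pa0 pa1] ha hb.
have -> : ta * tb - pa * pb = (ta - pa) * tb + pa * (tb - pb) by ring.
apply: le_trans (ler_normD _ _) _; have -> : 2 * h = h + h by ring.
apply: lerD; rewrite normrM.
  by rewrite (ger0_norm tb0) (le_trans _ ha)// ler_piMr.
by rewrite (ger0_norm pa0) (le_trans _ hb)// ler_piMl.
Qed.

(** Propagates an error h of the numerator, the denominator and the prefactor. *)
Lemma quot_near (E t y p h : R) : 0 < h <= 4^-1 -> 0 <= p <= 1 -> 0 <= y ->
  `|y - p| <= h -> 1 - h <= t <= 1 -> `|E - 1| <= h -> `|E * (y / t) - p| <= 8 * h.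
Proof.
move=> /andP[h0 h4] /andP[p0 p1] y0; rewrite !ler_distl => /andP[y1 y2] /andP[t1 t2] /andP[E1 E2].
have t0 : 0 < t by lra.
have hp : h * p <= h by rewrite ler_piMr// ltW.
have hp0 : 0 <= h * p by rewrite mulr_ge0// ltW.
have hh : h * h <= h / 4 by rewrite ler_pM2l.
have Y1 : y <= y / t by rewrite ler_pdivlMr// ler_piMr.
have Y2 : y / t <= p + 4 * h.
  rewrite ler_pdivrMr//; apply: (@le_trans _ _ ((p + 4 * h) * (1 - h))); first by lra.
  by rewrite ler_wpM2l//; lra.
have Y0 : 0 <= y / t by rewrite divr_ge0// ltW.
move: (y / t) Y0 Y1 Y2 => Y Y0 Y1 Y2.
have hY : h * Y <= h * (p + 4 * h) by rewrite ler_pM2l.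
have u : E * Y <= (1 + h) * Y by apply: ler_wpM2r => //; lra.
have l : (1 - h) * Y <= E * Y by apply: ler_wpM2r => //; lra.
by apply/andP; split; lra.
Qed.

(** For bounded gaps the distances a and b are nonnegative as soon as
    eps < exp (- B); the error terms are of order eps exp (2 B), apart from that of
    [eta_quot], which tends to 0 as well. *)
Lemma pairwt_near_psi B (d : R) : 0 <= B -> 0 < d -> exists2 e0 : R, 0 < e0 &
  forall eps (a b : int), 0 < eps < e0 -> `|gap eps a| <= B -> `|gap eps b| <= B ->
  `|pairwt eps a b - psi (gap eps a) * psi (gap eps b)| <= d.
Proof.
move=> B0 d0; pose eta : R := Num.min (d / 8) 4^-1.
have eta0 : 0 < eta by rewrite lt_min divr_gt0//= invr_gt0 ltr0n.
have eta4 : eta <= 4^-1 by rewrite ge_min lexx orbT.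
have etad : eta <= d / 8 by rewrite ge_min lexx.
have /cvg_right0P/(_ eta eta0)[e1 e10 H1] := @eta_quot_cvg1 R.
pose K := expR (2 * B).
have K1 : 1 <= K by rewrite -expR0 ler_expR mulr_ge0.
have BK : expR B <= K by rewrite ler_expR; lra.
have K0 : 0 < K := lt_le_trans ltr01 K1.
pose e2 := eta / (8 * K).
have e20 : 0 < e2 by rewrite divr_gt0// mulr_gt0.
pose e3 := expR (- B).
exists (Num.min (Num.min e1 e2) e3); first by rewrite !lt_min e10 e20 expR_gt0.
move=> eps a b /andP[e0]; rewrite !lt_min => /andP[/andP[ee1 ee2] ee3] aB bB.
have q01 := expRN_lt1 e0.
have epsK : 8 * (eps * K) <= eta.
  move: ee2; rewrite /e2 ltr_pdivlMr ?mulr_gt0// => h; apply/ltW; apply: le_lt_trans h.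
  by rewrite mulrCA.
have eB : eps * expR B <= 2^-1.
  by apply: le_trans (_ : eps * K <= _); [rewrite ler_pM2l|lra].
have e2' : eps <= 2^-1 by nra.
have mB : B < eps * (Defs.mscale eps)%:~R.
  have /andP[h _] := mscale_bounds e0; apply: lt_le_trans h.
  by rewrite ltrNr -ltr_expR lnK ?posrE.
have nn (c : int) : `|gap eps c| <= B -> 0 <= c.
  rewrite ler_norml /gap mulrBr => /andP[h _]; rewrite -(ler_int R) -(ler_pM2l e0) mulr0; lra.
case: a aB (nn _ aB) => // a aB _; case: b bB (nn _ bB) => // b bB _.
have ta := qtail_near_psi e0 B0 eB aB; have tb := qtail_near_psi e0 B0 eB bB.
have e02 : 0 < eps <= 2^-1 by rewrite e0.
have tab := qtail_near1 e02 B0 eB aB bB.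
have Eq := H1 eps; rewrite e0 ee1 in Eq; have {}Eq := Eq isT.
rewrite pairwt_nat// qinf_qbinom//.
rewrite -/K in ta tb tab.
have le1 c : 0 <= qtail (expR (- eps)) c <= 1 by rewrite qtail_le1// (ltW (qtail_gt0 _ _)).
have pp : 0 <= psi (gap eps a%:Z) * psi (gap eps b%:Z) <= 1.
  have /andP[? ?] := psi_itv (gap eps a%:Z); have /andP[? ?] := psi_itv (gap eps b%:Z).
  by rewrite mulr_ge0// mulr_ile1.
apply: (@le_trans _ _ (8 * eta)); last by lra.
apply: quot_near => //; first by rewrite eta0.
- by rewrite mulr_ge0 ?(ltW (qtail_gt0 _ _)).
- apply: le_trans (mul_near (le1 _) (psi_itv _) ta tb) _; lra.
- by rewrite qtail_le1 // andbT; lra.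
Qed.

Lemma psi_nondecreasing u v : u <= v -> psi u <= psi v.
Proof. by move=> uv; rewrite ler_expR lerN2 ler_expR lerN2. Qed.

(** The derivative is y exp (- y) with y = exp (- u), which is between 0 and 1. *)
Lemma psi_lipschitz u v : `|psi u - psi v| <= `|u - v|.
Proof.
wlog uv : u v / u <= v.
  move=> H; have /orP[h|h] := le_total u v; first exact: H.
  by rewrite distrC [leRHS]distrC; exact: H.
rewrite distrC [leRHS]distrC ger0_norm ?subr_ge0 ?psi_nondecreasing// ger0_norm ?subr_ge0//.
suff : u - psi u <= v - psi v by lra.
have D (x : R) : u <= x <= v ->
    is_derive x 1 (fun z => z - psi z) (1 - expR (- x) * expR (- expR (- x))).
  by move=> _; rewrite /psi; apply: is_derive_eq; rewrite /GRing.scale/=; ring.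
apply: (le_from_derive uv D) => x _; rewrite subr_ge0.
rewrite [expR (- expR _)]expRN ler_pdivrMr ?expR_gt0// mul1r.
by have := expR_ge1Dx (expR (- x)); lra.
Qed.

(** * A Peetre inequality *)

Lemma pow_le_fact_expR (x : R) k : 0 <= x -> x ^+ k <= k`!%:R * expR x.
Proof.
move=> x0; case: k => [|k]; first by rewrite expr0 mul1r -expR0 ler_expR.
have := expR_ge1Dxn k x0; rewrite -ler_pdivrMl ?ltr0n ?fact_gt0//.
by rewrite mulrC; lra.
Qed.

(** A double exponential absorbs every power: y ^ k <= k! exp y at y = c exp s. *)
Lemma superexp_decay (c s : R) D : 0 < c ->
  (1 + Num.max s 0 ^+ 2) ^+ D * expR (- (c * expR s)) <= 1 + (D + D)`!%:R / c ^+ (D + D).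
Proof.
move=> c0; have f0 : 0 <= (D + D)`!%:R / c ^+ (D + D) by rewrite divr_ge0// exprn_ge0// ltW.
have e1 : expR (- (c * expR s)) <= 1 by rewrite -expR0 ler_expR oppr_le0 mulr_ge0 ?expR_ge0 ?ltW.
have [s0|s0] := leP s 0.
  by rewrite (expr0n R 2) addr0 expr1n mul1r (le_trans e1)// lerDl.
apply: (@le_trans _ _ (expR s ^+ (D + D) * expR (- (c * expR s)))).
  rewrite ler_wpM2r ?expR_ge0// addnn -muln2 mulnC exprM lerXn2r ?nnegrE ?exprn_ge0 ?expR_ge0//.
    by rewrite addr_ge0// sqr_ge0.
  have := expR_ge1Dx s; nra.
have := pow_le_fact_expR (D + D) (mulr_ge0 (ltW c0) (expR_ge0 s)).
rewrite exprMn -ler_pdivlMl ?exprn_gt0// => h.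
rewrite expRN ler_pdivrMr ?expR_gt0//; apply: le_trans h _.
by rewrite mulrA ler_wpM2r ?expR_ge0// mulrC lerDr.
Qed.

(** An entry y can exceed a, or stay below b, by s > 0 only at the price
    exp (- c exp s), which absorbs every power of 1 + s ^ 2; and y is at most a in
    absolute value plus such an excess if y >= 0, and likewise with b if y < 0. *)
Lemma peetre (c : R) D : 0 < c -> exists2 K : R, 0 < K & forall a b y : R,
  (1 + y ^+ 2) ^+ D * expR (- (c * (expR (y - a) + expR (b - y)))) <=
  K * ((1 + a ^+ 2) * (1 + b ^+ 2)) ^+ D.
Proof.
move=> c0; pose K0 : R := 1 + (D + D)`!%:R / c ^+ (D + D).
have K00 : 0 < K0.
  by rewrite addr_gt0// divr_gt0 ?exprn_gt0// ltr0n fact_gt0.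
exists (2 ^+ D * K0) => [|a b y]; first by rewrite mulr_gt0 ?exprn_gt0.
have ge1 (x : R) : 1 <= 1 + x ^+ 2 by rewrite lerDl sqr_ge0.
have ge0 (x : R) : 0 <= 1 + x ^+ 2 := le_trans ler01 (ge1 x).
have key (s x : R) : `|y| <= Num.max s 0 + `|x| ->
    expR (- (c * (expR (y - a) + expR (b - y)))) <= expR (- (c * expR s)) ->
    1 + x ^+ 2 <= (1 + a ^+ 2) * (1 + b ^+ 2) ->
    (1 + y ^+ 2) ^+ D * expR (- (c * (expR (y - a) + expR (b - y)))) <=
    2 ^+ D * K0 * ((1 + a ^+ 2) * (1 + b ^+ 2)) ^+ D.
  move=> h1 h2 h3.
  have h4 : 1 + y ^+ 2 <= 2 * (1 + x ^+ 2) * (1 + Num.max s 0 ^+ 2).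
    have m0 : 0 <= Num.max s 0 by rewrite le_max lexx orbT.
    have := normr_ge0 x; have := normr_ge0 y; have := real_normK (num_real x); have := real_normK (num_real y).
    move: m0 h1; move: (Num.max s 0) `|x| `|y| => m x' y' m0 h1 <- <- y0 x0.
    have : y' ^+ 2 <= (m + x') ^+ 2 by rewrite lerXn2r ?nnegrE// addr_ge0.
    have := sqr_ge0 (m - x'); have := sqr_ge0 (m * x'); nra.
  apply: (@le_trans _ _ ((2 * (1 + x ^+ 2) * (1 + Num.max s 0 ^+ 2)) ^+ D * expR (- (c * expR s)))).
    by rewrite ler_pM ?exprn_ge0 ?expR_ge0// lerXn2r ?nnegrE ?mulr_ge0.
  have -> : (2 * (1 + x ^+ 2) * (1 + Num.max s 0 ^+ 2)) ^+ D * expR (- (c * expR s)) =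
      (2 * (1 + x ^+ 2)) ^+ D * ((1 + Num.max s 0 ^+ 2) ^+ D * expR (- (c * expR s))).
    by rewrite exprMn mulrA.
  apply: (@le_trans _ _ ((2 * (1 + x ^+ 2)) ^+ D * K0)).
    by rewrite ler_wpM2l ?exprn_ge0 ?mulr_ge0// superexp_decay.
  rewrite exprMn mulrAC ler_wpM2l ?mulr_ge0 ?exprn_ge0 ?(ltW K00)//.
  by rewrite lerXn2r ?nnegrE ?mulr_ge0.
have [y0|y0] := leP 0 y.
  apply: (key (y - a) a).
  - rewrite ger0_norm//; have := ler_norm a; have : y - a <= Num.max (y - a) 0 by rewrite le_max lexx.
    lra.
  - by rewrite ler_expR lerN2 ler_pM2l// lerDl expR_ge0.
  - by rewrite ler_peMr.
apply: (key (b - y) b).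
- rewrite ltr0_norm//; have := ler_norm (- b); rewrite normrN; have : b - y <= Num.max (b - y) 0 by rewrite le_max lexx.
  lra.
- by rewrite ler_expR lerN2 ler_pM2l// lerDr expR_ge0.
- by rewrite ler_peMl.
Qed.

End PairWeight.

(** * The polynomials as sums over triangular arrays *)

Section Arrays.

Definition row_of_seq (V : nmodType) N (s : seq V) : 'rV[V]_N := \row_(i < N) nth 0 s i.

Lemma crd_out (V : nmodType) N (v : 'rV[V]_N) i : (N < i)%N -> crd v i = 0.
Proof. by case: i => // j Nj; rewrite /crd insubN// -leqNgt. Qed.

Lemma crdE (V : nmodType) N (v : 'rV[V]_N) (i : 'I_N) : crd v i.+1 = v ord0 i.
Proof. by rewrite /crd insubT //= => H; congr (v _ _); apply: val_inj. Qed.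

Lemma crd_row (V : nmodType) N (F : nat -> V) i : (1 <= i <= N)%N ->
  crd (\row_(j < N) F j) i = F i.-1.
Proof.
case: i => // j jN; rewrite -[j.+1]/((Ordinal (jN : (j < N)%N) : nat).+1).
by rewrite crdE mxE.
Qed.

Lemma crd_row_of_seq (V : nmodType) N (s : seq V) i : size s = N -> (0 < i)%N ->
  crd (row_of_seq N s) i = nth 0 s i.-1.
Proof.
move=> sN i0; have [iN|iN] := leqP i N; first by rewrite crd_row// i0.
by rewrite crd_out// nth_default// sN; lia.
Qed.

(** Padding the rows with 0 supplies the convention x_(n+1) = 0, and makes the last
    pair of each row an instance of the general one. *)
Definition arr (V : nmodType) n (z : 'rV[V]_n) (t : seq V) (k i : nat) : V :=
  if (1 <= i <= uphalf k)%N then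
    (if k == n.*2 then crd z i else nth 0 t (woffset k + i.-1))
  else 0.

Definition rowsum (V : nmodType) (X : nat -> V) r : V := \sum_(1 <= i < r.+1) X i.

(** The weight of the row Y below the row X. *)
Definition pairprod (V : zmodType) (R : pzSemiRingType) (G : V -> V -> R)
    (X Y : nat -> V) r : R :=
  \prod_(1 <= i < r.+1) G (X i - Y i) (Y i - X i.+1).

Definition gtprod (V : zmodType) (R : pzSemiRingType) (G : V -> V -> R) n
    (X : nat -> nat -> V) : R :=
  \prod_(1 <= j < n.*2) pairprod G (X j.+1) (X j) (uphalf j).

(** The exponent of a_k, or the coefficient of lambda_k in the potential. *)
Definition wt_exponent (V : pzRingType) (X : nat -> nat -> V) k : V :=
  2 * rowsum (X (2 * k - 1)%N) (uphalf (2 * k - 1)) - rowsum (X (2 * k)%N) (uphalf (2 * k))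
  - rowsum (X (2 * k - 2)%N) (uphalf (2 * k - 2)).

Lemma woffsetS k : woffset k.+1 = (woffset k + uphalf k)%N.
Proof.
case: k => [|k]; first by rewrite /woffset !big_geq.
by rewrite /woffset big_nat_recr.
Qed.

Lemma woffset_leq j k : (j <= k)%N -> (woffset j <= woffset k)%N.
Proof.
move=> /subnKC <-; elim: (k - j)%N => [|d IH]; first by rewrite addn0.
by rewrite addnS woffsetS (leq_trans IH) ?leq_addr.
Qed.

Lemma woffset_doubleS n : woffset n.+1.*2 = (woffset n.*2 + (n + n.+1))%N.
Proof.
by rewrite doubleS !woffsetS -addnA; congr (_ + (_ + _))%N; rewrite uphalfE/= ?doubleK ?(half_bit_double n true)//; lia.
Qed.

(** Interlacing confines all entries between 0 and z_1, so the infinite ranges of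
    summation may be replaced by boxes, over which sums can be exchanged. *)
Definition Box (M N : nat) : set (seq int) :=
  [set s | size s = N /\ all (fun x : int => 0 <= x <= M%:Z) s].

Lemma finite_Box M N : finite_set (Box M N).
Proof.
apply: (@sub_finite_set _ _ (range (fun t : N.-tuple 'I_M.+1 => map (fun i : 'I_M.+1 => (i : nat)%:Z) t))); last first.
  by apply: finite_image; exact: finite_finset.
move=> s [sN /allP sM].
have sM' (i : 'I_N) : (`|nth 0%R s i|%N < M.+1)%N.
  have /sM/andP[] : nth 0%R s i \in s by rewrite mem_nth// sN.
  by case: (nth _ _ _).
exists [tuple Ordinal (sM' i) | i < N] => //.
apply: (@eq_from_nth _ 0%R); first by rewrite size_map size_tuple.
move=> i; rewrite size_map size_tuple => iN.
rewrite (nth_map ord0) ?size_tuple// -[X in nth _ _ X]/(nat_of_ord (Ordinal iN)) -tnth_nth tnth_mktuple/=.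
have /sM/andP[] : nth 0%R s i \in s by rewrite mem_nth// sN.
by case: (nth _ _ _).
Qed.

Lemma Box_cat (U : nmodType) M m k (F : seq int -> U) :
  \sum_(u \in Box M (m + k)) F u = \sum_(t \in Box M m) \sum_(s \in Box M k) F (t ++ s).
Proof.
rewrite pair_fsbig; [|exact: finite_Box..].
rewrite (reindex_fsbig (fun p => p.1 ++ p.2) (Box M m `*` Box M k))//.
split.
- move=> [t s] /= [[tm tM] [sk sM]]; split; first by rewrite size_cat tm sk.
  by rewrite all_cat tM sM.
- move=> [t s] [t' s']; rewrite !inE => -[/= [tm _] [sk _]] [/= [tm' _] [sk' _]] /eqP.
  by rewrite eqseq_cat ?tm ?tm'// => /andP[/eqP -> /eqP ->].
- move=> u [uN uM]; exists (take m u, drop m u); last by rewrite /= cat_take_drop.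
  split => /=; split.
  + by rewrite size_take uN; case: ltnP => //; lia.
  + by rewrite -(cat_take_drop m u) all_cat in uM; case/andP: uM.
  + by rewrite size_drop uN addKn.
  + by rewrite -(cat_take_drop m u) all_cat in uM; case/andP: uM.
Qed.

Lemma row_of_seq_bij M N : set_bij (Box M N)
  [set z : 'rV[int]_N | forall i, 0 <= z ord0 i <= M%:Z] (@row_of_seq int N).
Proof.
split.
- by move=> s [sN /allP sM] i; rewrite mxE; apply: sM; rewrite mem_nth// sN.
- move=> s s'; rewrite !inE => -[sN _] [sN' _] /matrixP/(_ ord0) E.
  apply: (@eq_from_nth _ 0); first by rewrite sN sN'.
  by move=> i; rewrite sN => iN; have := E (Ordinal iN); rewrite !mxE.
- move=> z zM; exists [seq z ord0 i | i <- enum 'I_N].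
    split; first by rewrite size_map size_enum_ord.
    by apply/allP => x /mapP[i _ ->]; exact: zM.
  apply/rowP => i; rewrite mxE (nth_map i) ?size_enum_ord//.
  by rewrite nth_ord_enum.
Qed.

(** Both summation domains are reduced to their intersection, outside of which the
    summand vanishes. *)
Lemma sum_row_of_seq (U : nmodType) M N (P : set 'rV[int]_N) (F : 'rV[int]_N -> U) :
  (forall z, P z -> F z != 0 -> forall i, 0 <= z ord0 i <= M%:Z) ->
  (forall s, Box M N s -> ~ P (row_of_seq N s) -> F (row_of_seq N s) = 0) ->
  \sum_(z \in P) F z = \sum_(s \in Box M N) F (row_of_seq N s).
Proof.
move=> H1 H2; rewrite -(reindex_fsbig _ _ _ _ (row_of_seq_bij M N)).
rewrite (fsbig_widen P (P `|` [set z | forall i, 0 <= z ord0 i <= M%:Z])).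
- symmetry; apply: fsbig_widen; first by move=> z; right.
  by move=> z [[Pz|//] nz] /=; apply: contra_notP nz => /eqP; exact: H1.
- by move=> z; left.
- move=> z [[//|zM] nP] /=.
  have [s sB Ez] : (@row_of_seq int N @` Box M N) z by case: (row_of_seq_bij M N) => _ _; apply.
  by rewrite -Ez; apply: H2; rewrite ?Ez.
Qed.

Section Weights.
Variable R : realType.
Implicit Types (q : R) (a : R[i]).

(** Vanishes for negative parts, so that the interlacing conditions are carried by
    the summand. *)
Definition gapbinom q (a b : int) : R :=
  if (0 <= a) && (0 <= b) then qbinom q `|(a + b)%R|%N `|a|%N else 0.

Definition kerterm q (p : nat) a (nu : 'rV[int]_p) (lam mu : 'rV[int]_p.+1) : R[i] :=
  a ^ (2 * vsum mu - vsum nu - vsum lam) *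
  (pairprod (gapbinom q) (crd lam) (crd mu) p.+1 *
   pairprod (gapbinom q) (crd mu) (crd nu) p)%:C.

Lemma interlace_bounds p (nu : 'rV[int]_p) (lam mu : 'rV[int]_p.+1) :
  interlace nu mu -> interlace mu lam ->
  (forall i, (1 <= i <= p.+1)%N -> 0 <= crd lam i - crd mu i /\ 0 <= crd mu i - crd lam i.+1) /\
  (forall i, (1 <= i <= p)%N -> 0 <= crd mu i - crd nu i /\ 0 <= crd nu i - crd mu i.+1).
Proof.
move=> I1 I2; split=> i /andP[i1 _]; rewrite !subr_ge0.
  by have [] := I2 i i1.
by have [] := I1 i i1.
Qed.

Lemma kerterm_eq q p a (nu : 'rV[int]_p) (lam mu : 'rV[int]_p.+1) :
  interlace nu mu -> interlace mu lam ->
  a ^ (2 * vsum mu - vsum nu - vsum lam) *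
    ((\prod_(1 <= i < p.+1)
        (qbinom q `|crd lam i - crd lam i.+1|%N `|crd lam i - crd mu i|%N *
         qbinom q `|crd mu i - crd mu i.+1|%N `|crd mu i - crd nu i|%N)) *
     qbinom q `|crd lam p.+1|%N `|crd lam p.+1 - crd mu p.+1|%N)%:C =
  kerterm q a nu lam mu.
Proof.
move=> I1 I2; have [B1 B2] := interlace_bounds I1 I2.
congr (_ * _%:C); rewrite /pairprod [X in _ = X * _]big_nat_recr// mulrAC; congr (_ * _).
  rewrite -big_split/=; apply: eq_big_nat => i /andP[i1 ip].
  have [|b1 b2] := B1 i; first by rewrite i1 ltnW// ltnW.
  have [|b3 b4] := B2 i; first by rewrite i1.
  by rewrite /gapbinom b1 b2 b3 b4 !subrKA.
have [|b1 b2] := B1 p.+1; first by rewrite /= leqnn.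
rewrite /gapbinom b1 b2 subrKA (crd_out lam (ltnSn p.+1)) subr0.
by [].
Qed.

Lemma gapbinom_neq0 q (a b : int) : gapbinom q a b != 0 -> 0 <= a /\ 0 <= b.
Proof. by rewrite /gapbinom; case: ifP => [/andP[]//|]; rewrite eqxx. Qed.

Lemma pairprod_neq0 q (X Y : nat -> int) r : pairprod (gapbinom q) X Y r != 0 ->
  forall i, (1 <= i <= r)%N -> X i.+1 <= Y i /\ Y i <= X i.
Proof.
rewrite /pairprod prodf_seq_neq0 => /allP H i /andP[i1 ir].
have := H i; rewrite mem_index_iota i1 ltnS ir => /(_ isT) /gapbinom_neq0.
by rewrite !subr_ge0 => -[].
Qed.

(** The converse of interlacing: nonzero weights force all differences to be
    nonnegative, and the inequalities of nu then order mu. *)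
Lemma kerterm_neq0 q p a (nu : 'rV[int]_p) (lam mu : 'rV[int]_p.+1) :
  (forall i, 0 <= mu ord0 i) -> kerterm q a nu lam mu != 0 ->
  Lambda mu /\ interlace nu mu /\ interlace mu lam.
Proof.
move=> mu0; rewrite mulf_eq0 negb_or => /andP[_].
rewrite (_ : 0 = (0 : R)%:C :> R[i])// (inj_eq (@complexI R)) mulf_eq0 negb_or => /andP[h1 h2].
have P1 := pairprod_neq0 h1; have P2 := pairprod_neq0 h2.
have mu0' i : 0 <= crd mu i.
  case: i => // i; have [ip|ip] := ltnP i p.+1; first by rewrite -[X in crd _ X.+1]/(nat_of_ord (Ordinal ip)) crdE.
  by rewrite crd_out.
have I1 : interlace nu mu.
  move=> i i1; have [ip|ip] := leqP i p.
    by have [|? ?] := P2 i; rewrite ?i1//; split.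
  by rewrite (crd_out nu ip) mu0' crd_out.
have I2 : interlace mu lam.
  move=> i i1; have [ip|ip] := leqP i p.+1.
    by have [|? ?] := P1 i; rewrite ?i1//; split.
  by rewrite !crd_out// ltnW.
split=> //; split=> [i /andP[i1 ip]|i _]; last exact: mu0'.
by have [h3 h4] := I1 i i1; exact: le_trans h4 h3.
Qed.

Lemma Qker_sum q p a (nu : 'rV[int]_p) (lam : 'rV[int]_p.+1) M :
  Lambda lam -> crd lam 1 <= M%:Z ->
  Qker a q nu lam = \sum_(s \in Box M p.+1) kerterm q a nu lam (row_of_seq p.+1 s).
Proof.
move=> [L1 L2] lM; rewrite /Qker.
under eq_fsbigr => mu; first by rewrite inE /= => -[_ [I1 I2]]; rewrite kerterm_eq//; over.
have lamM i : (1 <= i <= p.+1)%N -> crd lam i <= M%:Z.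
  elim: i => // -[//|i] IH /andP[_ ip].
  by apply: le_trans (L1 _ _) (IH _); rewrite //= ltnW.
apply: sum_row_of_seq.
- move=> mu [Lm [I1 I2]] _ i; rewrite -crdE; apply/andP; split.
    by apply: (proj2 Lm); rewrite /= ltn_ord.
  have [h _] := I2 i.+1 isT; apply: le_trans h (lamM _ _).
  by rewrite /= ltn_ord.
- move=> s [sN /allP sM]; apply: contra_notP => /eqP; apply: kerterm_neq0.
  by move=> i; rewrite mxE; have /sM/andP[] : nth 0%R s i \in s by rewrite mem_nth// sN.
Qed.

Definition gtterm q n (a : 'rV[R[i]]_n) (X : nat -> nat -> int) : R[i] :=
  (\prod_(1 <= k < n.+1) crd a k ^ wt_exponent X k) * (gtprod (gapbinom q) n X)%:C.

Lemma rowsum_crd (V : nmodType) N (v : 'rV[V]_N) : rowsum (crd v) N = vsum v.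
Proof.
rewrite /rowsum /vsum big_add1 big_mkord; apply: eq_bigr => i _; exact: crdE.
Qed.

Section Split.
Variables (p : nat) (z : 'rV[int]_p.+1) (t s' s : seq int).
Hypotheses (tN : size t = woffset p.*2) (s'N : size s' = p) (sN : size s = p.+1).
Let X := arr z (t ++ (s' ++ s)).

Lemma uphalf_double k : uphalf k.*2 = k. Proof. lia. Qed.

Lemma uphalf_doubleS k : uphalf k.*2.+1 = k.+1. Proof. lia. Qed.

Lemma arr_top i : (0 < i)%N -> X p.+1.*2 i = crd z i.
Proof.
move=> i0; rewrite /X /arr eqxx uphalf_double i0/=.
by case: leqP => // h; rewrite crd_out.
Qed.

Lemma arr_mid i : (0 < i)%N -> X p.*2.+1 i = crd (row_of_seq p.+1 s) i.
Proof.
move=> i0; rewrite /X /arr uphalf_doubleS i0/= crd_row_of_seq//.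
have -> : (p.*2.+1 == p.+1.*2) = false by lia.
case: leqP => h; last by rewrite nth_default// sN; lia.
rewrite woffsetS uphalf_double catA nth_cat size_cat tN s'N ltnNge -addnA leq_add2l leq_addr/=.
by congr nth; lia.
Qed.

Lemma arr_low k i : (k <= p.*2)%N -> X k i = arr (row_of_seq p s') t k i.
Proof.
move=> kp; rewrite /X /arr; case: ifP => // /andP[i0 ik].
have -> : (k == p.+1.*2) = false by lia.
case: eqP => [kE|/eqP kN].
  rewrite kE uphalf_double in ik; rewrite crd_row_of_seq// kE nth_cat tN ltnNge leq_addr/= addKn.
  by rewrite nth_cat s'N prednK// ik.
have kp' : (k.+1 <= p.*2)%N by rewrite ltn_neqAle kN.
have h : (woffset k + i.-1 < woffset p.*2)%N.
  by apply: leq_trans (woffset_leq kp'); rewrite woffsetS -addnS leq_add2l prednK.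
by rewrite nth_cat tN h.
Qed.

Lemma pairprod_eq (X1 Y1 X2 Y2 : nat -> int) q r :
  (forall i, (0 < i)%N -> X1 i = X2 i) -> (forall i, (0 < i)%N -> Y1 i = Y2 i) ->
  pairprod (gapbinom q) X1 Y1 r = pairprod (gapbinom q) X2 Y2 r.
Proof.
move=> hX hY; apply: eq_big_nat => i /andP[i0 _].
by rewrite !hX// !hY.
Qed.

Lemma rowsum_eq (X1 X2 : nat -> int) r :
  (forall i, (0 < i)%N -> X1 i = X2 i) -> rowsum X1 r = rowsum X2 r.
Proof. by move=> hX; apply: eq_big_nat => i /andP[i0 _]; rewrite hX. Qed.

(** The last two free rows of an array are nu and mu of the branching rule. *)
Lemma gtterm_split q (a : 'rV[R[i]]_p.+1) :
  gtterm q a X = kerterm q (crd a p.+1) (row_of_seq p s') z (row_of_seq p.+1 s) *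
    gtterm q (\row_(i < p) crd a i.+1) (arr (row_of_seq p s') t).
Proof.
rewrite /gtterm big_nat_recr//= /kerterm.
have -> : wt_exponent X p.+1 = 2 * vsum (row_of_seq p.+1 s) - vsum (row_of_seq p s') - vsum z.
  rewrite /wt_exponent.
  have -> : (2 * p.+1 - 1 = p.*2.+1)%N by lia.
  have -> : (2 * p.+1 - 2 = p.*2)%N by lia.
  have -> : (2 * p.+1 = p.+1.*2)%N by lia.
  rewrite uphalf_doubleS !uphalf_double -!rowsum_crd.
  rewrite (rowsum_eq _ arr_mid) (rowsum_eq _ arr_top).
  have -> : rowsum (X p.*2) p = rowsum (crd (row_of_seq p s')) p.
    apply: eq_big_nat => i /andP[i0 ip]; rewrite arr_low// /arr uphalf_double i0 -ltnS ip/= eqxx//.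
  by rewrite addrAC.
have -> : \prod_(1 <= k < p.+1) crd a k ^ wt_exponent X k =
    \prod_(1 <= k < p.+1) crd (\row_(i < p) crd a i.+1) k ^ wt_exponent (arr (row_of_seq p s') t) k.
  apply: eq_big_nat => k /andP[k0 kp].
  have -> : crd (\row_(i < p) crd a i.+1) k = crd a k.
    by rewrite (crd_row (fun i => crd a i.+1)) ?k0// prednK.
  congr (_ ^ _); rewrite /wt_exponent; congr (_ * _ - _ - _); apply: rowsum_eq => i i0; apply: arr_low; lia.
have -> : gtprod (gapbinom q) p.+1 X =
   pairprod (gapbinom q) (crd z) (crd (row_of_seq p.+1 s)) p.+1 *
   pairprod (gapbinom q) (crd (row_of_seq p.+1 s)) (crd (row_of_seq p s')) p *
   gtprod (gapbinom q) p (arr (row_of_seq p s') t).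
  rewrite /gtprod.
  have lowE : \prod_(1 <= j < p.*2) pairprod (gapbinom q) (X j.+1) (X j) (uphalf j) =
     \prod_(1 <= j < p.*2) pairprod (gapbinom q) (arr (row_of_seq p s') t j.+1) (arr (row_of_seq p s') t j) (uphalf j).
    by apply: eq_big_nat => j /andP[_ jp]; apply: pairprod_eq => i _; apply: arr_low; lia.
  have topE : pairprod (gapbinom q) (X p.*2.+2) (X p.*2.+1) (uphalf p.*2.+1) =
     pairprod (gapbinom q) (crd z) (crd (row_of_seq p.+1 s)) p.+1.
    rewrite uphalf_doubleS; apply: pairprod_eq; [exact: arr_top|exact: arr_mid].
  rewrite doubleS big_nat_recr//= topE -lowE.
  have midE : (0 < p)%N -> pairprod (gapbinom q) (X p.*2.+1) (X p.*2) (uphalf p.*2) =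
     pairprod (gapbinom q) (crd (row_of_seq p.+1 s)) (crd (row_of_seq p s')) p.
    move=> p0; rewrite uphalf_double; apply: eq_big_nat => i /andP[i0 ip].
    rewrite !arr_mid// arr_low// /arr uphalf_double i0 -ltnS ip/= eqxx//.
  case: (posnP p) => [p0|p0].
    have -> : pairprod (gapbinom q) (crd (row_of_seq p.+1 s)) (crd (row_of_seq p s')) p = 1.
      by rewrite /pairprod p0 big_geq.
    have p1 : (p.*2.+1 <= 1)%N by rewrite p0.
    have p2 : (p.*2 <= 1)%N by rewrite p0.
    by rewrite mulr1 (big_geq p1) (big_geq p2) mul1r mulr1.
  by rewrite big_nat_recr ?double_gt0// midE//=; ring.
rewrite !rmorphM/=; ring.
Qed.

End Split.

Lemma qbinom_sym q m k : (k <= m)%N -> qbinom q m (m - k) = qbinom q m k.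
Proof. by move=> km; rewrite /qbinom subKn// [X in _ / X]mulrC. Qed.

Lemma Box0 M : Box M 0 = [set [::]].
Proof.
apply/seteqP; split => [s [s0 _]|s ->] /=; first by apply/eqP; rewrite -size_eq0 s0.
by split.
Qed.

Lemma crd1_ge0 (z : 'rV[int]_1) : Lambda z -> 0 <= crd z 1.
Proof. by move=> [_ h]; apply: h. Qed.

(** In rank one the branching rule is the symmetry of the q-binomials, the row nu
    being empty. *)
Lemma Ppoly1_sum q (a : 'rV[R[i]]_1) (z : 'rV[int]_1) (nu : 'rV[int]_0) M :
  Lambda z -> crd z 1 <= M%:Z ->
  Ppoly q a z = \sum_(s \in Box M 1) kerterm q (crd a 1) nu z (row_of_seq 1 s).
Proof.
move=> Lz zM; have z0 := crd1_ge0 Lz.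
have v1 (v : 'rV[int]_1) : vsum v = crd v 1.
  by rewrite /vsum big_ord1 -crdE.
have v0 (v : 'rV[int]_0) : vsum v = 0 by rewrite /vsum big_ord0.
rewrite /Ppoly eqxx big_mkord.
rewrite (fsbig_ord _ _ (fun m => (qbinom q `|crd z 1|%N m)%:C * crd a 1 ^ (2 * m%:Z - crd z 1))).
have inj : set_inj `I_(`|crd z 1|%N.+1) (fun m : nat => [:: m%:Z]) by move=> m m' _ _ [].
rewrite -(fsbig_widen [set [:: m%:Z] | m in `I_(`|crd z 1|%N.+1)] (Box M 1)).
- rewrite fsbig_image//; apply: eq_fsbigr => m; rewrite inE => mz.
  rewrite /kerterm !v1 v0 subr0 crd_row_of_seq// (_ : nth 0 _ 1.-1 = m%:Z)// mulrC; congr (_ * _%:C).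
  rewrite /pairprod big_nat1 big_geq// mulr1 !crd_row_of_seq// (crd_out z (ltnSn 1)) subr0 (_ : nth 0 _ 1.-1 = m%:Z)//.
  have mz' : m%:Z <= crd z 1.
    have {}mz : (m < `|crd z 1|%N.+1)%N := mz.
    by move: (crd z 1) z0 mz => c; lia.
  have mz2 : (m <= `|crd z 1|)%N by exact: mz.
  rewrite /gapbinom subr_ge0 mz' subrK -(qbinom_sym _ mz2).
  by congr qbinom; move: (crd z 1) z0 mz' => c; lia.
- move=> _ [m mz <-]; have {}mz : (m < `|crd z 1|%N.+1)%N := mz.
  split=> //; rewrite /all andbT; move: (crd z 1) z0 zM mz => c; lia.
- move=> s [[sN /allP sM] nP].
  suff : kerterm q (crd a 1) nu z (row_of_seq 1 s) = 0 by [].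
  apply: contra_notP nP => /eqP h.
  have sp : forall i, 0 <= row_of_seq 1 s ord0 i.
    by move=> i; rewrite mxE; have /sM/andP[] : nth 0%R s i \in s by rewrite mem_nth// sN.
  have [_ [_ I2]] := kerterm_neq0 sp h.
  have [h1 _] := I2 1%N isT; rewrite crd_row_of_seq// in h1.
  move: (crd z 1) z0 zM h1 => c z0 zM h1.
  case: s sN sM h1 {h sp I2} => // x [] //= _ sM h1.
  have /andP[x0 _] := sM x (mem_head _ _).
  by exists `|x|%N; [rewrite /=; lia|congr (_ :: _); lia].
Qed.

Lemma Ppoly_sum q n (a : 'rV[R[i]]_n) (z : 'rV[int]_n) M : (0 < n)%N ->
  Lambda z -> crd z 1 <= M%:Z ->
  Ppoly q a z = \sum_(t \in Box M (woffset n.*2)) gtterm q a (arr z t).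
Proof.
elim: n a z => // p IH a z _ Lz zM.
rewrite woffset_doubleS Box_cat.
have E t s' s : size t = woffset p.*2 -> size s' = p -> size s = p.+1 ->
   gtterm q a (arr z (t ++ (s' ++ s))) = kerterm q (crd a p.+1) (row_of_seq p s') z (row_of_seq p.+1 s) *
    gtterm q (\row_(i < p) crd a i.+1) (arr (row_of_seq p s') t).
  by move=> tN s'N sN; apply: gtterm_split.
have -> : \sum_(t \in Box M (woffset p.*2)) \sum_(u \in Box M (p + p.+1)) gtterm q a (arr z (t ++ u)) =
  \sum_(s' \in Box M p) (Qker (crd a p.+1) q (row_of_seq p s') z *
     \sum_(t \in Box M (woffset p.*2)) gtterm q (\row_(i < p) crd a i.+1) (arr (row_of_seq p s') t)).
  under eq_fsbigr do rewrite Box_cat.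
  rewrite exchange_fsbig; [|exact: finite_Box..].
  apply: eq_fsbigr => s'; rewrite inE => -[s'N _].
  rewrite mulr_fsumr; apply: eq_fsbigr => t; rewrite inE => -[tN _].
  rewrite (Qker_sum _ _ _ Lz zM) mulr_fsuml.
  by apply: eq_fsbigr => s; rewrite inE => -[sN _]; rewrite E.
case: p IH a z Lz zM {E} => [|p] IH a z Lz zM.
  have -> : woffset 0.*2 = 0%N by rewrite /woffset big_geq.
  rewrite Box0 fsbig_set1 fsbig_set1 (Qker_sum _ _ _ Lz zM) (Ppoly1_sum _ _ (row_of_seq 0 [::]) Lz zM).
  by rewrite /gtterm /gtprod !big_geq// mul1r mulr1.
have QN nu : Qker (crd a p.+2) q nu z != 0 -> exists mu : 'rV[int]_p.+2, Lambda mu /\ interlace nu mu /\ interlace mu z.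
  apply: contra_neqP => h; rewrite /Qker (_ : [set mu | _] = set0) ?fsbig_set0//.
  by apply/seteqP; split=> // mu /= hm; apply: h; exists mu.
have zMi i : (1 <= i <= p.+2)%N -> crd z i <= M%:Z.
  elim: i => // -[//|i] IHi /andP[_ ip].
  by apply: le_trans (proj1 Lz _ _) (IHi _); rewrite //= ltnW.
have QL nu : Qker (crd a p.+2) q nu z != 0 ->
    Lambda nu /\ forall i, (1 <= i <= p.+1)%N -> 0 <= crd nu i <= M%:Z.
  move=> /QN[mu [[Lm1 Lm2] [I1 I2]]].
  have nn i : (1 <= i <= p.+1)%N -> 0 <= crd nu i.
    move=> /andP[i1 ip]; have [_ h] := I1 i i1; apply: le_trans h.
    by apply: Lm2; rewrite /= ltnS.
  split; first split=> // i /andP[i1 ip].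
    have [_ h1] := I1 i i1; have [h2 _] := I1 i.+1 isT; exact: le_trans h2 h1.
  move=> i /andP[i1 ip]; rewrite nn ?i1//=.
  have [h1 _] := I1 i i1; have [h2 _] := I2 i i1.
  by apply: le_trans h1 (le_trans h2 (zMi _ _)); rewrite i1 ltnW.
rewrite [LHS]/= (sum_row_of_seq (M := M)).
- apply: eq_fsbigr => s'; rewrite inE => s'B.
  have [->|/QL[Ls sM]] := eqVneq (Qker (crd a p.+2) q (row_of_seq p.+1 s') z) 0; first by rewrite !mul0r.
  by congr (_ * _); apply: IH => //; have /andP[] := sM 1%N isT.
- move=> nu _; rewrite mulf_eq0 negb_or => /andP[/QL[_ h] _] i.
  by rewrite -crdE; apply: h; rewrite /= ltn_ord.
- move=> s' _; apply: contra_notP => /eqP; rewrite mulf_eq0 negb_or.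
  by move=> /andP[/QL[]].
Qed.

End Weights.
End Arrays.

(** * Step functions and decay on powers of the real line *)

Section TupleMeasure.
Variable R : realType.
Local Notation RT := (measurableTypeR R).
Local Notation leb := (@lebesgue_measure R).
Local Notation mpow N := (measure_pow leb N).

Lemma measure_powS N (A : set (N.+1.-tuple RT)) :
  mpow N.+1 A = (leb \x mpow N)%E (@tcons _ RT N @^-1` A).
Proof. by []. Qed.

Definition cell (eps : R) N (k : nat -> int) : set (N.-tuple RT) :=
  [set t | forall i : 'I_N, Num.floor (tnth t i / eps) = k i].

Arguments cell : clear implicits.

Lemma cell_itv (eps : R) (k : int) : 0 < eps ->
  [set x : R | Num.floor (x / eps) = k] = `[k%:~R * eps, (k%:~R + 1) * eps[%classic.
Proof.
move=> e0; apply/seteqP; split => x /=; rewrite in_itv/=.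
  move=> <-; have := floor_itv (x / eps); rewrite intrD1 => /andP[h1 h2].
  by rewrite -ler_pdivlMr// h1 -ltr_pdivrMr.
rewrite -ler_pdivlMr// -ltr_pdivrMr// => /andP[h1 h2]; apply: floor_def.
by rewrite h1 intrD1.
Qed.

Lemma measurable_cell (eps : R) N (k : nat -> int) : 0 < eps -> measurable (cell eps N k).
Proof.
move=> e0.
have -> : cell eps N k = \bigcap_(i in [set: 'I_N])
    ((fun t : N.-tuple RT => tnth t i) @^-1` [set x : R | Num.floor (x / eps) = k i]).
  by apply/seteqP; split => [t tk i _|t tk i]; [exact: tk|exact: (tk i I)].
apply: fin_bigcap_measurable => // i _.
by rewrite cell_itv// -[X in measurable X]setTI; apply: measurable_tnth => //; exact: measurable_itv.
Qed.

(** Fubini, one coordinate at a time. *)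
Lemma measure_cell (eps : R) N (k : nat -> int) : 0 < eps ->
  mpow N (cell eps N k) = (eps ^+ N)%:E.
Proof.
move=> e0; elim: N k => [|N IH] k.
  by rewrite /= diracE expr0 mem_set// => -[].
rewrite measure_powS.
have -> : @tcons _ RT N @^-1` cell eps N.+1 k =
    [set x : R | Num.floor (x / eps) = k 0%N] `*` cell eps N (fun i => k i.+1).
  apply/seteqP; split => [[x t] /= xt|[x t] [/= xk tk] i].
    split => [|i /=]; first by have := xt ord0; rewrite (tnth_nth 0).
    by have := xt (lift ord0 i); rewrite !(tnth_nth 0).
  case: (unliftP ord0 i) => [j|] ->; last by rewrite (tnth_nth 0)/=.
  by rewrite (tnth_nth 0)/= -(tk j) (tnth_nth 0).
rewrite product_measure1E; last 2 first.
- by rewrite cell_itv//; exact: measurable_itv.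
- exact: measurable_cell.
rewrite cell_itv//.
have L : leb `[(k 0%N)%:~R * eps, ((k 0%N)%:~R + 1) * eps[%classic = eps%:E.
  rewrite lebesgue_measure_itv/= lte_fin ltr_pM2r// ltrDl ltr01.
  by rewrite -EFinD; congr _%:E; ring.
transitivity (eps%:E * (eps ^+ N)%:E)%E; last by rewrite -EFinM exprS.
by congr (_ * _)%E; [exact: L|exact: IH].
Qed.

(** Any integrable function that decays polynomially would serve; this one has the
    integral pi and is comparable with itself under bounded translations. *)
Definition decay (x : R) : R := (1 + x ^+ 2)^-1.
Definition tdecay N (t : N.-tuple RT) : R := \prod_(i < N) decay (tnth t i).

Lemma decay_gt0 x : 0 < decay x.
Proof. by rewrite invr_gt0 ltr_pwDl// sqr_ge0. Qed.

Lemma continuous_decay : continuous decay.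
Proof. exact: continuous_oneDsqrV. Qed.

Lemma measurable_decay : measurable_fun [set: RT] decay.
Proof. by apply: continuous_measurable_fun; exact: continuous_decay. Qed.

Lemma integral_decay : (\int[leb]_x (decay x)%:E = pi%:E)%E.
Proof.
rewrite ge0_symfun_integralT//=.
- rewrite (_ : [set x | _] = `[0, +oo[%classic); last first.
    by apply/seteqP; split => x/=; rewrite in_itv/= andbT.
  by rewrite /decay integral0y_oneDsqr -EFinM mulrCA divff// mulr1.
- by move=> x; exact/ltW/decay_gt0.
- exact: continuous_decay.
- by move=> x/=; rewrite /decay sqrrN.
Qed.

Lemma tdecay_ge0 N (t : N.-tuple RT) : 0 <= tdecay t.
Proof. by apply: prodr_ge0 => i _; exact/ltW/decay_gt0. Qed.

Lemma measurable_tdecay N : measurable_fun [set: N.-tuple RT] (@tdecay N).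
Proof.
apply: measurable_prod => i _; apply: measurableT_comp; first exact: measurable_decay.
exact: measurable_tnth.
Qed.

Lemma tdecay_cons N (x : R) (t : N.-tuple RT) :
  tdecay (@tcons _ RT N (x, t)) = decay x * tdecay t.
Proof.
rewrite /tdecay big_ord_recl; congr (decay _ * _); apply: eq_bigr => i _.
by congr decay; rewrite !(tnth_nth 0).
Qed.

Lemma integral_mpowS N (f : N.+1.-tuple RT -> \bar R) :
  measurable_fun [set: N.+1.-tuple RT] f -> (forall t, 0 <= f t)%E ->
  (\int[mpow N.+1]_t f t = \int[leb]_x \int[mpow N]_t f (@tcons _ RT N (x, t)))%E.
Proof.
move=> mf f0.
transitivity (\int[pushforward (leb \x mpow N) (@tcons _ RT N)]_t f t)%E.
  by apply: eq_measure_integral => //; exact: measurable_tcons.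
rewrite ge0_integral_pushforward//; last exact: measurable_tcons.
rewrite preimage_setT fubini_tonelli1//; last by move=> p; exact: f0.
by apply: measurableT_comp => //; exact: measurable_tcons.
Qed.

Lemma integral_tdecay N : (\int[mpow N]_t (tdecay t)%:E = (pi ^+ N)%:E)%E.
Proof.
elim: N => [|N IH].
  rewrite integral_dirac//= ?diracT ?mul1e; last by apply/measurable_EFinP; exact: measurable_tdecay.
  by rewrite /tdecay big_ord0 expr0.
rewrite integral_mpowS; last 2 first.
- by apply/measurable_EFinP; exact: measurable_tdecay.
- by move=> t; rewrite lee_fin tdecay_ge0.
under eq_integral => x _.
  under eq_integral do rewrite tdecay_cons EFinM.
  rewrite ge0_integralZl//; last 3 first.
  - by apply/measurable_EFinP; exact: measurable_tdecay.
  - by move=> t _; rewrite lee_fin tdecay_ge0.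
  - by rewrite lee_fin ltW ?decay_gt0.
  rewrite IH; over.
rewrite ge0_integralZr//.
- by rewrite integral_decay -EFinM exprS.
- by apply/measurable_EFinP; exact: measurable_decay.
- by move=> x _; rewrite lee_fin ltW ?decay_gt0.
- by rewrite lee_fin exprn_ge0 ?pi_ge0.
Qed.

Lemma integrable_tdecay N : (mpow N).-integrable [set: N.-tuple RT] (EFin \o @tdecay N).
Proof.
apply/integrableP; split; first by apply/measurable_EFinP; exact: measurable_tdecay.
under eq_integral do rewrite /= ger0_norm ?tdecay_ge0//.
by rewrite integral_tdecay ltry.
Qed.

Lemma integrable_cell (eps : R) N (k : nat -> int) : 0 < eps ->
  (mpow N).-integrable [set: N.-tuple RT] (fun t => (\1_(cell eps N k) t)%:E).
Proof.
move=> e0; have mc := @measurable_cell eps N k e0.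
apply/integrableP; split; first exact/measurable_EFinP/measurable_indic.
under eq_integral do rewrite /= ger0_norm//.
rewrite integral_indic// setIT [X in (X < _)%E](_ : _ = (eps ^+ N)%:E) ?ltry//.
exact: measure_cell.
Qed.

(** The integer array attached to a point; sh carries the shifts (k - 2i + 2) m. *)
Definition ints (eps : R) (sh : nat -> int) N (t : N.-tuple RT) : seq int :=
  mkseq (fun i => Num.floor (nth 0 t i / eps) + sh i) N.

Lemma cell_ints (eps : R) (sh : nat -> int) N (t : N.-tuple RT) (s : seq int) : size s = N ->
  cell eps N (fun i => nth 0 s i - sh i) t <-> ints eps sh t = s.
Proof.
move=> sN; split=> [H|<- i].
  apply: (@eq_from_nth _ 0); first by rewrite size_mkseq sN.
  move=> i; rewrite size_mkseq => iN; rewrite nth_mkseq//.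
  by have := H (Ordinal iN); rewrite (tnth_nth 0)/= => ->; rewrite subrK.
by rewrite nth_mkseq// addrK (tnth_nth 0).
Qed.

Lemma Box_enum M N : exists2 r : seq (seq int), uniq r & Box M N = [set` r].
Proof.
have /finite_seqP[r rE] := finite_Box M N; exists (undup r); first exact: undup_uniq.
by rewrite rE; apply/seteqP; split => s /=; rewrite mem_undup.
Qed.

Lemma step_funE (eps : R) (sh : nat -> int) (N M : nat) (F : seq int -> R) (r : seq (seq int)) :
  (forall s, size s = N -> F s != 0 -> Box M N s) -> uniq r -> Box M N = [set` r] ->
  forall t : N.-tuple RT, F (ints eps sh t) =
  \sum_(s <- r) F s * \1_(cell eps N (fun i => nth 0 s i - sh i)) t.
Proof.
move=> FB ur rE t; have sz : size (ints eps sh t) = N by rewrite size_mkseq.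
have rN s : s \in r -> size s = N.
  by move=> sr; have [] : Box M N s by rewrite rE.
have [F0|/(FB _ sz)] := eqVneq (F (ints eps sh t)) 0.
  rewrite F0 big_seq big1// => s /rN sN; rewrite indicE.
  case: (boolP (t \in _)); last by rewrite mulr0.
  by rewrite inE => /(cell_ints _ _ _ sN).1 <-; rewrite F0 mul0r.
rewrite rE /= => inr; rewrite (bigD1_seq _ inr ur)/= indicE mem_set; last exact/(cell_ints _ _ _ sz).
rewrite mulr1 big_seq_cond big1 ?addr0// => s /andP[/rN sN sn].
rewrite indicE; case: (boolP (t \in _)); last by rewrite mulr0.
by rewrite inE => /(cell_ints _ _ _ sN).1 ts; rewrite ts eqxx in sn.
Qed.

Section StepIntegral.
Variables (eps : R) (e0 : 0 < eps) (sh : nat -> int) (N M : nat) (F : seq int -> R).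
Hypothesis FB : forall s, size s = N -> F s != 0 -> Box M N s.

Lemma integrable_step : (mpow N).-integrable [set: N.-tuple RT]
  (fun t => (F (ints eps sh t))%:E).
Proof.
have [r ur rE] := Box_enum M N.
under eq_fun do rewrite (step_funE _ _ FB ur rE) -sumEFin.
apply: integrable_sum => // s _.
by under eq_fun do rewrite EFinM; apply: integrableZl => //; exact: integrable_cell.
Qed.

Lemma integral_step : \int[mpow N]_t F (ints eps sh t) = eps ^+ N * \sum_(s \in Box M N) F s.
Proof.
have [r ur rE] := Box_enum M N; rewrite /Rintegral.
under eq_integral do rewrite (step_funE _ _ FB ur rE) -sumEFin.
rewrite integral_sum//; last first.
  by move=> s; under eq_fun do rewrite EFinM; apply: integrableZl => //; exact: integrable_cell.
rewrite (eq_bigr (fun s => (eps ^+ N * F s)%:E)); last first.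
  move=> s _; under eq_integral do rewrite EFinM.
  rewrite integralZl//; last exact: integrable_cell.
  rewrite integral_indic//; last exact: measurable_cell.
  rewrite setIT [X in (_ * X)%E](_ : _ = (eps ^+ N)%:E) -?EFinM 1?mulrC//.
  exact: measure_cell.
by rewrite sumEFin /= -mulr_sumr rE fsbig_seq.
Qed.

End StepIntegral.

End TupleMeasure.

(** * Integral representations *)

Section Phase.
Variable R : realType.
Implicit Types (eps x y : R).

Definition cis (u : R) : R[i] := cexp (0 +i* u).

Lemma cisE u : cis u = cos u +i* sin u.
Proof. by rewrite /cis /cexp /= expR0 mul1r. Qed.

Lemma cisD u v : cis (u + v) = cis u * cis v.
Proof.
by rewrite !cisE cosD sinD; apply/eqP; rewrite eq_complex/= eqxx/= addrC.
Qed.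

Lemma cis0 : cis 0 = 1.
Proof. by rewrite cisE cos0 sin0. Qed.

Lemma cis_exprz u (e : int) : cis u ^ e = cis (e%:~R * u).
Proof.
have cn (k : nat) : cis u ^+ k = cis (k%:R * u).
  elim: k => [|k IH]; first by rewrite expr0 mul0r cis0.
  by rewrite exprS IH -cisD -natr1 mulrDl mul1r addrC.
case: e => k; first by rewrite -exprnP cn.
have u1 : cis u ^+ k.+1 * cis (- (k.+1%:R * u)) = 1 by rewrite cn -cisD subrr cis0.
rewrite NegzE -exprnN mulrNz mulNr; apply: (mulfI (x := cis u ^+ k.+1)).
  by apply: contraTneq (oner_neq0 R[i]) => h; rewrite -u1 h mul0r eqxx.
by rewrite u1 divff//; apply: contraTneq (oner_neq0 R[i]) => h; rewrite -u1 h mul0r eqxx.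
Qed.

Lemma cis_sum (I : Type) (r : seq I) (F : I -> R) :
  \prod_(i <- r) cis (F i) = cis (\sum_(i <- r) F i).
Proof. by elim/big_rec2: _ => [|i u v _ ->]; [rewrite cis0|rewrite cisD]. Qed.

Lemma woffset_double n : woffset n.*2 = (n ^ 2)%N.
Proof.
elim: n => [|n IH]; first by rewrite /woffset big_geq.
by rewrite woffset_doubleS IH; lia.
Qed.

Lemma pairwtE eps (a b : int) :
  pairwt eps a b = expR (Ascale eps) * gapbinom (expR (- eps)) a b.
Proof. by rewrite /pairwt /gapbinom; case: ifP => // _; rewrite mulr0. Qed.

Lemma gtprod_pairwt eps n (X : nat -> nat -> int) :
  gtprod (pairwt eps) n X =
  expR ((n ^ 2)%:R * Ascale eps) * gtprod (gapbinom (expR (- eps))) n X.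
Proof.
have -> : expR ((n ^ 2)%:R * Ascale eps) = \prod_(1 <= j < n.*2) expR (Ascale eps) ^+ uphalf j.
  by rewrite expRM_natl -woffset_double /woffset -prodrXr.
rewrite /gtprod -big_split/=; apply: eq_bigr => j _.
rewrite /pairprod; under eq_bigr do rewrite pairwtE.
by rewrite big_split/= big_const_nat subn1 iter_mulr_1.
Qed.

Lemma shift_exists m : exists sh : nat -> int, forall k i, (k < m)%N -> (1 <= i <= uphalf k)%N ->
  sh (woffset k + i.-1)%N = k%:Z - 2 * i%:Z + 2.
Proof.
elim: m => [|m [sh IH]]; first by exists (fun=> 0).
exists (fun l => if (l < woffset m)%N then sh l
                 else m%:Z - 2 * (l - woffset m).+1%:Z + 2) => k i km /andP[i1 ik].
have [km'|mk] := ltnP k m.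
  rewrite IH ?i1// (_ : (_ < _)%N)//; apply: leq_trans (woffset_leq km').
  by rewrite woffsetS; lia.
have -> : k = m by lia.
by rewrite ltnNge leq_addr/=; lia.
Qed.

Definition disc eps (t : seq R) : seq R := [seq eps * (Num.floor (y / eps))%:~R | y <- t].

Lemma flat_index_lt m k i : (k < m)%N -> (1 <= i <= uphalf k)%N ->
  (woffset k + i.-1 < woffset m)%N.
Proof.
move=> kn /andP[i1 ik]; apply: leq_trans (woffset_leq kn); rewrite woffsetS; lia.
Qed.

Section Arr.
Variables (n : nat) (eps : R) (x : 'rV[R]_n) (z : 'rV[int]_n) (sh : nat -> int).
Variable t : (woffset n.*2).-tuple (measurableTypeR R).
Let m : int := Defs.mscale eps.
Hypothesis e0 : 0 < eps.
Hypothesis shE : forall k i, (k < n.*2)%N -> (1 <= i <= uphalf k)%N ->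
  sh (woffset k + i.-1)%N = (k%:Z - 2 * i%:Z + 2) * m.
Hypothesis xz : zscale eps x = \row_(i < n) (crd z i.+1)%:~R.
Let Z := arr z (ints eps sh t).
Let D := arr x (disc eps t).

Lemma arr_disc k i : (k <= n.*2)%N -> (1 <= i <= uphalf k)%N ->
  D k i = eps * ((Z k i)%:~R - (k%:Z - 2 * i%:Z + 2)%:~R * m%:~R).
Proof.
move=> kn ik; rewrite /D /Z /arr ik; case: eqP => [kE|/eqP kN].
  have /andP[i1 i2] := ik; have iN : (i <= n)%N by move: i2; rewrite kE; lia.
  have := congr1 (fun v : 'rV_n => crd v i) xz.
  rewrite /zscale (crd_row (fun i => eps^-1 * crd x i.+1 + (2 * n%:Z - 2 * i%:Z)%:~R * (Defs.mscale eps)%:~R)) ?i1//.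
  rewrite (crd_row (fun i => (crd z i.+1)%:~R)) ?i1// prednK// => <-.
  rewrite -/m kE (_ : 2 * n%:Z - 2 * i.-1%:Z = n.*2%:Z - 2 * i%:Z + 2); last by lia.
  by rewrite addrK mulVKf ?gt_eqF.
have kn' : (k < n.*2)%N by rewrite ltn_neqAle kN.
have h := flat_index_lt kn' ik.
rewrite (nth_map 0) ?size_tuple// nth_mkseq// shE// intrD intrM; ring.
Qed.

Lemma arr_out (V : nmodType) N (v : 'rV[V]_N) (s : seq V) k i : (uphalf k < i)%N -> arr v s k i = 0.
Proof. by move=> h; rewrite /arr [(i <= _)%N]leqNgt h andbF. Qed.

(** The shifts of adjacent entries differ by exactly m. For the last entry of a row
    below a row of the same length the missing neighbour is 0, which is consistent
    since that entry is itself centred at m. *)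
Lemma gap_disc j i : (0 < j < n.*2)%N -> (1 <= i <= uphalf j)%N ->
  gap eps (Z j.+1 i - Z j i) = D j.+1 i - D j i /\ gap eps (Z j i - Z j.+1 i.+1) = D j i - D j.+1 i.+1.
Proof.
move=> /andP[j0 jn] /andP[i1 ij].
have h1 : (1 <= i <= uphalf j.+1)%N by rewrite i1 (leq_trans ij)//; lia.
rewrite /gap !intrB (arr_disc jn h1) (arr_disc (ltnW jn)) ?i1//; split.
  by rewrite !(intrD, intrB, intrM) -[j.+1%:Z]/(1 + j%:Z) intrD; ring.
have [h2|h2] := leqP i.+1 (uphalf j.+1).
  rewrite (arr_disc jn) ?h2//.
  by rewrite !(intrD, intrB, intrM) -[j.+1%:Z]/(1 + j%:Z) -[i.+1%:Z]/(1 + i%:Z) !intrD; ring.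
rewrite [D j.+1 i.+1]arr_out// [Z j.+1 i.+1]arr_out// subr0.
have -> : j%:Z - 2 * i%:Z + 2 = 1 by lia.
by rewrite mulr1z; ring.
Qed.

Lemma rowsum_disc k : (k <= n.*2)%N ->
  rowsum (D k) (uphalf k) = eps * ((rowsum (Z k) (uphalf k))%:~R -
     (\sum_(1 <= i < (uphalf k).+1) (k%:Z - 2 * i%:Z + 2))%:~R * m%:~R).
Proof.
move=> kn; rewrite /rowsum !rmorph_sum/= mulr_suml -sumrB mulr_sumr.
apply: eq_big_nat => i ik; rewrite arr_disc//.
Qed.

Lemma shift_rowsum k r : \sum_(1 <= i < r.+1) (k%:Z - 2 * i%:Z + 2) = r%:Z * (k%:Z + 1 - r%:Z).
Proof.
elim: r => [|r IH]; first by rewrite big_geq// mul0r.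
by rewrite big_nat_recr//= IH; lia.
Qed.

(** The shifts cancel: row j has total shift r (j + 1 - r) m with r = [(j+1)/2], and
    2 k ^ 2 - k (k + 1) - (k - 1) k = 0. *)
Lemma wt_exponent_disc k : (1 <= k <= n)%N ->
  wt_exponent D k = eps * (wt_exponent Z k)%:~R.
Proof.
move=> /andP[k1 kn]; rewrite /wt_exponent !rowsum_disc ?shift_rowsum; try lia.
have -> : uphalf (2 * k - 1) = k by lia.
have -> : uphalf (2 * k) = k by lia.
have -> : uphalf (2 * k - 2) = k.-1 by lia.
rewrite !(intrD, intrB, intrM).
have -> : (2 * k - 1)%:Z = 2 * k%:Z - 1 by lia.
have -> : (2 * k)%:Z = 2 * k%:Z by lia.
have -> : (2 * k - 2)%:Z = 2 * k%:Z - 2 by lia.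
have -> : (k.-1)%:Z = k%:Z - 1 by lia.
rewrite !(intrD, intrB, intrM); ring.
Qed.

End Arr.

Lemma flat_index_ex m l : (l < woffset m)%N ->
  exists k i, [/\ (0 < k < m)%N, (1 <= i <= uphalf k)%N & l = (woffset k + i.-1)%N].
Proof.
elim: m => [|m IH]; first by rewrite /woffset big_geq.
have [/IH[k [i [/andP[k0 km] ik lE]]] _|h] := ltnP l (woffset m).
  by exists k, i; split=> //; rewrite k0 ltnW.
rewrite woffsetS => lm; exists m, (l - woffset m).+1; split; last by rewrite /= subnKC.
  by rewrite ltnSn andbT; case: m {IH h} lm => //; rewrite /woffset big_geq.
by rewrite /= ltn_subLR.
Qed.

(** The support condition that encodes interlacing. *)
Lemma pairwt_neq0 eps (a b : int) : pairwt eps a b != 0 -> 0 <= a /\ 0 <= b.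
Proof. by rewrite /pairwt; case: ifP => [/andP[]//|]; rewrite eqxx. Qed.

Lemma gtprod_pairwt_neq0 eps n (Z : nat -> nat -> int) : gtprod (pairwt eps) n Z != 0 ->
  forall j i, (0 < j < n.*2)%N -> (1 <= i <= uphalf j)%N ->
  Z j.+1 i.+1 <= Z j i <= Z j.+1 i.
Proof.
rewrite /gtprod prodf_seq_neq0 => /allP H j i jn /andP[i1 ij].
have := H j; rewrite mem_index_iota jn => /(_ isT) /=.
rewrite /pairprod prodf_seq_neq0 => /allP H2.
have := H2 i; rewrite mem_index_iota i1 ltnS ij => /(_ isT) /= /pairwt_neq0.
by rewrite !subr_ge0 => -[-> ->].
Qed.

(** Reading the rows downwards from z, interlacing keeps all entries between 0 and z_1. *)
Lemma weight_support eps n (z : 'rV[int]_n) (s : seq int) : (0 < n)%N -> Lambda z ->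
  size s = woffset n.*2 -> gtprod (pairwt eps) n (arr z s) != 0 ->
  Box `|crd z 1|%N (woffset n.*2) s.
Proof.
move=> n0 [L1 L2] sN /gtprod_pairwt_neq0 H; split=> //.
have z1 : 0 <= crd z 1 by apply: L2.
have top i : (0 < i)%N -> 0 <= crd z i <= crd z 1.
  move=> i0; have [iN|iN] := leqP i n; last by rewrite crd_out// lexx.
  rewrite L2 ?i0//=; elim: i i0 iN => // -[//|i] IH _ iN.
  by apply: le_trans (L1 _ _) (IH _ _) => //; exact: ltnW.
have P d : (d < n.*2)%N -> forall i, 0 <= arr z s (n.*2 - d) i <= crd z 1.
  elim: d => [|d IH] dn i.
    rewrite subn0 /arr eqxx; case: ifP => [/andP[i0 _]|_]; first exact: top.
    by rewrite lexx.
  have [ik|ik] := boolP (1 <= i <= uphalf (n.*2 - d.+1))%N; last first.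
    by rewrite /arr (negbTE ik) lexx.
  have dn' : (0 < n.*2 - d.+1 < n.*2)%N by lia.
  have /andP[h1 h2] := H _ i dn' ik.
  have E : (n.*2 - d.+1).+1 = (n.*2 - d)%N by lia.
  rewrite E in h1 h2; have IHd := IH (ltnW dn).
  have /andP[a1 _] := IHd i.+1; have /andP[_ a2] := IHd i.
  by rewrite (le_trans a1 h1) (le_trans h2 a2).
apply/(all_nthP 0) => l; rewrite sN => /flat_index_ex[k [i [/andP[k0 kn] ik lE]]].
have kn' : (n.*2 - k < n.*2)%N by lia.
have := P _ kn' i; rewrite subKn ?(ltnW kn)// /arr ik (ltn_eqF kn) -lE => /andP[h1 h2].
by rewrite h1 andTb; apply: le_trans h2 _; move: (crd z 1) z1 => c; lia.
Qed.

Definition phase n (lam : 'rV[R]_n) (X : nat -> nat -> R) : R :=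
  \sum_(1 <= k < n.+1) crd lam k * wt_exponent X k.

Definition stepfun (phi : R -> R) n (lam : 'rV[R]_n) eps (x : 'rV[R]_n) (z : 'rV[int]_n)
    (sh : nat -> int) (t : (woffset n.*2).-tuple (measurableTypeR R)) : R :=
  phi (phase lam (arr x (disc eps t))) * gtprod (pairwt eps) n (arr z (ints eps sh t)).

(** The integer vector z of the scaling. *)
Definition zfloor n eps (x : 'rV[R]_n) : 'rV[int]_n :=
  \row_(i < n) Num.floor (crd (zscale eps x) i.+1).

Lemma zfloorE n eps (x : 'rV[R]_n) : scaled_dom eps x ->
  Lambda (zfloor eps x) /\ zscale eps x = \row_(i < n) (crd (zfloor eps x) i.+1)%:~R.
Proof.
move=> [z Lz E].
suff -> : zfloor eps x = z by [].
apply/rowP => i; rewrite mxE E.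
have h : (1 <= i.+1 <= n)%N by exact: ltn_ord.
by rewrite (crd_row (fun i => (crd z i.+1)%:~R) h) intrKfloor; exact: crdE.
Qed.

(** The centring of the entry (k, i) at (k - 2i + 2) m, read in the flat numbering of
    the entries. On the row 2n it is the scaling of z, and consecutive rows are
    centred at distance m from each other. *)
Definition shifts n eps (sh : nat -> int) := forall k i, (k < n.*2)%N -> (1 <= i <= uphalf k)%N ->
  sh (woffset k + i.-1)%N = (k%:Z - 2 * i%:Z + 2) * Defs.mscale eps.

Lemma shifts_exist n eps : exists sh, shifts n eps sh.
Proof.
have [sh H] := shift_exists n.*2; exists (fun l => sh l * Defs.mscale eps) => k i kn ik.
by rewrite H.
Qed.

Definition step_phase n (lam : 'rV[R]_n) eps (z : 'rV[int]_n) (s : seq int) : R :=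
  \sum_(1 <= k < n.+1) (wt_exponent (arr z s) k)%:~R * (eps * crd lam k).

Lemma Psi_eps_sum n (lam : 'rV[R]_n) eps (x : 'rV[R]_n) (z : 'rV[int]_n) : (0 < n)%N ->
  scaled_dom eps x -> z = zfloor eps x ->
  Psi_eps lam eps x = \sum_(s \in Box `|crd z 1|%N (woffset n.*2))
    ((eps ^+ woffset n.*2)%:C * (cis (step_phase lam eps z s) * (gtprod (pairwt eps) n (arr z s))%:C)).
Proof.
move=> n0 /zfloorE[Lz _] zE; rewrite -zE in Lz; rewrite /Psi_eps -/(zfloor eps x) -zE.
rewrite (Ppoly_sum _ _ n0 Lz (M := `|crd z 1|%N)); last first.
  have : 0 <= crd z 1 by apply: (proj2 Lz).
  by move: (crd z 1) => c; lia.
rewrite mulr_fsumr; apply: eq_fsbigr => s _.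
rewrite /gtterm gtprod_pairwt -woffset_double !rmorphM/=.
have -> : \prod_(1 <= k < n.+1) crd (\row_(l < n) cexp (0 +i* (eps * crd lam l.+1))) k
     ^ wt_exponent (arr z s) k = cis (step_phase lam eps z s).
  rewrite -cis_sum; apply: eq_big_nat => k /andP[k1 kn].
  by rewrite (crd_row (fun l => cexp (0 +i* (eps * crd lam l.+1)))) ?k1// prednK// cis_exprz.
by ring.
Qed.

Lemma phase_disc n (lam : 'rV[R]_n) eps (x : 'rV[R]_n) (z : 'rV[int]_n) sh
    (t : (woffset n.*2).-tuple (measurableTypeR R)) : 0 < eps -> shifts n eps sh ->
  zscale eps x = \row_(i < n) (crd z i.+1)%:~R ->
  phase lam (arr x (disc eps t)) = step_phase lam eps z (ints eps sh t).
Proof.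
move=> e0 shE xz; apply: eq_big_nat => k /andP[k1 kn].
rewrite (wt_exponent_disc t e0 shE xz) ?k1//; ring.
Qed.

(** The step function is constant on cells of volume eps ^ (n ^ 2), and takes on the
    cell of an integer array the value of the summand of that array. Real and
    imaginary parts are separated, the phase entering through phi. *)
Lemma Psi_eps_integral n (lam : 'rV[R]_n) eps (x : 'rV[R]_n) sh : (0 < n)%N -> 0 < eps ->
  scaled_dom eps x -> shifts n eps sh ->
  [/\ forall phi, (measure_pow (@lebesgue_measure R) (woffset n.*2)).-integrable setT
        (fun t => (stepfun phi lam eps x (zfloor eps x) sh t)%:E),
      complex.Re (Psi_eps lam eps x) =
        \int[measure_pow (@lebesgue_measure R) (woffset n.*2)]_t
           stepfun cos lam eps x (zfloor eps x) sh t &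
      complex.Im (Psi_eps lam eps x) =
        \int[measure_pow (@lebesgue_measure R) (woffset n.*2)]_t
           stepfun sin lam eps x (zfloor eps x) sh t].
Proof.
move=> n0 e0 dom shE; have [Lz xz] := zfloorE dom.
set z := zfloor eps x in Lz xz *.
pose F phi s := phi (step_phase lam eps z s) * gtprod (pairwt eps) n (arr z s).
have FB phi s : size s = woffset n.*2 -> F phi s != 0 -> Box `|crd z 1|%N (woffset n.*2) s.
  by move=> sN; rewrite mulf_eq0 negb_or => /andP[_]; exact: weight_support.
have stepE phi : stepfun phi lam eps x z sh = (fun t => F phi (ints eps sh t)).
  by apply/funext => t; rewrite /stepfun (phase_disc lam t e0 shE xz).
have [r ur rE] := Box_enum `|crd z 1|%N (woffset n.*2).
split.
- by move=> phi; rewrite stepE; exact: integrable_step (FB phi).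
- rewrite stepE (integral_step e0 _ (FB cos)) (Psi_eps_sum lam n0 dom erefl) -/z rE -!fsbig_seq//.
  rewrite raddf_sum mulr_sumr; apply: eq_bigr => s _.
  by rewrite cisE /F /=; ring.
- rewrite stepE (integral_step e0 _ (FB sin)) (Psi_eps_sum lam n0 dom erefl) -/z rE -!fsbig_seq//.
  rewrite raddf_sum mulr_sumr; apply: eq_bigr => s _.
  by rewrite cisE /F /=; ring.
Qed.

Definition psi2 (u v : R) : R := psi u * psi v.

Definition limfun (phi : R -> R) n (lam x : 'rV[R]_n)
    (t : (woffset n.*2).-tuple (measurableTypeR R)) : R :=
  phi (phase lam (arr x t)) * gtprod psi2 n (arr x t).

(** Minus the logarithm of the limiting weight of row j. *)
Definition rowenergy (X : nat -> nat -> R) j : R :=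
  \sum_(1 <= i < (uphalf j).+1) (expR (X j i - X j.+1 i) + expR (X j.+1 i.+1 - X j i)).

Lemma gtprod_psi2 n (X : nat -> nat -> R) :
  gtprod psi2 n X = expR (- \sum_(1 <= j < n.*2) rowenergy X j).
Proof.
rewrite /gtprod -sumrN expR_sum; apply: eq_bigr => j _.
rewrite /pairprod /rowenergy -sumrN expR_sum; apply: eq_bigr => i _.
by rewrite /psi2 /psi -expRD -opprD !opprB.
Qed.

(** The Whittaker potential groups the rows 2k - 1 and 2k - 2. *)
Lemma sum_odd_even n (E : nat -> R) : E 0%N = 0 ->
  \sum_(1 <= j < n.*2) E j = \sum_(1 <= k < n.+1) (E (2 * k - 1)%N + E (2 * k - 2)%N).
Proof.
move=> E0; elim: n => [|n IH]; first by rewrite !big_geq.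
rewrite [RHS]big_nat_recr//= -IH doubleS.
have -> : (2 * n.+1 - 1 = n.*2.+1)%N by lia.
have -> : (2 * n.+1 - 2 = n.*2)%N by lia.
rewrite big_nat_recr//= [RHS]addrCA [RHS]addrC; congr (_ + _).
case: n {IH} => [|n]; first by rewrite !big_geq// E0 addr0.
by rewrite doubleS big_nat_recr.
Qed.

(** With the zero padding the term exp (- x^(2k-1)_k) is the second exponential of the
    last entry of row 2k - 1. *)
Lemma wpotentialE n (lam x : 'rV[R]_n) (t : (woffset n.*2).-tuple (measurableTypeR R)) :
  wpotential (\row_(l < n) (0 +i* crd lam l.+1)) (warray x t) =
  (- \sum_(1 <= j < n.*2) rowenergy (arr x t) j) +i* phase lam (arr x t).
Proof.
have W k i : (1 <= i <= uphalf k)%N -> warray x t k i = arr x t k i.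
  by move=> ik; rewrite /warray /arr ik.
have SE k : \sum_(1 <= i < (uphalf k).+1) warray x t k i = rowsum (arr x t k) (uphalf k).
  by apply: eq_big_nat => i ik; rewrite W.
rewrite /wpotential.
have -> : \sum_(1 <= k < n.+1) crd (\row_(l < n) (0 +i* crd lam l.+1)) k *
     (2 * (\sum_(1 <= i < (uphalf (2 * k - 1)).+1) warray x t (2 * k - 1) i)
      - (\sum_(1 <= i < (uphalf (2 * k)).+1) warray x t (2 * k) i)
      - (\sum_(1 <= i < (uphalf (2 * k - 2)).+1) warray x t (2 * k - 2) i))%:C =
    0 +i* phase lam (arr x t).
  transitivity (\sum_(1 <= k < n.+1) (0 +i* (crd lam k * wt_exponent (arr x t) k))).
    apply: eq_big_nat => k /andP[k1 kn].
    rewrite (crd_row (fun l => 0 +i* crd lam l.+1)) ?k1// prednK// !SE.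
    by apply/eqP; rewrite eq_complex/= !mul0r mulr0 subr0 add0r !eqxx.
  rewrite /phase; elim/big_rec2: _ => // k a b _ ->.
  by apply/eqP; rewrite eq_complex/= addr0 !eqxx.
apply/eqP; rewrite eq_complex/= add0r subr0 eqxx andbT; apply/eqP; congr (- _).
rewrite sum_odd_even; last by rewrite /rowenergy big_geq.
apply: eq_big_nat => k /andP[k1 kn].
rewrite /rowenergy.
have u1 : uphalf (2 * k - 1) = k by lia.
have u2 : uphalf (2 * k - 2) = k.-1 by lia.
have u3 : uphalf (2 * k) = k by lia.
have s1 : ((2 * k - 1).+1 = 2 * k)%N by lia.
have s2 : ((2 * k - 2).+1 = 2 * k - 1)%N by lia.
rewrite u1 u2 s1 s2 prednK//; congr (_ + _).
  rewrite big_nat_recr//=; congr (_ + _).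
    apply: eq_big_nat => i /andP[i1 ik].
    by rewrite !W ?u1 ?u3 ?i1//= ?(ltnW ik)// ltnW.
  rewrite !W ?u1 ?u3 ?k1 ?leqnn//= [arr x t (2 * k) k.+1]arr_out ?u3// sub0r addrC.
  by [].
apply: eq_big_nat => i /andP[i1 ik].
have h1 : (1 <= i <= uphalf (2 * k - 1))%N by lia.
have h2 : (1 <= i.+1 <= uphalf (2 * k - 1))%N by lia.
have h3 : (1 <= i <= uphalf (2 * k - 2))%N by lia.
by rewrite !W// addrC.
Qed.

Lemma Psi_soE n (lam x : 'rV[R]_n) :
  let mN := measure_pow (@lebesgue_measure R) (woffset n.*2) in
  Psi_so (\row_(l < n) (0 +i* crd lam l.+1)) x =
  (\int[mN]_t limfun cos lam x t) +i* (\int[mN]_t limfun sin lam x t).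
Proof.
move=> mN; rewrite /Psi_so /cintegral.
have E t : cexp (wpotential (\row_(l < n) (0 +i* crd lam l.+1)) (warray x t)) =
    limfun cos lam x t +i* limfun sin lam x t.
  rewrite wpotentialE /cexp /= /limfun gtprod_psi2.
  by apply/eqP; rewrite eq_complex/= !mul0r subr0 addr0 ![expR _ * _]mulrC !eqxx.
by congr (_ +i* _); congr Rintegral; apply/funext => t; rewrite E.
Qed.

(** * Domination of the integrand *)

(** The shape of the upper bound for the weight of an entry; c is variable because
    the exponent is shared between two uses. *)
Definition penalty (c u v : R) : R := expR (- (c * (expR (- u) + expR (- v)))).

Lemma penalty_gt0 c u v : 0 < penalty c u v. Proof. exact: expR_gt0. Qed.

Lemma penalty_le1 c u v : 0 < c -> penalty c u v <= 1.
Proof.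
by move=> c0; rewrite -expR0 ler_expR oppr_le0 mulr_ge0 ?addr_ge0 ?expR_ge0// ltW.
Qed.

Lemma penaltyD c d u v : penalty (c + d) u v = penalty c u v * penalty d u v.
Proof. by rewrite /penalty -expRD mulrDl opprD. Qed.

(** The larger of exp (- u) and exp (- v) is at least their geometric mean. *)
Lemma penalty_le_mid c u v : 0 < c -> penalty c u v <= expR (- c * expR (- (u + v) / 2)).
Proof.
move=> c0; rewrite ler_expR mulNr lerN2 ler_pM2l//.
have [uv|vu] := leP u v.
  by rewrite (@le_trans _ _ (expR (- u)))// ?lerDl ?expR_ge0// ler_expR; lra.
by rewrite (@le_trans _ _ (expR (- v)))// ?lerDr ?expR_ge0// ler_expR; lra.
Qed.

Definition row_weight (X : nat -> nat -> R) j : R := \prod_(1 <= i < (uphalf j).+1) (1 + X j i ^+ 2).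

Lemma oneDsq_ge1 (y : R) : 1 <= 1 + y ^+ 2.
Proof. by rewrite lerDl sqr_ge0. Qed.

Lemma prod_oneDsq_ge1 (I : Type) (r : seq I) (F : I -> R) : 1 <= \prod_(i <- r) (1 + F i ^+ 2).
Proof.
elim: r => [|i r IH]; first by rewrite big_nil.
by rewrite big_cons (le_trans IH)// ler_peMl ?oneDsq_ge1// (le_trans ler01 IH).
Qed.

Lemma row_weight_ge1 X j : 1 <= row_weight X j. Proof. exact: prod_oneDsq_ge1. Qed.

Lemma row_weight_gt0 X j : 0 < row_weight X j. Proof. exact: lt_le_trans ltr01 (row_weight_ge1 X j). Qed.

Definition zero_ext (X : nat -> nat -> R) := forall k i, (uphalf k < i)%N -> X k i = 0.

(** Entry i of row j has the neighbours i and i + 1 above, which is why the row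
    weight of row j + 1 enters twice. *)
Lemma row_weight_left X j : \prod_(1 <= i < (uphalf j).+1) (1 + X j.+1 i ^+ 2) <= row_weight X j.+1.
Proof.
have jj : ((uphalf j).+1 <= (uphalf j.+1).+1)%N by lia.
rewrite /row_weight [leRHS](big_cat_nat _ jj)//=.
rewrite ler_peMr ?prod_oneDsq_ge1//.
by apply: le_trans (prod_oneDsq_ge1 _ _); exact: ler01.
Qed.

Lemma row_weight_right X j : zero_ext X ->
  \prod_(1 <= i < (uphalf j).+1) (1 + X j.+1 i.+1 ^+ 2) <= row_weight X j.+1.
Proof.
move=> Xo.
have -> : row_weight X j.+1 = \prod_(1 <= i < (uphalf j).+2) (1 + X j.+1 i ^+ 2).
  rewrite /row_weight; have [->//|E] : uphalf j.+1 = (uphalf j).+1 \/ uphalf j.+1 = uphalf j by lia.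
  have Z0 : X j.+1 (uphalf j).+1 = 0 by apply: Xo; rewrite E.
  by rewrite E [RHS]big_nat_recr// Z0 expr0n addr0 /= mulr1.
rewrite [leRHS]big_nat_recl// ler_peMl ?oneDsq_ge1//.
by apply: le_trans (prod_oneDsq_ge1 _ _); exact: ler01.
Qed.

(** Peetre's inequality for all the entries of a row. *)
Lemma row_peetre (c : R) D : 0 < c -> exists2 K : R, 0 < K & forall X j, zero_ext X ->
  pairprod (penalty c) (X j.+1) (X j) (uphalf j) <=
  K ^+ uphalf j * (row_weight X j.+1 ^+ (2 * D) / row_weight X j ^+ D).
Proof.
move=> c0; have [K K0 HK] := peetre D c0; exists K => // X j Xo.
have g0 (y : R) : 0 < (1 + y ^+ 2) ^+ D by rewrite exprn_gt0// (lt_le_trans ltr01)// oneDsq_ge1.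
apply: (@le_trans _ _ (\prod_(1 <= i < (uphalf j).+1)
   (K * ((1 + X j.+1 i ^+ 2) * (1 + X j.+1 i.+1 ^+ 2)) ^+ D / (1 + X j i ^+ 2) ^+ D))).
  apply: ler_prod => i _; rewrite ltW ?penalty_gt0//= ler_pdivlMr// mulrC.
  by have := HK (X j.+1 i) (X j.+1 i.+1) (X j i); rewrite /penalty !opprB.
rewrite prodf_div big_split/= prodr_const_nat subn1/= -mulrA; apply: ler_wpM2l.
  by rewrite exprn_ge0// ltW.
rewrite /row_weight -prodrXl -/(row_weight X j.+1) !prodrXl.
apply: ler_wpM2r; first by rewrite invr_ge0 exprn_ge0// ltW// row_weight_gt0.
rewrite big_split/= mul2n -addnn exprD exprMn.
apply: ler_pM; rewrite ?exprn_ge0 ?(le_trans ler01 (prod_oneDsq_ge1 _ _))//.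
  by rewrite lerXn2r ?nnegrE ?(le_trans ler01 (prod_oneDsq_ge1 _ _)) ?(ltW (row_weight_gt0 _ _))// row_weight_left.
by rewrite lerXn2r ?nnegrE ?(le_trans ler01 (prod_oneDsq_ge1 _ _)) ?(ltW (row_weight_gt0 _ _))// row_weight_right.
Qed.

(** Row j must provide its own factor 1 / (1 + y ^ 2) and pay for twice the power
    already owed by the rows below it. *)
Fixpoint peetre_exp m : nat := if m is m'.+1 then (2 * peetre_exp m').+1 else 0.

Lemma prod_nat1_recr (F : nat -> R) m :
  \prod_(1 <= j < m.+2) F j = (\prod_(1 <= j < m.+1) F j) * F m.+1.
Proof. by rewrite big_nat_recr. Qed.

(** Each row repays the power produced by the row below it and leaves one inverse
    row weight. *)
Lemma array_peetre (c : R) m : 0 < c -> exists2 C : R, 0 < C & forall X, zero_ext X ->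
  \prod_(1 <= j < m.+1) pairprod (penalty c) (X j.+1) (X j) (uphalf j) <=
  C * row_weight X m.+1 ^+ (2 * peetre_exp m) * \prod_(1 <= j < m.+1) (row_weight X j)^-1.
Proof.
move=> c0; elim: m => [|m [C C0 HC]].
  by exists 1 => // X _; rewrite !big_geq// mulr1 mul1r -[(2 * peetre_exp 0)%N]/0%N expr0.
have [K K0 HK] := row_peetre (peetre_exp m.+1) c0.
exists (C * K ^+ uphalf m.+1) => [|X Xo]; first by rewrite mulr_gt0// exprn_gt0.
rewrite !prod_nat1_recr.
have pp0 j : 0 <= pairprod (penalty c) (X j.+1) (X j) (uphalf j).
  by apply: prodr_ge0 => i _; exact/ltW/penalty_gt0.
apply: (@le_trans _ _ (C * row_weight X m.+1 ^+ (2 * peetre_exp m) * \prod_(1 <= j < m.+1) (row_weight X j)^-1 *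
   (K ^+ uphalf m.+1 * (row_weight X m.+2 ^+ (2 * peetre_exp m.+1) / row_weight X m.+1 ^+ peetre_exp m.+1)))).
  apply: ler_pM; [by apply: prodr_ge0 => j _; exact: pp0|exact: pp0|exact: HC|exact: HK].
have w0 := row_weight_gt0 X m.+1.
rewrite le_eqVlt; apply/orP; left; apply/eqP.
rewrite [in X in _ / X]/= exprS invfM.
set P := \prod_(_ <= _ < _) _; set W := row_weight X m.+2 ^+ _; set KK := K ^+ _.
have Wn : row_weight X m.+1 ^+ (2 * peetre_exp m) != 0 by rewrite expf_neq0 ?gt_eqF.
move: (_ ^+ (2 * _)) Wn => V Vn.
by field; rewrite Vn gt_eqF.
Qed.

Lemma prod_flat (h : nat -> R) m :
  \prod_(1 <= j < m) \prod_(1 <= i < (uphalf j).+1) h (woffset j + i.-1)%N =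
  \prod_(l < woffset m) h l.
Proof.
case: m => [|m]; first by rewrite /woffset !big_geq// big_ord0.
elim: m => [|m IH]; first by rewrite /woffset !big_geq// big_ord0.
rewrite prod_nat1_recr IH (woffsetS m.+1) big_split_ord; congr (_ * _).
by rewrite big_add1 big_mkord.
Qed.

Lemma zero_ext_arr n (x : 'rV[R]_n) (s : seq R) : zero_ext (arr x s).
Proof. by move=> k i h; exact: arr_out. Qed.

Lemma prod_row_weight_arr n (x : 'rV[R]_n) (s : seq R) :
  \prod_(1 <= j < n.*2) (row_weight (arr x s) j)^-1 = \prod_(l < woffset n.*2) decay (nth 0 s l).
Proof.
rewrite -(prod_flat (fun l => decay (nth 0 s l))); apply: eq_big_nat => j /andP[j1 jn].
rewrite /row_weight -prodfV; apply: eq_big_nat => i /andP[i1 ij].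
by rewrite /decay /arr i1 -ltnS ij (ltn_eqF jn).
Qed.

Lemma disc_near eps y : 0 < eps -> `|eps * (Num.floor (y / eps))%:~R - y| <= eps.
Proof.
move=> e0; have := floor_itv (y / eps); rewrite intrD1 ler_pdivlMr// ltr_pdivrMr// => /andP[h1 h2].
by rewrite ler_distl; apply/andP; split; lra.
Qed.

(** Replacing a point by its grid point, at distance at most 1, costs a factor 3. *)
Lemma decay_near (u y : R) : `|u - y| <= 1 -> decay u <= 3 * decay y.
Proof.
move=> uy; have a0 : 0 < 1 + u ^+ 2 := lt_le_trans ltr01 (oneDsq_ge1 u).
have b0 : 0 < 1 + y ^+ 2 := lt_le_trans ltr01 (oneDsq_ge1 y).
rewrite /decay ler_pdivlMr// mulrC ler_pdivrMr//.
move: uy; rewrite ler_norml => /andP[h1 h2].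
have : (u - y) ^+ 2 <= 1 by nra.
have := sqr_ge0 (u + (u - y)); nra.
Qed.

Lemma pairprod_nat_eq (V : zmodType) (G1 : V -> V -> R) (G2 : R -> R -> R)
    (X1 Y1 : nat -> V) (X2 Y2 : nat -> R) r :
  (forall i, (1 <= i <= r)%N ->
     0 <= G1 (X1 i - Y1 i) (Y1 i - X1 i.+1) <= G2 (X2 i - Y2 i) (Y2 i - X2 i.+1)) ->
  0 <= pairprod G1 X1 Y1 r <= pairprod G2 X2 Y2 r.
Proof.
move=> H; apply/andP; split.
  rewrite /pairprod big_nat; apply: prodr_ge0 => i ir.
  by case/andP: (H i ir).
by rewrite /pairprod big_nat [leRHS]big_nat; apply: ler_prod => i ir; exact: H.
Qed.

Lemma bigprod_le1 (I : Type) (r : seq I) (F : I -> R) :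
  (forall i, 0 <= F i <= 1) -> \prod_(i <- r) F i <= 1.
Proof.
move=> F01; elim: r => [|i r IH]; first by rewrite big_nil.
rewrite big_cons mulr_ile1//; first by case/andP: (F01 i).
  by apply: prodr_ge0 => j _; case/andP: (F01 j).
by case/andP: (F01 i).
Qed.

(** The weight 1/4 of the penalties is split into two halves: one is kept for the top
    row only and gives the double exponentials in x, the other feeds
    [array_peetre]. *)
Lemma stepfun_bound n : (0 < n)%N -> exists C c e0 : R, exists D : nat,
  [/\ 0 < C, 0 < c, 0 < e0 & forall phi (lam x : 'rV[R]_n) eps sh t,
    (forall u, `|phi u| <= 1) -> 0 < eps < e0 -> scaled_dom eps x -> shifts n eps sh ->
    `|stepfun phi lam eps x (zfloor eps x) sh t| <=
    C * (\prod_(1 <= i < n.+1) (1 + crd x i ^+ 2)) ^+ D *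
      (\prod_(1 <= i < n.+1) expR (- c * expR (- (crd x i - crd x i.+1) / 2))) * tdecay t].
Proof.
move=> n0; have [e1 e10 H1] := pairwt_le R.
have c8 : (0 : R) < 8^-1 by rewrite invr_gt0 ltr0n.
have [C C0 HC] := array_peetre n.*2.-1 c8.
have n2 : n.*2.-1.+1 = n.*2 by lia.
rewrite n2 in HC.
exists (2 ^+ woffset n.*2 * C * 3 ^+ woffset n.*2), 8^-1, (Num.min e1 1), (2 * peetre_exp n.*2.-1)%N.
split.
- by rewrite !mulr_gt0// exprn_gt0// ltr0n.
- by [].
- by rewrite lt_min e10 ltr01.
move=> phi lam x eps sh t phi1 /andP[e0]; rewrite lt_min => /andP[ee1 ee2] dom shE.
have [Lz xz] := zfloorE dom; set z := zfloor eps x in Lz xz *.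
set Dd := arr x (disc eps t); set Z := arr z (ints eps sh t).
have b1 : 0 <= gtprod (pairwt eps) n Z <=
   \prod_(1 <= j < n.*2) pairprod (fun u v => 2 * penalty 4^-1 u v) (Dd j.+1) (Dd j) (uphalf j).
  have rowb j : (1 <= j < n.*2)%N -> 0 <= pairprod (pairwt eps) (Z j.+1) (Z j) (uphalf j) <=
      pairprod (fun u v => 2 * penalty 4^-1 u v) (Dd j.+1) (Dd j) (uphalf j).
    move=> jn; apply: pairprod_nat_eq => i ij; rewrite pairwt_ge0//=.
    have [g1 g2] := gap_disc t e0 shE xz jn ij; rewrite -g1 -g2.
    by apply: H1; rewrite e0.
  apply/andP; split.
    by rewrite /gtprod big_nat; apply: prodr_ge0 => j /rowb/andP[].
  by rewrite /gtprod big_nat [leRHS]big_nat; apply: ler_prod => j /rowb.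
have b2 : \prod_(1 <= j < n.*2) pairprod (fun u v => 2 * penalty 4^-1 u v) (Dd j.+1) (Dd j) (uphalf j) =
   2 ^+ woffset n.*2 * (\prod_(1 <= j < n.*2) pairprod (penalty 8^-1) (Dd j.+1) (Dd j) (uphalf j) *
                 \prod_(1 <= j < n.*2) pairprod (penalty 8^-1) (Dd j.+1) (Dd j) (uphalf j)).
  rewrite {1}/woffset -prodrXr -!big_split/=; apply: eq_bigr => j _.
  rewrite /pairprod -big_split/=.
  have -> : 2 ^+ uphalf j = \prod_(1 <= i < (uphalf j).+1) 2 :> R by rewrite prodr_const_nat subn1.
  rewrite -big_split/=; apply: eq_bigr => i _.
  by rewrite (_ : 4^-1 = 8^-1 + 8^-1) ?penaltyD//; field.
have pr0 j : 0 <= pairprod (penalty 8^-1) (Dd j.+1) (Dd j) (uphalf j).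
  by apply: prodr_ge0 => i _; exact/ltW/penalty_gt0.
have pr1 j : pairprod (penalty 8^-1) (Dd j.+1) (Dd j) (uphalf j) <= 1.
  by apply: bigprod_le1 => i; rewrite ltW ?penalty_gt0// penalty_le1.
have topD i : (0 < i)%N -> Dd n.*2 i = crd x i.
  move=> i0; rewrite /Dd /arr eqxx i0/= (_ : uphalf n.*2 = n); last by lia.
  by case: leqP => // h; rewrite crd_out.
have b3 : \prod_(1 <= j < n.*2) pairprod (penalty 8^-1) (Dd j.+1) (Dd j) (uphalf j) <=
   \prod_(1 <= i < n.+1) expR (- 8^-1 * expR (- (crd x i - crd x i.+1) / 2)).
  have [m nE] : exists m, n = m.+1 by exists n.-1; rewrite prednK.
  have -> : n.*2 = (m.*2.+1).+1 by rewrite nE.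
  rewrite prod_nat1_recr.
  apply: (@le_trans _ _ (pairprod (penalty 8^-1) (Dd m.*2.+2) (Dd m.*2.+1) (uphalf m.*2.+1))).
    by rewrite ler_piMl//; apply: bigprod_le1 => j; rewrite pr0 pr1.
  rewrite /pairprod (_ : uphalf m.*2.+1 = n); last by lia.
  rewrite (_ : m.*2.+2 = n.*2); last by rewrite nE.
  rewrite big_nat [leRHS]big_nat; apply: ler_prod => i /andP[i1 _].
  rewrite ltW ?penalty_gt0//=; apply: le_trans (penalty_le_mid _ _ c8) _.
  by rewrite !topD// addrA subrK.
have b4 := HC Dd (@zero_ext_arr _ _ _).
rewrite prod_row_weight_arr (_ : row_weight Dd n.*2 = \prod_(1 <= i < n.+1) (1 + crd x i ^+ 2)) in b4; last first.
  rewrite /row_weight (_ : uphalf n.*2 = n); last by lia.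
  by apply: eq_big_nat => i /andP[i1 _]; rewrite topD.
have b5 : \prod_(l < woffset n.*2) decay (nth 0 (disc eps t) l) <= 3 ^+ woffset n.*2 * tdecay t.
  have -> : 3 ^+ woffset n.*2 = \prod_(l < woffset n.*2) 3 :> R by rewrite prodr_const card_ord.
  rewrite /tdecay -big_split/=; apply: ler_prod => l _; rewrite ltW ?decay_gt0//=.
  rewrite (nth_map 0) ?size_tuple// (tnth_nth 0); apply: decay_near.
  by apply: le_trans (disc_near _ e0) _; exact: ltW.
rewrite /stepfun normrM; case/andP: b1 => b10 b1.
rewrite [`|gtprod _ _ _|]ger0_norm//; apply: (@le_trans _ _ (gtprod (pairwt eps) n Z)).
  by rewrite ler_piMl.
apply: le_trans b1 _; rewrite b2.
move: b3 b4 b5; set P := \prod_(1 <= j < n.*2) _; set E := \prod_(1 <= i < n.+1) expR _.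
set W := (\prod_(1 <= i < n.+1) _) ^+ _; set T := \prod_(l < _) _; move=> b3 b4 b5.
have P0 : 0 <= P by apply: prodr_ge0.
have W0 : 0 <= W by rewrite exprn_ge0// (le_trans ler01)// prod_oneDsq_ge1.
have E0 : 0 <= E := le_trans P0 b3.
apply: (@le_trans _ _ (2 ^+ woffset n.*2 * (E * (C * W * (3 ^+ woffset n.*2 * tdecay t))))).
  apply: ler_wpM2l; first by rewrite exprn_ge0.
  apply: ler_pM => //; apply: le_trans b4 _.
  by apply: ler_wpM2l => //; rewrite mulr_ge0// ltW.
rewrite le_eqVlt; apply/orP; left; apply/eqP; ring.
Qed.

(** * Pointwise convergence of the integrand *)

(** Factors within h <= 1 of numbers in [0, 1] are bounded by 2, so each exchange
    of a factor costs at most h times a power of 2. *)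
Lemma prod_near (r : seq nat) (f g : nat -> R) (h : R) : 0 <= h <= 1 ->
  (forall i, i \in r -> 0 <= g i <= 1) -> (forall i, i \in r -> `|f i - g i| <= h) ->
  [/\ 0 <= \prod_(i <- r) g i <= 1, `|\prod_(i <- r) f i| <= 2 ^+ size r &
  `|\prod_(i <- r) f i - \prod_(i <- r) g i| <= 2 ^+ size r * h].
Proof.
move=> /andP[h0 h1]; elim: r => [|j r IH] Hg Hf.
  by rewrite !big_nil subrr normr0 normr1 mulr_ge0// ler01 lexx.
have rj i : i \in r -> i \in j :: r by rewrite in_cons => ->; rewrite orbT.
have [/andP[G0 G1] F2 FG] := IH (fun i ir => Hg i (rj i ir)) (fun i ir => Hf i (rj i ir)).
rewrite !big_cons; have /andP[g0 g1] := Hg j (mem_head _ _); have fj := Hf j (mem_head _ _).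
have f2 : `|f j| <= 2.
  have := ler_normD (f j - g j) (g j); rewrite subrK (ger0_norm g0); lra.
move: G0 G1 F2 FG; set F := \prod_(i <- r) f i; set G := \prod_(i <- r) g i => G0 G1 F2 FG.
split.
- by rewrite mulr_ge0//= mulr_ile1.
- by rewrite normrM exprS ler_pM.
have -> : f j * F - g j * G = (f j - g j) * F + g j * (F - G) by ring.
apply: le_trans (ler_normD _ _) _; rewrite !normrM (ger0_norm g0) exprS.
have -> : 2 * 2 ^+ size r * h = h * 2 ^+ size r + 1 * (2 ^+ size r * h) by ring.
by apply: lerD; apply: ler_pM.
Qed.

(** Twice the estimate for products, along a row and then over the rows. *)
Lemma gtprod_near (V : zmodType) n (G1 : V -> V -> R) (G2 : R -> R -> R)
    (X : nat -> nat -> V) (Y : nat -> nat -> R) (h : R) : 0 <= h -> 2 ^+ n * h <= 1 ->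
  (forall u v, 0 <= G2 u v <= 1) ->
  (forall j i, (1 <= j < n.*2)%N -> (1 <= i <= uphalf j)%N ->
     `|G1 (X j.+1 i - X j i) (X j i - X j.+1 i.+1) - G2 (Y j.+1 i - Y j i) (Y j i - Y j.+1 i.+1)| <= h) ->
  0 <= gtprod G2 n Y <= 1 /\ `|gtprod G1 n X - gtprod G2 n Y| <= 2 ^+ n.*2 * (2 ^+ n * h).
Proof.
move=> h0 hn G2b H; have n1 : 1 <= (2 : R) ^+ n by rewrite exprn_ege1// ler1n.
have h1 : h <= 1 by apply: le_trans hn; rewrite ler_peMl.
have row j : j \in index_iota 1 n.*2 ->
   0 <= pairprod G2 (Y j.+1) (Y j) (uphalf j) <= 1 /\
   `|pairprod G1 (X j.+1) (X j) (uphalf j) - pairprod G2 (Y j.+1) (Y j) (uphalf j)| <= 2 ^+ n * h.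
  rewrite mem_index_iota => jn.
  have [|||P1 _ P2] := @prod_near (index_iota 1 (uphalf j).+1)
    (fun i => G1 (X j.+1 i - X j i) (X j i - X j.+1 i.+1))
    (fun i => G2 (Y j.+1 i - Y j i) (Y j i - Y j.+1 i.+1)) h.
  - by rewrite h0.
  - by move=> i _; exact: G2b.
  - by move=> i; rewrite mem_index_iota ltnS => ij; exact: H.
  split=> //; apply: le_trans P2 _; apply: ler_wpM2r => //.
  by rewrite size_iota subn1/= ler_eXn2l ?ltr1n//; lia.
have [|||P1 _ P2] := @prod_near (index_iota 1 n.*2)
    (fun j => pairprod G1 (X j.+1) (X j) (uphalf j)) (fun j => pairprod G2 (Y j.+1) (Y j) (uphalf j)) (2 ^+ n * h).
- by rewrite hn mulr_ge0// exprn_ge0.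
- by move=> j /row[].
- by move=> j /row[].
split=> //; apply: le_trans P2 _; apply: ler_wpM2r; first by rewrite mulr_ge0// exprn_ge0.
by rewrite size_iota ler_eXn2l ?ltr1n//; lia.
Qed.

Lemma arr_disc_near n (x : 'rV[R]_n) eps (t : (woffset n.*2).-tuple (measurableTypeR R)) k i :
  0 < eps -> (k <= n.*2)%N -> `|arr x (disc eps t) k i - arr x t k i| <= eps.
Proof.
move=> e0 kn; rewrite /arr; case: ifP => ik; last by rewrite subrr normr0 ltW.
case: eqP => kE; first by rewrite subrr normr0 ltW.
have kn' : (k < n.*2)%N by rewrite ltn_neqAle kn andbT; exact/eqP.
by rewrite (nth_map 0) ?disc_near// size_tuple (flat_index_lt kn' ik).
Qed.

Lemma arr_le n (x : 'rV[R]_n) (t : seq R) B k i : 0 <= B -> (forall i, `|crd x i| <= B) ->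
  `|arr x t k i| <= B + \sum_(y <- t) `|y|.
Proof.
move=> B0 xB; have S0 : 0 <= \sum_(y <- t) `|y| by apply: sumr_ge0.
rewrite /arr; case: ifP => _; last by rewrite normr0 addr_ge0.
case: ifP => _; first by rewrite (le_trans (xB _))// lerDl.
have [h|h] := ltnP (woffset k + i.-1) (size t); last by rewrite nth_default// normr0 addr_ge0.
rewrite (le_trans _ (_ : \sum_(y <- t) `|y| <= _))// ?lerDr//.
have := mem_nth 0 h; move: (nth 0 t _) => y; elim: t {S0 h} => // a s IH.
rewrite in_cons big_cons => /orP[/eqP ->|/IH h]; first by rewrite lerDl sumr_ge0.
by rewrite (le_trans h)// lerDr.
Qed.

Lemma rowsum_near (X Y : nat -> R) r eps : (forall i, `|X i - Y i| <= eps) ->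
  `|rowsum X r - rowsum Y r| <= r%:R * eps.
Proof.
move=> H; rewrite /rowsum -sumrB; apply: le_trans (ler_norm_sum _ _ _) _.
apply: (@le_trans _ _ (\sum_(1 <= i < r.+1) eps)); first by apply: ler_sum.
by rewrite sumr_const_nat subn1 mulr_natl.
Qed.

(** The phase is linear in the entries, with at most n entries per row. *)
Lemma phase_near n (lam x : 'rV[R]_n) eps (t : (woffset n.*2).-tuple (measurableTypeR R)) : 0 < eps ->
  `|phase lam (arr x (disc eps t)) - phase lam (arr x t)| <=
  (\sum_(1 <= k < n.+1) `|crd lam k| * (4 * n%:R)) * eps.
Proof.
move=> e0; rewrite /phase -sumrB mulr_suml; apply: le_trans (ler_norm_sum _ _ _) _.
rewrite big_nat [leRHS]big_nat; apply: ler_sum => k /andP[k1 kn].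
rewrite -mulrBr normrM -mulrA ler_wpM2l// /wt_exponent.
have D j : (j <= n.*2)%N -> `|rowsum (arr x (disc eps t) j) (uphalf j) - rowsum (arr x t j) (uphalf j)| <= (uphalf j)%:R * eps.
  by move=> jn; apply: rowsum_near => i; exact: arr_disc_near.
have j1 : (2 * k - 1 <= n.*2)%N by lia.
have j2 : (2 * k <= n.*2)%N by lia.
have j3 : (2 * k - 2 <= n.*2)%N by lia.
move: (D _ j1) (D _ j2) (D _ j3).
move: (rowsum _ _) (rowsum _ _) (rowsum _ _) (rowsum _ _) (rowsum _ _) (rowsum _ _) => c' c b' b a' a.
have -> : uphalf (2 * k - 1) = k by lia.
have -> : uphalf (2 * k) = k by lia.
have u3 : ((uphalf (2 * k - 2))%:R : R) <= k%:R by rewrite ler_nat; lia.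
have kn' : (k%:R : R) <= n%:R by rewrite ler_nat -ltnS.
move=> h1 h2 h3.
have h3' : `|c - c'| <= k%:R * eps by apply: le_trans h3 _; rewrite ler_pM2r.
have h4 : k%:R * eps <= n%:R * eps by rewrite ler_pM2r.
move: h1 h2 h3' h4; move: (k%:R * eps) => u h1 h2 h3' h4.
have -> : 4 * n%:R * eps = 4 * (n%:R * eps) by ring.
move: (n%:R * eps) h4 => v h4.
move: h1 h2 h3'; rewrite !ler_norml => /andP[p1 p2] /andP[p3 p4] /andP[p5 p6].
by apply/andP; split; lra.
Qed.

Lemma psi2_itv (u v : R) : 0 <= psi2 u v <= 1.
Proof.
have /andP[a0 a1] := psi_itv u; have /andP[b0 b1] := psi_itv v.
by rewrite mulr_ge0//= mulr_ile1.
Qed.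

(** At a fixed point t all gaps are bounded in terms of B and t, so every weight is
    close to its limit, uniformly in x; the discretisation moves entries by at
    most eps. *)
Lemma stepfun_near (phi : R -> R) n (lam : 'rV[R]_n) (B : R) (t : (woffset n.*2).-tuple (measurableTypeR R)) (d : R) :
  (forall u, `|phi u| <= 1) -> (forall u v, `|phi u - phi v| <= `|u - v|) -> 0 <= B -> 0 < d ->
  exists2 e0 : R, 0 < e0 & forall eps (x : 'rV[R]_n) sh, 0 < eps < e0 -> scaled_dom eps x -> shifts n eps sh ->
    (forall i, `|crd x i| <= B) ->
    `|stepfun phi lam eps x (zfloor eps x) sh t - limfun phi lam x t| <= d.
Proof.
move=> phi1 phiL B0 d0.
pose Bt := B + \sum_(y <- t) `|y|.
have Bt0 : 0 <= Bt by rewrite addr_ge0// sumr_ge0.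
pose Kn : R := 2 ^+ n.*2 * 2 ^+ n.
have k0 (k : nat) : 0 < (2 : R) ^+ k by rewrite exprn_gt0.
have Kn0 : 0 < Kn by rewrite mulr_gt0.
pose eta : R := Num.min (1 / Kn) (d / (4 * Kn)).
have eta0 : 0 < eta by rewrite lt_min !divr_gt0 ?mulr_gt0.
have etaK : Kn * eta <= 1 by rewrite mulrC -ler_pdivlMr// ge_min lexx.
have etad : Kn * eta <= d / 4.
  have : eta <= d / (4 * Kn) by rewrite ge_min lexx orbT.
  by rewrite ler_pdivlMr ?mulr_gt0// => h; rewrite ler_pdivlMr//; lra.
pose Cp := \sum_(1 <= k < n.+1) `|crd lam k| * (4 * n%:R).
have Cp0 : 0 <= Cp by apply: sumr_ge0 => k _; rewrite !mulr_ge0.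
have B20 : 0 <= 2 * Bt + 2 by rewrite addr_ge0// mulr_ge0.
have [e1 e10 H1] := pairwt_near_psi B20 (divr_gt0 eta0 (ltr0n _ 2)).
exists (Num.min (Num.min e1 1) (Num.min (eta / 8) (d / (4 * (Cp + 1))))).
  by rewrite !lt_min e10 ltr01 !divr_gt0// mulr_gt0// ltr_wpDl.
move=> eps x sh /andP[e0]; rewrite !lt_min => /andP[/andP[ee1 ee2] /andP[ee3 ee4]] dom shE xB.
have [Lz xz] := zfloorE dom; set z := zfloor eps x in Lz xz *.
set D := arr x (disc eps t); set L := arr x t; set Z := arr z (ints eps sh t).
have DL k i : (k <= n.*2)%N -> `|D k i - L k i| <= eps by move=> kn; exact: arr_disc_near.
have LB k i : `|L k i| <= Bt by exact: arr_le.
have DB k i : (k <= n.*2)%N -> `|D k i| <= Bt + 1.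
  move=> kn; have := ler_normD (D k i - L k i) (L k i); rewrite subrK => h.
  have h1 := DL k i kn; have h2 := LB k i; lra.
have gapB (u v : R) : `|u| <= Bt + 1 -> `|v| <= Bt + 1 -> `|u - v| <= 2 * Bt + 2.
  by move=> h1 h2; have := ler_normB u v; lra.
have gapD (a b a' b' : R) : `|a - a'| <= eps -> `|b - b'| <= eps -> `|psi (a - b) - psi (a' - b')| <= 2 * eps.
  move=> h1 h2; apply: le_trans (psi_lipschitz _ _) _.
  have -> : a - b - (a' - b') = (a - a') - (b - b') by ring.
  by have := ler_normB (a - a') (b - b'); lra.
have near j i : (1 <= j < n.*2)%N -> (1 <= i <= uphalf j)%N ->
   `|pairwt eps (Z j.+1 i - Z j i) (Z j i - Z j.+1 i.+1) -
     psi2 (L j.+1 i - L j i) (L j i - L j.+1 i.+1)| <= eta.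
  move=> jn ij; have /andP[j0 jn'] := jn.
  have [g1 g2] := gap_disc t e0 shE xz jn ij; rewrite -/D -/Z in g1 g2.
  have m1 := DB j i (ltnW jn'); have m2 := DB j.+1 i jn'; have m3 := DB j.+1 i.+1 jn'.
  have := H1 eps (Z j.+1 i - Z j i) (Z j i - Z j.+1 i.+1); rewrite e0 ee1 g1 g2.
  move=> /(_ isT (gapB _ _ m2 m1) (gapB _ _ m1 m3)).
  have p1 := gapD _ _ _ _ (DL j.+1 i jn') (DL j i (ltnW jn')).
  have p2 := gapD _ _ _ _ (DL j i (ltnW jn')) (DL j.+1 i.+1 jn').
  have := mul_near (psi_itv _) (psi_itv _) p1 p2; rewrite /psi2.
  move: (pairwt _ _ _) (psi _ * psi _) (psi _ * psi _) => a b c h1 h2.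
  have := ler_distD c a b; lra.
have h2n : 2 ^+ n * eta <= 1.
  apply: le_trans etaK; rewrite ler_wpM2r// ?(ltW eta0)// /Kn ler_peMl ?(ltW (k0 n))//.
  by rewrite exprn_ege1// ler1n.
have [/andP[g0 g1] gn] := gtprod_near (ltW eta0) h2n psi2_itv near.
have ph := phase_near lam x t e0; rewrite -/Cp -/D -/L in ph.
have {}gn : `|gtprod (pairwt eps) n Z - gtprod psi2 n L| <= Kn * eta.
  by apply: le_trans gn _; rewrite mulrA.
rewrite /stepfun /limfun -/D -/L -/Z.
have pD := phiL (phase lam D) (phase lam L); have pb := phi1 (phase lam L).
have Cpe : Cp * eps <= d / 4.
  have : (Cp + 1) * eps <= d / 4.
    by move: ee4; rewrite ltr_pdivlMr ?mulr_gt0 ?ltr_wpDl// => h; rewrite ler_pdivlMr//; lra.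
  by apply: le_trans; rewrite ler_pM2r// lerDl.
have {ph}pD := le_trans pD (le_trans ph Cpe).
move: (gtprod (pairwt eps) n Z) (gtprod psi2 n L) (phi (phase lam D)) (phi (phase lam L)) gn g0 g1 pD pb
  => W G a b gn g0 g1 ab b1.
have -> : a * W - b * G = (a - b) * W + b * (W - G) by ring.
apply: le_trans (ler_normD _ _) _; rewrite !normrM.
have W2 : `|W| <= 2.
  have := ler_normD (W - G) G; rewrite subrK (ger0_norm g0) => h.
  have := le_trans gn etaK; lra.
have t1 : `|a - b| * `|W| <= d / 4 * 2 by apply: ler_pM.
have t2 : `|b| * `|W - G| <= 1 * (d / 4) by apply: ler_pM => //; exact: le_trans gn etad.
lra.
Qed.

(** Both x - f x and x + f x are nondecreasing. *)
Lemma lipschitz1_of_derive (f df : R -> R) : (forall x, is_derive x 1 f (df x)) ->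
  (forall x, `|df x| <= 1) -> forall u v, `|f u - f v| <= `|u - v|.
Proof.
move=> Df df1; suff W u v : u <= v -> `|f u - f v| <= `|u - v|.
  by move=> u v; have [/W//|/ltW/W] := leP u v; rewrite distrC [leRHS]distrC.
move=> uv; rewrite [leRHS]distrC (ger0_norm (x := v - u)) ?subr_ge0//.
have up : u - f u <= v - f v.
  apply: (@le_from_derive _ (fun x => x - f x) (fun x => 1 - df x)) => // x _.
  by rewrite subr_ge0 (le_trans (ler_norm _)).
have lo : u + f u <= v + f v.
  apply: (@le_from_derive _ (fun x => x + f x) (fun x => 1 + df x)) => // x _.
  by rewrite -[df x]opprK subr_ge0 (le_trans (ler_norm _))// normrN.
rewrite ler_norml; apply/andP; split; lra.
Qed.

Lemma cos_norm_le1 (u : R) : `|cos u| <= 1.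
Proof. by rewrite ler_norml cos_geN1 cos_le1. Qed.

Lemma sin_norm_le1 (u : R) : `|sin u| <= 1.
Proof. by rewrite ler_norml sin_geN1 sin_le1. Qed.

Lemma cos_lipschitz1 (u v : R) : `|cos u - cos v| <= `|u - v|.
Proof.
by apply: (@lipschitz1_of_derive cos (fun x => - sin x)) => x; rewrite normrN sin_norm_le1.
Qed.

Lemma sin_lipschitz1 (u v : R) : `|sin u - sin v| <= `|u - v|.
Proof.
by apply: (@lipschitz1_of_derive sin cos) => x; exact: cos_norm_le1.
Qed.

(** * Convergence of the integrals *)

(** The limit weight is a product of penalties with c = 1. *)
Lemma limfun_bound n : (0 < n)%N -> exists2 C : R, 0 < C & exists D : nat, forall phi (lam x : 'rV[R]_n) t,
  (forall u, `|phi u| <= 1) ->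
  `|limfun phi lam x t| <= C * (\prod_(1 <= i < n.+1) (1 + crd x i ^+ 2)) ^+ D * tdecay t.
Proof.
case: n => // n _; have [C C0 HC] := array_peetre n.*2.+1 ltr01.
exists C => //; exists (2 * peetre_exp n.*2.+1)%N => phi lam x t phi1.
have := HC (arr x t) (@zero_ext_arr _ _ _).
rewrite -doubleS prod_row_weight_arr => b.
have psiE : gtprod psi2 n.+1 (arr x t) =
   \prod_(1 <= j < n.+1.*2) pairprod (penalty 1) (arr x t j.+1) (arr x t j) (uphalf j).
  apply: eq_bigr => j _; apply: eq_bigr => i _.
  by rewrite /psi2 /psi /penalty mul1r -expRD -opprD.
have g0 : 0 <= gtprod psi2 n.+1 (arr x t) by rewrite gtprod_psi2 expR_ge0.
rewrite -psiE in b; rewrite /limfun normrM [`|gtprod _ _ _|]ger0_norm//.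
apply: (@le_trans _ _ (gtprod psi2 n.+1 (arr x t))); first exact: ler_piMl.
apply: le_trans b _; rewrite le_eqVlt; apply/orP; left; apply/eqP; congr (_ * _ ^+ _ * _).
  rewrite /row_weight (_ : uphalf n.+1.*2 = n.+1); last by lia.
  apply: eq_big_nat => i ik; rewrite /arr eqxx (_ : uphalf n.+1.*2 = n.+1); last by lia.
  by rewrite -(ltnS i) ik.
by rewrite /tdecay; apply: eq_bigr => l _; rewrite (tnth_nth 0).
Qed.

Lemma measurable_arr n (x : 'rV[R]_n) k i :
  measurable_fun setT (fun t : (woffset n.*2).-tuple (measurableTypeR R) => arr x t k i).
Proof.
rewrite /arr; case: (1 <= i <= uphalf k)%N => //; case: (k == n.*2) => //.
have [h|h] := ltnP (woffset k + i.-1) (woffset n.*2).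
  rewrite (_ : (fun t => _) = (fun t : (woffset n.*2).-tuple _ => tnth t (Ordinal h))).
    exact: measurable_tnth.
  by apply/funext => t; rewrite (tnth_nth 0).
rewrite (_ : (fun t => _) = cst 0) //.
by apply/funext => t; rewrite nth_default// size_tuple.
Qed.

Lemma measurable_limfun (phi : R -> R) n (lam x : 'rV[R]_n) :
  measurable_fun setT phi -> measurable_fun setT (limfun phi lam x).
Proof.
move=> mphi; apply: measurable_funM.
  apply: measurableT_comp => //; apply: measurable_sum => k.
  have mr m r : measurable_fun setT (fun t : (woffset n.*2).-tuple (measurableTypeR R) => rowsum (arr x t m) r).
    by apply: measurable_sum => i; exact: measurable_arr.
  apply: measurable_funM => //; rewrite /wt_exponent.
  apply: measurable_funB => //; apply: measurable_funB => //; exact: measurable_funM.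
under eq_fun do rewrite gtprod_psi2.
apply: measurableT_comp => //; apply: measurableT_comp => //.
apply: measurable_sum => j; apply: measurable_sum => i.
by apply: measurable_funD; apply: measurableT_comp => //; apply: measurable_funB; exact: measurable_arr.
Qed.

Lemma integrable_limfun (phi : R -> R) n (lam x : 'rV[R]_n) : (0 < n)%N -> measurable_fun setT phi ->
  (forall u, `|phi u| <= 1) ->
  (measure_pow (@lebesgue_measure R) (woffset n.*2)).-integrable setT (EFin \o limfun phi lam x).
Proof.
move=> n0 mphi phi1; have [C C0 [D HD]] := limfun_bound n0.
set K := C * (\prod_(1 <= i < n.+1) (1 + crd x i ^+ 2)) ^+ D.
have Ki := integrableZl measurableT K (@integrable_tdecay R (woffset n.*2)).
apply: le_integrable Ki => //; first by apply/measurable_EFinP; exact: measurable_limfun.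
move=> t _ /=; rewrite lee_fin; apply: le_trans (HD _ _ _ _ phi1) _.
exact: ler_norm.
Qed.

Lemma crdprod_le n (x : 'rV[R]_n) B : (forall i, `|crd x i| <= B) ->
  \prod_(1 <= i < n.+1) (1 + crd x i ^+ 2) <= (1 + B ^+ 2) ^+ n.
Proof.
move=> xB; have B0 : 0 <= B := le_trans (normr_ge0 _) (xB 0%N).
have -> : (1 + B ^+ 2) ^+ n = \prod_(1 <= i < n.+1) (1 + B ^+ 2) by rewrite prodr_const_nat subn1.
apply: ler_prod => i _; rewrite (le_trans ler01 (oneDsq_ge1 _))//= lerD2l.
by rewrite -(@real_normK R (crd x i)) ?num_real// lerXn2r ?nnegrE.
Qed.

Lemma expR_decay_le1 (c u : R) : 0 < c -> 0 <= expR (- c * expR u) <= 1.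
Proof.
by move=> c0; rewrite expR_ge0 -expR0 ler_expR mulNr oppr_le0 mulr_ge0 ?expR_ge0// ltW.
Qed.

(** Otherwise there is a sequence of eps and x violating the estimate, to which
    dominated convergence applies: the differences tend to 0 pointwise even though
    x varies, by [stepfun_near]. *)
Lemma step_integral_near (phi : R -> R) n (lam : 'rV[R]_n) (B d : R) : (0 < n)%N ->
  measurable_fun setT phi -> (forall u, `|phi u| <= 1) ->
  (forall u v, `|phi u - phi v| <= `|u - v|) -> 0 <= B -> 0 < d ->
  exists2 e0 : R, 0 < e0 & forall eps (x : 'rV[R]_n) sh, 0 < eps < e0 -> scaled_dom eps x ->
    shifts n eps sh -> (forall i, `|crd x i| <= B) ->
    let mN := measure_pow (@lebesgue_measure R) (woffset n.*2) in
    `|(\int[mN]_t stepfun phi lam eps x (zfloor eps x) sh t) - \int[mN]_t limfun phi lam x t| < d.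
Proof.
move=> n0 mphi phi1 phiL B0 d0; set mN := measure_pow _ _; apply: contrapT => H.
have [C [c [e1 [D [C0 c0 e10 HS]]]]] := stepfun_bound n0.
have [C' C'0 [D' HL]] := limfun_bound n0.
(* shrinking eps below 1 / (k + 1) along the sequence *)
pose bad (k : nat) (p : R * 'rV[R]_n * (nat -> int)) :=
  [/\ 0 < p.1.1 < Num.min e1 (k.+1%:R^-1), scaled_dom p.1.1 p.1.2, shifts n p.1.1 p.2,
      forall i, `|crd p.1.2 i| <= B &
      d <= `|(\int[mN]_t stepfun phi lam p.1.1 p.1.2 (zfloor p.1.1 p.1.2) p.2 t)
             - \int[mN]_t limfun phi lam p.1.2 t|].
have /choice[p Hp] : forall k, exists p, bad k p.
  move=> k; apply: contrapT => Nb; apply: H.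
  exists (Num.min e1 (k.+1%:R^-1)); first by rewrite lt_min e10 invr_gt0 ltr0n.
  move=> eps x sh e0 dom shE xB /=; rewrite ltNge; apply/negP => h.
  by apply: Nb; exists (eps, x, sh); split.
pose f k t : R := `|stepfun phi lam (p k).1.1 (p k).1.2 (zfloor (p k).1.1 (p k).1.2) (p k).2 t
                - limfun phi lam (p k).1.2 t|.
pose W := (1 + B ^+ 2) ^+ n.
pose K := C * W ^+ D + C' * W ^+ D'.
have ek k : 0 < (p k).1.1 < e1 /\ (p k).1.1 < k.+1%:R^-1.
  by have [/andP[-> ]] := Hp k; rewrite lt_min => /andP[-> ->].
have Si k : mN.-integrable setT (EFin \o stepfun phi lam (p k).1.1 (p k).1.2 (zfloor (p k).1.1 (p k).1.2) (p k).2).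
  have [_ dom shE _ _] := Hp k; have [/andP[h0 _] _] := ek k.
  by have [I _ _] := Psi_eps_integral lam n0 h0 dom shE; exact: I.
have Li k : mN.-integrable setT (EFin \o limfun phi lam (p k).1.2).
  exact: integrable_limfun.
have Di k : mN.-integrable setT (EFin \o (fun t => stepfun phi lam (p k).1.1 (p k).1.2 (zfloor (p k).1.1 (p k).1.2) (p k).2 t
                - limfun phi lam (p k).1.2 t)).
  by apply: integrableB (Si k) (Li k).
have fi k : mN.-integrable setT (EFin \o f k) by exact: integrable_norm (Di k).
have Wk k : \prod_(1 <= i < n.+1) (1 + crd (p k).1.2 i ^+ 2) <= W.
  by have [_ _ _ xB _] := Hp k; exact: crdprod_le.
have fK k t : f k t <= K * tdecay t.
  have [_ dom shE _ _] := Hp k; have [e01 _] := ek k.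
  apply: le_trans (ler_normB _ _) _; rewrite /K mulrDl; apply: lerD.
    apply: le_trans (HS _ _ _ _ _ _ phi1 e01 dom shE) _.
    rewrite ler_wpM2r ?tdecay_ge0//.
    apply: (@le_trans _ _ (C * (\prod_(1 <= i < n.+1) (1 + crd (p k).1.2 i ^+ 2)) ^+ D)).
      rewrite ler_piMr//; last by apply: bigprod_le1 => i; exact: expR_decay_le1.
      by rewrite mulr_ge0 ?(ltW C0)// exprn_ge0// (le_trans ler01)// prod_oneDsq_ge1.
    rewrite ler_pM2l// lerXn2r ?nnegrE ?(le_trans ler01 (prod_oneDsq_ge1 _ _))//.
    by rewrite (le_trans _ (Wk k)) ?(le_trans ler01 (prod_oneDsq_ge1 _ _)).
  apply: le_trans (HL _ _ _ _ phi1) _; rewrite ler_wpM2r ?tdecay_ge0//.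
  rewrite ler_pM2l// lerXn2r ?nnegrE ?(le_trans ler01 (prod_oneDsq_ge1 _ _))//.
  by rewrite (le_trans _ (Wk k)) ?(le_trans ler01 (prod_oneDsq_ge1 _ _)).
have f0 t : f k t @[k --> \oo] --> (0 : R).
  apply/cvgrPdist_le => e e_gt0.
  have [e2 e20 N2] := stepfun_near lam t phi1 phiL B0 e_gt0.
  near=> k; rewrite sub0r normrN /f normr_id.
  have [_ dom shE xB _] := Hp k; have [/andP[h0 _] hk] := ek k.
  apply: N2 => //; rewrite h0 /=; apply: lt_trans hk _.
  near: k; exact: near_infty_natSinv_lt (PosNum e20).
have [||||| _ I0 _] := @dominated_convergence _ _ _ mN setT measurableT
  (fun k => EFin \o f k) (cst 0%E) (fun t => (K * tdecay t)%:E).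
- by move=> k; exact: measurable_int (fi k).
- exact: measurable_cst.
- by apply: aeW => t _; apply: cvg_EFin; [exact: nearW|exact: f0].
- by have := integrableZl measurableT K (@integrable_tdecay R (woffset n.*2)).
- by apply: aeW => t k _ /=; rewrite lee_fin normr_id; exact: fK.
have /fine_cvgP[_ /cvgrPdist_lt/(_ d d0)[k _ /(_ k (leqnn k))]] := I0.
rewrite sub0r normrN /=; apply/negP; rewrite -leNgt.
have [_ _ _ _ hd] := Hp k; apply: le_trans hd _.
rewrite -RintegralB//; apply: le_trans (le_normr_Rintegral _ _) _ => //.
apply: le_trans _ (ler_norm _); rewrite le_eqVlt; apply/orP; left; apply/eqP.
rewrite /Rintegral; congr fine; apply: eq_integral => t _ /=.
by rewrite subr0 /f normr_id.
Unshelve. all: end_near.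
Qed.

Lemma normc_le (z : R[i]) : ComplexField.Normc.normc z <= `|complex.Re z| + `|complex.Im z|.
Proof.
case: z => a b /=; rewrite -(ler_pXn2r (n := 2)) ?nnegrE ?sqrtr_ge0 ?addr_ge0//.
rewrite sqr_sqrtr ?addr_ge0 ?sqr_ge0// -(@real_normK R a) ?num_real// -(@real_normK R b) ?num_real//.
by rewrite sqrrD lerD2r lerDl mulrn_wge0// mulr_ge0.
Qed.

(** Integrate [stepfun_bound]. *)
Lemma Psi_eps_bound n : (0 < n)%N -> exists C c e0 : R, exists D : nat,
  [/\ 0 < C, 0 < c, 0 < e0 & forall (lam x : 'rV[R]_n) eps, 0 < eps < e0 -> scaled_dom eps x ->
    ComplexField.Normc.normc (Psi_eps lam eps x) <=
    C * (\prod_(1 <= i < n.+1) (1 + crd x i ^+ 2)) ^+ D *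
      (\prod_(1 <= i < n.+1) expR (- c * expR (- (crd x i - crd x i.+1) / 2)))].
Proof.
move=> n0; have [C [c [e0 [D [C0 c0 e00 H]]]]] := stepfun_bound n0.
exists (2 * C * pi ^+ woffset n.*2), c, e0, D; split=> //.
  by rewrite !mulr_gt0// exprn_gt0// pi_gt0.
move=> lam x eps ee dom; have [sh shE] := shifts_exist n eps.
set W := _ ^+ D; set E := \prod_(1 <= i < n.+1) expR _.
pose mN := measure_pow (@lebesgue_measure R) (woffset n.*2).
have [Si ReE ImE] := Psi_eps_integral lam n0 (proj1 (andP ee)) dom shE.
have B phi : (forall u, `|phi u| <= 1) ->
    `|\int[mN]_t stepfun phi lam eps x (zfloor eps x) sh t| <= C * W * E * pi ^+ woffset n.*2.
  move=> phi1; apply: le_trans (le_normr_Rintegral _ (Si phi)) _ => //.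
  have Ki := integrableZl measurableT (C * W * E) (@integrable_tdecay R (woffset n.*2)).
  have -> : C * W * E * pi ^+ woffset n.*2 = \int[mN]_t (C * W * E * tdecay t).
    rewrite RintegralZl//; last exact: integrable_tdecay.
    by congr (_ * _); rewrite /Rintegral integral_tdecay.
  apply: le_Rintegral => //; first exact: integrable_norm (Si phi).
  by move=> t _; exact: H.
apply: le_trans (normc_le _) _; rewrite ReE ImE.
have -> : 2 * C * pi ^+ woffset n.*2 * W * E =
    C * W * E * pi ^+ woffset n.*2 + C * W * E * pi ^+ woffset n.*2 by ring.
by apply: lerD; apply: B; [exact: cos_norm_le1|exact: sin_norm_le1].
Qed.

Lemma Psi_eps_near n (lam : 'rV[R]_n) (B d : R) : (0 < n)%N -> 0 <= B -> 0 < d ->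
  exists2 e0 : R, 0 < e0 & forall eps (x : 'rV[R]_n), 0 < eps < e0 -> scaled_dom eps x ->
    (forall i, `|crd x i| <= B) ->
    ComplexField.Normc.normc
      (Psi_eps lam eps x - Psi_so (\row_(l < n) (0 +i* crd lam l.+1)) x) < d.
Proof.
move=> n0 B0 d0; have d2 : 0 < d / 2 by rewrite divr_gt0.
have mc : measurable_fun setT (@cos R) by apply: continuous_measurable_fun; exact: continuous_cos.
have ms : measurable_fun setT (@sin R) by apply: continuous_measurable_fun; exact: continuous_sin.
have [e1 e10 H1] := step_integral_near lam n0 mc cos_norm_le1 cos_lipschitz1 B0 d2.
have [e2 e20 H2] := step_integral_near lam n0 ms sin_norm_le1 sin_lipschitz1 B0 d2.
exists (Num.min e1 e2) => [|eps x]; first by rewrite lt_min e10.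
rewrite lt_min => /andP[e0 /andP[ee1 ee2]] dom xB; have [sh shE] := shifts_exist n eps.
have [_ ReE ImE] := Psi_eps_integral lam n0 e0 dom shE.
have L1 := H1 eps x sh; rewrite e0 ee1 in L1; have {}L1 := L1 isT dom shE xB.
have L2 := H2 eps x sh; rewrite e0 ee2 in L2; have {}L2 := L2 isT dom shE xB.
have ReB (a b : R[i]) : complex.Re (a - b) = complex.Re a - complex.Re b by case: a; case: b.
have ImB (a b : R[i]) : complex.Im (a - b) = complex.Im a - complex.Im b by case: a; case: b.
apply: le_lt_trans (normc_le _) _; rewrite Psi_soE ReB ImB ReE ImE.
by rewrite (splitr d); apply: ltrD.
Qed.

End Phase.

Lemma compact_crd (R : realType) n (K : set 'rV[R]_n) : compact K -> 
  exists2 B : R, 0 <= B & forall x : 'rV[R]_n, K x -> forall i, `|crd x i| <= B.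
Proof.
move=> /compact_bounded[M [_ HM]]; exists (`|M| + 1); first by rewrite addr_ge0.
move=> x Kx i; have xM : mx_norm x <= `|M| + 1.
  by apply: HM => //; rewrite (le_lt_trans (ler_norm _))// ltrDl.
case: i => [|i]; first by rewrite normr0 addr_ge0.
rewrite /crd; case: insubP => [j _ _|_]; last by rewrite normr0 addr_ge0.
apply: le_trans xM; rewrite mx_normrE; apply/bigmax_geP; right => /=.
by exists (ord0, j).
Qed.

(** * The estimate and the limit *)

Theorem theorem7p2p3 (R : realType) (n : nat) (hn : (1 <= n)%N) :
  (forall s : {set 'I_n},
     exists (P : mpoly.mpoly n R) (c eps0 : R),
       0 < c /\ 0 < eps0 /\
       forall (lam : 'rV[R]_n) (eps : R) (x : 'rV[R]_n),
         0 < eps < eps0 -> scaled_dom eps x -> sigma x = s ->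
         ComplexField.Normc.normc (Psi_eps lam eps x) <=
           mpoly.meval (fun i : 'I_n => x ord0 i) P *
           \prod_(i in s) expR (- c * expR (- (crd x i.+1 - crd x i.+2) / 2)))
  /\
  (forall (lam : 'rV[R]_n) (K : set 'rV[R]_n), compact K ->
     forall delta : R, 0 < delta ->
       \forall eps \near 0^'+,
         forall x : 'rV[R]_n, K x -> scaled_dom eps x ->
           ComplexField.Normc.normc
             (Psi_eps lam eps x -
              Psi_so (\row_(l < n) (0 +i* crd lam l.+1)) x) < delta).
Proof.
split=> [s|lam K cK d d0].
  have [C [c [e0 [D [C0 c0 e00 H]]]]] := Psi_eps_bound R hn.
  pose P : mpoly.mpoly n R := mpoly.mpolyC n C *
    (\prod_(i < n) (1 + mpoly.mpolyX R (mpoly.mnm1 i) ^+ 2)) ^+ D.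
  have evE (x : 'rV[R]_n) (i : 'I_n) : mpoly.meval (fun i => x ord0 i)
      (1 + mpoly.mpolyX R (mpoly.mnm1 i) ^+ 2) = 1 + crd x i.+1 ^+ 2.
    by rewrite mpoly.mevalD mpoly.meval1 expr2 mpoly.mevalM mpoly.mevalXU crdE.
  exists P, c, e0; do 2 split=> //; move=> lam eps x ee dom _.
  apply: le_trans (H lam x eps ee dom) _.
  have -> : mpoly.meval (fun i : 'I_n => x ord0 i) P =
      C * (\prod_(1 <= i < n.+1) (1 + crd x i ^+ 2)) ^+ D.
    rewrite /P mpoly.mevalM mpoly.mevalC rmorphXn rmorph_prod; congr (_ * _ ^+ _).
    rewrite big_add1 big_mkord; apply: eq_bigr => i _.
    exact: evE.
  apply: ler_wpM2l.
    by rewrite mulr_ge0 ?(ltW C0)// exprn_ge0// (le_trans ler01)// prod_oneDsq_ge1.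
  rewrite big_add1 big_mkord [leRHS]big_mkcond /=; apply: ler_prod => i _.
  by rewrite expR_ge0 /=; case: ifP => // _; have /andP[] := expR_decay_le1 (- (crd x i.+1 - crd x i.+2) / 2) c0.
have [B B0 KB] := compact_crd cK.
have [e0 e00 H] := Psi_eps_near lam hn B0 d0.
apply/near_right0P; exists e0 => // eps ee x Kx dom.
by apply: H => //; exact: KB.
Qed.
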